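(* In the large $n$ limit, suppose $k$ and $p$ satisfy $k/n<1-2\log(\sqrt{1-p}+\sqrt p)$ and $(\varepsilon/n)^{1-\frac kn}=o(1/n)$. Then the expected Choi error of the random codes formed by $\mathfrak C_n^\varepsilon$ against the strength-$p$ 1D nearest-neighbour $ZZ$-coupling noise satisfies $$\mathbb E_{U\sim\mathfrak C_n^\varepsilon}\epsilon_{\mathrm{Choi}}\le\left(2^{-n\left(1-2\log(\sqrt{1-p}+\sqrt p)-\frac kn\right)}+\frac{4\varepsilon^{1-\frac kn}n^{\frac kn}}{\log(n/\varepsilon)}\right)^{\frac14}.$$ That is, the 1D $O(\log n)$-depth double-layer blocked circuits can achieve an encoding rate $1-2\log(\sqrt{1-p}+\sqrt p)$ for strength-$p$ 1D nearest-neighbour $ZZ$-coupling noise.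
   Context: All logarithms are base 2. ''In the large $n$ limit'' means for sufficiently large $n$. Achieving an encoding rate means that for constant rates $k/n$ strictly below that value, parameters can be chosen so that the circuit depth is $O(\log n)$ and the expected Choi error tends to $0$ as $n\to\infty$. Double-layer blocked ensemble $\mathfrak C_n^\varepsilon$: $n$ qubits on a line are divided into $2N$ consecutive regions of $\xi=n/2N$ qubits each, with $\xi=\log(n/\varepsilon)$. $U=U_2U_1$ with $U_1=\bigotimes_{i=1}^NU_C^{2i-1,2i}$, $U_2=\bigotimes_{i=1}^{N-1}U_C^{2i,2i+1}$, where the $U_C^{j,j+1}$ are independent uniformly random Clifford unitaries on the $2\xi$ qubits of regions $j,j+1$. Such a Clifford is implementable in 1D depth $O(\xi)$, so the circuit depth is $O(\log(n/\varepsilon))$. Each region contains $\frac kn\xi$ logical qubits and $\frac{n-k}n\xi$ ancillary qubits in $|0\rangle$. Choi error: $L$ is the $k$-qubit logical system, $S$ the $n$-qubit physical system, $R$ a $k$-qubit reference, $\hat\phi_{LR}$ the maximally entangled state, $\mathcal E(\rho)=U(\rho\otimes|0^{n-k}\rangle\langle0^{n-k}|)U^\dagger$ the encoding. For a noise channel $\mathcal N$ on $S$, $\epsilon_{\mathrm{Choi}}=\min_{\mathcal D}P(\hat\phi_{LR},[(\mathcal D\circ\mathcal N\circ\mathcal E)_L\otimes I_R](\hat\phi_{LR}))$, the minimum being over quantum (decoding) channels $\mathcal D$ from $S$ to $L$, with $P=\sqrt{1-F^2}$ and $F(\rho,\sigma)=\Vert\sqrt\rho\sqrt\sigma\Vert_1$.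 Strength-$p$ 1D nearest-neighbour $ZZ$-coupling noise ($p$ a probability): $\mathcal N_{zz}$ is the composition over $i=1,\dots,n-1$ of the channels $\rho\mapsto(1-p)\rho+pZ_iZ_{i+1}\rho Z_iZ_{i+1}$, where $Z_i$ is Pauli $Z$ on qubit $i$ of the line. *)

(* Defs.v *)
From mathcomp Require Import all_boot all_order all_algebra finmap.
From mathcomp Require Import complex.
From mathcomp Require Import all_classical all_reals all_analysis.

Set Implicit Arguments.
Unset Strict Implicit.
Unset Printing Implicit Defensive.

Import Order.TTheory GRing.Theory Num.Theory.
Import numFieldNormedType.Exports.

Local Open Scope classical_set_scope.
Local Open Scope ring_scope.
Local Open Scope sesquilinear_scope.

Definition log2 {R : realType} (x : R) : R := ln x / ln 2.

Notation bits n := (n.-tuple bool).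

(* Matrices are indexed by ordinals in MathComp; rows and columns of [op T] are
   labelled by the elements of [T] through [enum_rank].  The composite of the
   systems with bases [S] and [T] has basis [S * T]. *)
Definition op (R : realType) (T : finType) := 'M[R[i]]_#|T|.

Section Operators.
Variable R : realType.
Local Notation C := R[i].
Local Notation op := (op R).

Definition mkop (T : finType) (f : T -> T -> C) : op T :=
  \matrix_(i, j) f (enum_val i) (enum_val j).

Definition entry (T : finType) (A : op T) (x y : T) : C :=
  A (enum_rank x) (enum_rank y).

Definition psd (T : finType) (A : op T) : Prop :=
  forall v : 'rV[C]_#|T|, 0 <= (v *m A *m v ^t*) 0 0.

(* The square root of a positive semidefinite matrix, through its spectral
   decomposition [A = P^-1 *m diag_mx d *m P] with [P] unitary. *)
Definition sqrtmx (T : finType) (A : op T) : op T :=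
  let P := spectralmx A in
  invmx P *m diag_mx (map_mx sqrtC (spectral_diag A)) *m P.

Definition trnorm (T : finType) (A : op T) : R :=
  complex.Re (\tr (sqrtmx (A ^t* *m A))).

Definition fidelity (T : finType) (rho sigma : op T) : R :=
  trnorm (sqrtmx rho *m sqrtmx sigma).

Definition purified_distance (T : finType) (rho sigma : op T) : R :=
  Num.sqrt (1 - fidelity rho sigma ^+ 2).

(* [F (x) id]: apply [F] to each [S]-block of an operator on [S (x) Q]. *)
Definition tens_id (S T Q : finType) (F : op S -> op T) (M : op (S * Q)%type) :
    op (T * Q)%type :=
  mkop (fun x y =>
    entry (F (mkop (fun s t => entry M (s, x.2) (t, y.2)))) x.1 y.1).

Definition is_channel (S T : finType) (F : op S -> op T) : Prop :=
  [/\ forall (a : C) (A B : op S), F (a *: A + B) = a *: F A + F B,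
      forall A : op S, \tr (F A) = \tr A
    & forall (d : nat) (M : op (S * 'I_d)%type), psd M -> psd (tens_id F M)].

Definition max_entangled (T : finType) : op (T * T)%type :=
  mkop (fun x y => ((x.1 == x.2) && (y.1 == y.2))%:R / #|T|%:R).

(* [enc] is the encoding channel from [L] to [S].  The minimum over decoders is
   attained (the set of channels is compact), so it is the infimum. *)
Definition choi_error (L S : finType) (noise : op S -> op S)
    (enc : op L -> op S) : R :=
  inf [set purified_distance (max_entangled L)
             (tens_id (D \o noise \o enc) (max_entangled L))
      | D in [set D : op S -> op L | is_channel D]].

(* [emb n o A] is the operator on [n] qubits acting as [A] on the [w]
   consecutive qubits [o, o + 1, ..., o + w - 1] and trivially elsewhere
   (meant for [o + w <= n]). *)
Definition slice (n w o : nat) (x : bits n) : bits w :=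
  [tuple nth false x (o + t)%N | t < w].

Definition emb (n w o : nat) (A : op (bits w)) : op (bits n) :=
  mkop (fun x y => entry A (slice w o x) (slice w o y) *
    [forall i : 'I_n, ~~ (o <= i < o + w)%N ==> (tnth x i == tnth y i)]%:R).

Variant pauli := PauliI | PauliX | PauliY | PauliZ.

Definition pauli_entry (P : pauli) (x y : bool) : C :=
  match P with
  | PauliI => (x == y)%:R
  | PauliX => (x != y)%:R
  | PauliY => (x != y)%:R * (if x then 'i else - 'i)
  | PauliZ => (x == y)%:R * (if x then - 1 else 1)
  end.

Definition pauli_string (n : nat) (s : 'I_n -> pauli) : op (bits n) :=
  mkop (fun x y => \prod_(i < n) pauli_entry (s i) (tnth x i) (tnth y i)).

Definition pauli_group (n : nat) : set (op (bits n)) :=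
  [set A | exists (a : nat) (s : 'I_n -> pauli), A = 'i ^+ a *: pauli_string s].

(* The Clifford group up to global phases.  Requiring determinant 1 leaves
   exactly [2 ^ n] elements of each class modulo global phase (they differ by
   the [2 ^ n]-th roots of unity), so this set is finite and its uniform
   distribution induces the uniform one on the Clifford group modulo phases. *)
Definition clifford (n : nat) : set (op (bits n)) :=
  [set U | [/\ U \is unitarymx, \det U = 1 &
    [set U *m P *m U ^t* | P in @pauli_group n] = @pauli_group n]].

(* One layer: two-qubit gates on disjoint pairs [(i, i + 1)], [i \in I]. *)
Definition nn_layer (n : nat) (V : op (bits n)) : Prop :=
  exists (I : {set 'I_n}) (g : 'I_n -> op (bits 2)),
    [/\ forall i : 'I_n, i \in I -> (i.+1 < n)%N,
        forall i j : 'I_n, i \in I -> j \in I -> j != i.+1 :> nat,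
        forall i : 'I_n, i \in I -> g i \is unitarymx
      & V = \big[mulmx/1%:M]_(i in I) emb n i (g i)].

Definition nn_depth_le (d n : nat) (U : op (bits n)) : Prop :=
  exists Vs : d.-tuple (op (bits n)),
    (forall j, nn_layer (tnth Vs j)) /\ U = \big[mulmx/1%:M]_(V <- Vs) V.

(* Qubits are numbered from 0, so the couplings are [Z_i Z_(i+1)], [i < n - 1]. *)
Definition pauliZ_at (n i : nat) : op (bits n) :=
  pauli_string (fun j : 'I_n => if j == i :> nat then PauliZ else PauliI).

Definition zz_coupling (p : R) (n i : nat) (rho : op (bits n)) : op (bits n) :=
  let ZZ := pauliZ_at n i *m pauliZ_at n i.+1 in
  (1 - p)%:C%C *: rho + p%:C%C *: (ZZ *m rho *m ZZ).

Definition zz_noise (p : R) (n : nat) : op (bits n) -> op (bits n) :=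
  \big[comp/id]_(i < n.-1) zz_coupling p i.

End Operators.

Arguments pauli_group : clear implicits.
Arguments clifford : clear implicits.
Arguments zz_noise {R} p n.

Definition uniform_mean (R : realType) (T : choiceType) (A : set T)
    (f : T -> R) : R :=
  (\sum_(x <- fset_set A) f x) / #|` fset_set A|%:R.

(* [n] qubits in [2 N] consecutive regions of [xi = log (n / eps)] qubits, of
   which [kappa = (k / n) xi] are logical.  All these numbers being integers,
   [eps = n / 2 ^ xi] varies with [n]. *)
Record dl_params (R : realType) := DLParams {
  dl_n : nat;
  dl_k : nat;
  dl_eps : R;
  dl_N : nat;
  dl_xi : nat;
  dl_kappa : nat;
  dl_N_gt0 : (0 < dl_N)%N;
  dl_xi_gt0 : (0 < dl_xi)%N;
  dl_eps_gt0 : 0 < dl_eps;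
  dl_nE : dl_n = (2 * dl_N * dl_xi)%N;
  dl_xiE : dl_xi%:R = log2 (dl_n%:R / dl_eps);
  dl_kappaE : dl_kappa%:R = dl_k%:R / dl_n%:R * dl_xi%:R :> R }.

Section DoubleLayer.
Variables (R : realType) (c : dl_params R).
Local Notation n := (dl_n c).
Local Notation k := (dl_k c).
Local Notation N := (dl_N c).
Local Notation xi := (dl_xi c).
Local Notation kappa := (dl_kappa c).

(* The gates [U_C^{2i-1,2i}] (first component) and [U_C^{2i,2i+1}] (second). *)
Definition dl_gates : choiceType :=
  ({ffun 'I_N -> op R (bits (2 * xi)%N)} *
   {ffun 'I_N.-1 -> op R (bits (2 * xi)%N)})%type.

(* Uniform distribution on this product set: independent uniform gates. *)
Definition dl_support : set dl_gates :=
  [set g : dl_gates | (forall i, clifford R (2 * xi) (g.1 i)) /\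
                      (forall i, clifford R (2 * xi) (g.2 i))].

Definition dl_unitary (g : dl_gates) : op R (bits n) :=
  (\big[mulmx/1%:M]_(i < N.-1) emb n ((2 * i + 1) * xi)%N (g.2 i)) *m
  (\big[mulmx/1%:M]_(i < N) emb n (2 * i * xi)%N (g.1 i)).

(* The logical qubits are placed, in order, on the first [kappa] qubits of each
   region; the other qubits are ancillas. *)
Definition logical_part (x : bits n) : bits k :=
  [tuple nth false x (l %/ kappa * xi + l %% kappa)%N | l < k].

Definition ancillas0 (x : bits n) : bool :=
  [forall i : 'I_n, (kappa <= i %% xi)%N ==> ~~ tnth x i].

Definition with_ancillas (rho : op R (bits k)) : op R (bits n) :=
  mkop (fun x y => entry rho (logical_part x) (logical_part y) *
                   (ancillas0 x && ancillas0 y)%:R).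

Definition encoding (U : op R (bits n)) (rho : op R (bits k)) :
    op R (bits n) :=
  U *m with_ancillas rho *m U ^t*.

Definition expected_choi_error (noise : op R (bits n) -> op R (bits n)) : R :=
  uniform_mean dl_support
    (fun g => choi_error noise (encoding (dl_unitary g))).

End DoubleLayer.

Arguments dl_support {R} c.
Arguments dl_unitary {R} c g.
Arguments expected_choi_error {R} c noise.

(* The constant rates [k / n] are exactly the rationals; [n] tends to infinity
   along the sizes for which the regions consist of integer numbers of qubits.
   The depth bound holds for every circuit of the ensemble, not on average. *)
Definition achieves_rate (R : realType)
    (noise : forall n, op R (bits n) -> op R (bits n)) (r0 : R) : Prop :=
  forall r : rat, 0 <= r -> ratr r < r0 ->
  exists (c : nat -> dl_params R) (d : nat -> nat),
    [/\ (dl_n (c m))%:R @[m --> \oo] --> (+oo : set_system R),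
        forall m, (dl_k (c m))%:R / (dl_n (c m))%:R = ratr r :> R,
        forall m g, dl_support (c m) g -> nn_depth_le (d m) (dl_unitary (c m) g),
        (fun m => (d m)%:R : R) =O_\oo (fun m => log2 (dl_n (c m))%:R : R)
      & expected_choi_error (c m) (noise _) @[m --> \oo] --> (0 : R)].

Definition zz_rate (R : realType) (p : R) : R :=
  1 - 2 * log2 (Num.sqrt (1 - p) + Num.sqrt p).

(* Main.v *)
(** If two errors cannot be confused (their product is detected by the code) they
    can be corrected simultaneously, so correcting the errors more likely than
    everything they can be confused with gives a decoder whose entanglement fidelity
    is the probability of that set.  By [pr a <= sqrt (pr a * pr b)] the failure
    probability is at most the sum over nontrivial undetected coupling patterns [b]
    of the Bhattacharyya coefficients [beta ^ |b|], [beta = 2 sqrt (p (1 - p))], and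
    [1 + beta = (sqrt p + sqrt (1 - p))^2].  A random Clifford sends a nontrivial
    Pauli of its block to a uniform one, which is undetected, or trivial on one of
    the two regions, with probability of order [eta ^ 2], [eta = 2 ^ - (xi - kappa)].
    Averaging over both layers leaves an Ising chain on the [2 N] regions with weight
    [g * eta], [g = (1 + beta) ^ xi], per active region and [eta] per domain wall:
    the fully active chain is the first term of the bound, the walls are the second.

    For the depth, two staircases of two-qubit Cliffords peel a Clifford off one qubit;
    the staircases for successive qubits run in a pipeline, in linear depth. *)
Require Import Defs.
From HB Require Import structures.
From mathcomp Require Import all_boot all_order all_algebra finmap.
From mathcomp Require Import complex.
From mathcomp Require Import all_classical all_reals all_analysis.
From mathcomp Require Import ring lra zify.

Set Implicit Arguments.
Unset Strict Implicit.
Unset Printing Implicit Defensive.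

Import Order.TTheory GRing.Theory Num.Theory.
Import numFieldNormedType.Exports.

Local Open Scope classical_set_scope.
Local Open Scope ring_scope.
Local Open Scope sesquilinear_scope.

(** * Matrix entries, Kraus operators and fidelity *)

(** The exponent 1/4 leaves room. A Choi error is at most the square root of a failure probability,
    so concavity gives the square root of the sum [delta] of the two terms; this is below
    [delta^(1/4)] when [delta < 1], and otherwise the error is at most 1. Errors are pulled back
    through the encoder: conjugation by [U2 U1] meets the second layer first, which leaves the two
    end regions alone and scrambles the inner ones in cells [(2j+1, 2j+2)]; the first layer then
    acts on blocks [(2i, 2i+1)], where detection is decided. Each gate contributes [eta ^ 2] because
    it acts on two regions, and this square is shared out between active regions and walls. The
    smallness condition on [(eps/n)^(1-k/n)], which is [eta], bounds [N * eta], so that walls can be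
    counted to first order. The randomness of the gates enters only through transitivity of the
    Clifford group on nontrivial Paulis. *)

HB.instance Definition _ (A : pzSemiRingType) n :=
  Monoid.isLaw.Build 'M[A]_n 1%:M (@mulmx A n n n)
    (@mulmxA A n n n n) (@mul1mx A n n) (@mulmx1 A n n).

Section MatrixEntries.
Variable C : numClosedFieldType.

(** [entry] for rectangular matrices, convertible to it on [op]; Kraus operators and encoding
    isometries link different systems. *)
Definition ment (S T : finType) (A : 'M[C]_(#|S|, #|T|)) (x : S) (y : T) : C :=
  A (enum_rank x) (enum_rank y).

Definition mkmx (S T : finType) (f : S -> T -> C) : 'M[C]_(#|S|, #|T|) :=
  \matrix_(i, j) f (enum_val i) (enum_val j).

Lemma mentP (S T : finType) (A B : 'M[C]_(#|S|, #|T|)) :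
  ment A =2 ment B -> A = B.
Proof.
move=> AB; apply/matrixP => i j.
by have := AB (enum_val i) (enum_val j); rewrite /ment !enum_valK.
Qed.

Lemma ment_mkmx (S T : finType) (f : S -> T -> C) x y :
  ment (mkmx f) x y = f x y.
Proof. by rewrite /ment mxE !enum_rankK. Qed.

Lemma sum_enum_rank (V : nmodType) (T : finType) (f : 'I_#|T| -> V) :
  \sum_i f i = \sum_(x : T) f (enum_rank x).
Proof.
rewrite (reindex (@enum_rank T)) //.
exact/onW_bij/enum_rank_bij.
Qed.

Lemma ment_mul (S T U : finType) (A : 'M[C]_(#|S|, #|T|))
    (B : 'M[C]_(#|T|, #|U|)) x y :
  ment (A *m B) x y = \sum_z ment A x z * ment B z y.
Proof. by rewrite /ment mxE sum_enum_rank. Qed.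

Lemma ment1 (T : finType) (x y : T) : ment 1%:M x y = (x == y)%:R.
Proof. by rewrite /ment mxE (inj_eq enum_rank_inj). Qed.

Lemma ment_adj (S T : finType) (A : 'M[C]_(#|S|, #|T|)) x y :
  ment (A ^t*) x y = (ment A y x)^*.
Proof. by rewrite /ment !mxE. Qed.

Lemma mentD (S T : finType) (A B : 'M[C]_(#|S|, #|T|)) x y :
  ment (A + B) x y = ment A x y + ment B x y.
Proof. by rewrite /ment !mxE. Qed.

Lemma mentZ (S T : finType) (a : C) (A : 'M[C]_(#|S|, #|T|)) x y :
  ment (a *: A) x y = a * ment A x y.
Proof. by rewrite /ment !mxE. Qed.

Lemma ment0 (S T : finType) x y : ment (0 : 'M[C]_(#|S|, #|T|)) x y = 0.
Proof. by rewrite /ment !mxE. Qed.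

Lemma ment_sum (S T I : finType) (P : pred I) (F : I -> 'M[C]_(#|S|, #|T|)) x y :
  ment (\sum_(i | P i) F i) x y = \sum_(i | P i) ment (F i) x y.
Proof. by rewrite /ment summxE. Qed.

Lemma tr_ment (T : finType) (A : 'M[C]_#|T|) : \tr A = \sum_x ment A x x.
Proof. by rewrite /mxtrace sum_enum_rank. Qed.

Lemma hadj_mul m n p (A : 'M[C]_(m, n)) (B : 'M[C]_(n, p)) :
  (A *m B) ^t* = B ^t* *m A ^t*.
Proof. by rewrite trmx_mul map_mxM. Qed.

Lemma hadjD m n (A B : 'M[C]_(m, n)) : (A + B) ^t* = A ^t* + B ^t*.
Proof. by rewrite linearD map_mxD. Qed.

Lemma hadjB m n (A B : 'M[C]_(m, n)) : (A - B) ^t* = A ^t* - B ^t*.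
Proof. by rewrite linearB map_mxB. Qed.

Lemma hadjZ m n (a : C) (A : 'M[C]_(m, n)) : (a *: A) ^t* = a^* *: A ^t*.
Proof. by rewrite linearZ map_mxZ. Qed.

Lemma hadj1 n : (1%:M : 'M[C]_n) ^t* = 1%:M.
Proof. by rewrite trmx1 map_mx1. Qed.

Lemma hadj_sum m n (I : finType) (P : pred I) (F : I -> 'M[C]_(m, n)) :
  (\sum_(i | P i) F i) ^t* = \sum_(i | P i) (F i) ^t*.
Proof. by apply/matrixP => i j; rewrite !mxE !summxE rmorph_sum; apply: eq_bigr => k _; rewrite !mxE. Qed.

Lemma unitarymx_mulVmx n (U : 'M[C]_n) : U \is unitarymx -> U ^t* *m U = 1%:M.
Proof. by move=> /unitarymxP/mulmx1C. Qed.

Lemma unitarymx_adj n (U : 'M[C]_n) : U \is unitarymx -> U ^t* \is unitarymx.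
Proof. by rewrite trmxC_unitary. Qed.

Lemma unitarymx1 n : (1%:M : 'M[C]_n) \is unitarymx.
Proof. by apply/unitarymxP; rewrite hadj1 mulmx1. Qed.

End MatrixEntries.

Section Fidelity.
Variable R : realType.
Local Notation C := R[i].

(** The spectrum lies in {0, c}, and on both points the root is division by [sqrt c]. This evaluates
    [sqrtmx] on a pure state ([c = 1]) and on the rank-one operator inside the trace norm, whatever
    eigenbasis [spectralmx] picks. *)
Lemma sqrtmx_scaled_idempotent (T : finType) (A : op R T) (c : C) : 0 < c ->
  A ^t* = A -> A *m A = c *: A -> sqrtmx A = (sqrtC c)^-1 *: A.
Proof.
move=> c0 Ah AA; rewrite /sqrtmx.
have Un : A \is normalmx by apply/normalmxP; rewrite Ah.
have /orthomx_spectralP := Un.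
set P := spectralmx A; set d := spectral_diag A => Ae.
have Pu : P \in unitmx := spectral_unit A.
have dE : diag_mx d = P *m A *m invmx P.
  by rewrite [in RHS]Ae !mulmxA mulmxV // mul1mx mulmxK.
have d2 i : d 0 i ^+ 2 = c * d 0 i.
  have : diag_mx d *m diag_mx d = c *: diag_mx d.
    rewrite dE !mulmxA mulmxKV // -(mulmxA P A A) AA -scalemxAr -scalemxAl.
    done.
  rewrite mulmx_diag => /matrixP/(_ i i); rewrite !mxE eqxx !mulr1n.
  by rewrite expr2.
suff -> : diag_mx (map_mx sqrtC d) = (sqrtC c)^-1 *: diag_mx d.
  by rewrite -scalemxAr -scalemxAl -Ae.
apply/matrixP => i j; rewrite !mxE mulrnAr; congr (_ *+ _).
have := d2 i; move/eqP; rewrite expr2 -subr_eq0 -mulrBl mulf_eq0 => /orP[|/eqP->].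
  rewrite subr_eq0 => /eqP->.
  by rewrite -[X in _ = _ * X]sqrtCK expr2 mulKf // sqrtC_eq0 gt_eqF.
by rewrite sqrtC0 mulr0.
Qed.

(** In the eigenbasis the Gram operator is [(P M)(P M)^*], so its eigenvalues are sums of squared
    moduli; their roots are then real, which makes the root Hermitian. *)
Lemma sqrtmx_gram (T : finType) m (M : 'M[C]_(#|T|, m)) (s := sqrtmx (M *m M ^t* : op R T)) :
  s ^t* = s /\ s *m s = M *m M ^t*.
Proof.
set A : op R T := M *m M ^t*.
have Ah : A ^t* = A by rewrite /A hadj_mul trmxCK.
have Un : A \is normalmx by apply/normalmxP; rewrite Ah.
have /orthomx_spectralP := Un; rewrite /s -/A /sqrtmx.
set P := spectralmx A; set d := spectral_diag A => Ae.
have Pu : P \in unitmx := spectral_unit A.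
have PU : P \is unitarymx := spectral_unitarymx A.
have dE : diag_mx d = (P *m M) *m (P *m M) ^t*.
  rewrite hadj_mul !mulmxA -(mulmxA P) -/A -(invmx_unitary PU).
  by rewrite [in RHS]Ae !mulmxA mulmxV // mul1mx mulmxK.
have d0 i : 0 <= d 0 i.
  have /matrixP/(_ i i) := dE.
  rewrite !mxE eqxx mulr1n => ->; apply: sumr_ge0 => j _.
  by rewrite !mxE -normCK exprn_ge0.
split.
  rewrite !hadj_mul (invmx_unitary PU) trmxCK mulmxA; congr (_ *m _ *m _).
  apply/matrixP => i j; rewrite !mxE eq_sym; case: eqP => [->|_]; last by rewrite conjC0.
  by rewrite mulr1n geC0_conj // sqrtC_ge0.
set E := diag_mx _; have EE : E *m E = diag_mx d.
  by rewrite mulmx_diag; congr diag_mx; apply/rowP => i; rewrite !mxE -expr2 sqrtCK.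
by rewrite [RHS]Ae -EE -!mulmxA (mulmxA P) mulmxV // mul1mx.
Qed.

(** For [B = w w^* s] the operator [B^* B] is the rank-one [(s w)(s w)^*], whose nonzero eigenvalue
    is [|s w|^2 = f]; the trace norm is therefore [sqrt f]. *)
Lemma fidelity_rank_one_ge (T : finType) m (w : 'cV[C]_#|T|) (M : 'M[C]_(#|T|, m)) (f : R) :
  w ^t* *m w = 1%:M -> w ^t* *m (M *m M ^t*) *m w = f%:C%C%:M -> 0 <= f ->
  f <= fidelity (w *m w ^t*) (M *m M ^t*) ^+ 2.
Proof.
move=> w1 wM f0; have [->|fn0] := eqVneq f 0; first exact: sqr_ge0.
have f1 : 0 < f by rewrite lt_neqAle eq_sym fn0.
have wwh : (w *m w ^t*) ^t* = w *m w ^t* by rewrite hadj_mul trmxCK.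
have sqw : sqrtmx (w *m w ^t* : op R T) = w *m w ^t*.
  rewrite (@sqrtmx_scaled_idempotent _ _ 1) ?ltr01 //.
    by rewrite sqrtC1 invr1 scale1r.
  by rewrite mulmxA -(mulmxA w) w1 mulmx1 scale1r.
rewrite /fidelity sqw.
have [] := sqrtmx_gram M; set s := sqrtmx (_ : op R T) => sh ss.
set B := _ *m s; rewrite /trnorm.
have BB : B ^t* *m B = s *m w *m (s *m w) ^t*.
  rewrite /B hadj_mul wwh sh !mulmxA -(mulmxA _ (w ^t*) w) w1 mulmx1.
  by rewrite hadj_mul sh !mulmxA.
have sw : (s *m w) ^t* *m (s *m w) = f%:C%C%:M.
  by rewrite hadj_mul sh mulmxA -(mulmxA (w ^t*)) ss wM.
have fC : 0 < f%:C%C :> C by rewrite ltcR.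
rewrite BB (@sqrtmx_scaled_idempotent _ _ f%:C%C) //.
- rewrite linearZ /= mxtrace_mulC sw mxtrace_scalar mulr1n.
  rewrite -[X in _ * X]sqrtCK expr2 mulKf ?sqrtC_eq0 ?(gt_eqF fC) //.
  have rR : (complex.Re (sqrtC f%:C%C))%:C%C = sqrtC f%:C%C.
    by apply: RRe_real; rewrite ger0_real // sqrtC_ge0 ltW.
  have : ((complex.Re (sqrtC f%:C%C)) * (complex.Re (sqrtC f%:C%C)))%:C%C = f%:C%C :> C.
    by rewrite rmorphM /= rR -expr2 sqrtCK.
  by move/complexI->.
- by rewrite hadj_mul trmxCK.
- by rewrite mulmxA -(mulmxA (s *m w)) sw mul_mx_scalar -scalemxAl.
Qed.

End Fidelity.

(** * Kraus channels and a decoder for mutually detectable errors *)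

Section Kraus.
Variable R : realType.
Local Notation C := R[i].

Lemma sum_pair (V : nmodType) (S T : finType) (F : S * T -> V) :
  \sum_z F z = \sum_s \sum_t F (s, t).
Proof. by rewrite pair_bigA; apply: eq_bigr => -[]. Qed.

Definition kraus (S T I : finType) (K : I -> 'M[C]_(#|T|, #|S|)) (A : op R S) :
    op R T :=
  \sum_i K i *m A *m (K i) ^t*.

Definition tens1 (S T : finType) (Q : finType) (K : 'M[C]_(#|T|, #|S|)) :
    'M[C]_(#|{: T * Q}|, #|{: S * Q}|) :=
  mkmx (fun x y => ment K x.1 y.1 * (x.2 == y.2)%:R).

Lemma tens_id_kraus (S T I Q : finType) (K : I -> 'M[C]_(#|T|, #|S|))
    (M : op R (S * Q)%type) :
  tens_id (kraus K) M = kraus (fun i => tens1 Q (K i)) M.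
Proof.
apply: (@mentP _ (T * Q)%type (T * Q)%type) => x y.
rewrite ment_mkmx [LHS]ment_sum [RHS]ment_sum; apply: eq_bigr => i _.
rewrite [LHS]ment_mul [RHS]ment_mul.
rewrite [RHS]sum_pair.
apply: eq_bigr => s _; rewrite (bigD1 y.2) //= [X in _ + X]big1 ?addr0 => [|q /negPf qy].
  rewrite !ment_adj !ment_mkmx /= eqxx mulr1; congr (_ * _).
  rewrite [LHS]ment_mul [RHS]ment_mul [RHS]sum_pair.
  apply: eq_bigr => s' _.
  rewrite (bigD1 x.2) //= [X in _ + X]big1 ?addr0 => [|q /negPf qx].
    by rewrite !ment_mkmx /= eqxx mulr1.
  by rewrite ment_mkmx /= eq_sym qx mulr0 mul0r.
by rewrite !ment_adj !ment_mkmx /= eq_sym qy mulr0 conjC0 mulr0.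
Qed.

Lemma psd_kraus (S T I : finType) (K : I -> 'M[C]_(#|T|, #|S|)) (M : op R S) :
  psd M -> psd (kraus K M).
Proof.
move=> M0 v; rewrite /kraus mulmx_sumr mulmx_suml summxE; apply: sumr_ge0 => i _.
by have := M0 (v *m K i); rewrite hadj_mul !mulmxA.
Qed.

Lemma kraus_channel (S T I : finType) (K : I -> 'M[C]_(#|T|, #|S|)) :
  \sum_i (K i) ^t* *m K i = 1%:M -> is_channel (kraus K).
Proof.
move=> K1; split.
- move=> a A B; rewrite /kraus scaler_sumr -big_split /=; apply: eq_bigr => i _.
  by rewrite mulmxDr mulmxDl -scalemxAr -scalemxAl.
- move=> A; rewrite /kraus raddf_sum /=.
  transitivity (\sum_i \tr ((K i) ^t* *m K i *m A)).
    by apply: eq_bigr => i _; rewrite mxtrace_mulC mulmxA.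
  by rewrite -[RHS](congr1 mxtrace (mul1mx A)) -K1 mulmx_suml raddf_sum.
- by move=> d M M0; rewrite tens_id_kraus; apply: psd_kraus.
Qed.

Definition maxent (L : finType) : 'cV[C]_#|{: L * L}| :=
  \col_i (((enum_val i).1 == (enum_val i).2)%:R / sqrtC #|L|%:R).

Lemma conj_sqrtn (n : nat) : (sqrtC n%:R : C)^* = sqrtC n%:R.
Proof. by rewrite geC0_conj // sqrtC_ge0 ler0n. Qed.

Lemma max_entangledE (L : finType) :
  max_entangled R L = maxent L *m (maxent L) ^t*.
Proof.
apply/matrixP => i j; rewrite !mxE big_ord1 !mxE.
rewrite rmorphM fmorphV /= conjC_nat conj_sqrtn mulrACA -natrM mulnb -invfM.
by rewrite -expr2 sqrtCK.
Qed.

Lemma sum_diag (V : nmodType) (L : finType) (F : L * L -> V) :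
  (forall x, x.1 != x.2 -> F x = 0) -> \sum_x F x = \sum_l F (l, l).
Proof.
move=> F0; rewrite sum_pair; apply: eq_bigr => l _.
by rewrite (bigD1 l) //= big1 ?addr0 // => m lm; rewrite F0 // eq_sym.
Qed.

Lemma maxent_unit (L : finType) : (0 < #|L|)%N ->
  (maxent L) ^t* *m maxent L = 1%:M.
Proof.
move=> L0; apply/matrixP => i j; rewrite !ord1 mxE sum_enum_rank.
under eq_bigr do rewrite !mxE enum_rankK.
rewrite sum_diag => [|x /negPf ->]; last by rewrite mul0r mulr0.
under eq_bigr do rewrite eqxx mul1r fmorphV /= conj_sqrtn -invfM -expr2 sqrtCK.
by rewrite [RHS]mxE eqxx sumr_const cardT -cardE -[LHS]mulr_natl divff // pnatr_eq0 -lt0n.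
Qed.

(** The entanglement fidelity of a Kraus map is the sum over its operators of the squared modulus of
    this amplitude. *)
Lemma maxent_tens1 (L : finType) (K : op R L) :
  (maxent L) ^t* *m tens1 L K *m maxent L = (\tr K / #|L|%:R)%:M.
Proof.
apply/matrixP => i j; rewrite !ord1 [RHS]mxE eqxx mulr1n [LHS]mxE sum_enum_rank.
under eq_bigr => y _.
  rewrite mxE sum_enum_rank.
  under eq_bigr do rewrite !mxE !enum_rankK.
  rewrite mxE enum_rankK sum_diag => [|x /negPf ->]; last first.
    by rewrite mul0r conjC0 mul0r.
  over.
rewrite sum_diag => [|x /negPf ->]; last by rewrite mul0r mulr0.
rewrite tr_ment mulr_suml; apply: eq_bigr => l _ /=.
rewrite (bigD1 l) //= big1 ?addr0 => [|m /negPf ml]; last first.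
  by rewrite ml mulr0 mulr0.
rewrite !eqxx mulr1 !mul1r fmorphV /= conj_sqrtn mulrAC -invfM -expr2 sqrtCK.
by rewrite mulrC.
Qed.

(** The spaces [E a V] for [a] in [A] are mutually orthogonal, so measuring in which of them the
    state lies identifies the error, which is then undone. The Kraus operator [V^* E a^*] applied to
    error [a] contributes [pr a] to the entanglement fidelity; all other contributions are
    nonnegative and are dropped. *)
Lemma choi_error_le (L S I : finType) (V : 'M[C]_(#|S|, #|L|)) (pr : I -> R)
    (E : I -> op R S) (noise : op R S -> op R S) (enc : op R L -> op R S)
    (A : {set I}) :
  (0 < #|L|)%N -> V ^t* *m V = 1%:M ->
  (forall a, E a \is unitarymx) -> (forall a, 0 <= pr a) ->
  (forall rho, noise rho = \sum_a (pr a)%:C%C *: (E a *m rho *m (E a) ^t*)) ->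
  (forall rho, enc rho = V *m rho *m V ^t*) ->
  {in A &, forall a b, a != b -> V ^t* *m (E a) ^t* *m E b *m V = 0} ->
  choi_error noise enc <= Num.sqrt (1 - \sum_(a in A) pr a).
Proof.
move=> L0 VV EU pr0 noiseE encE orth.
have l0 : L := enum_val (Ordinal L0).
pose Pi : op R S := \sum_(a in A) E a *m V *m V ^t* *m (E a) ^t*.
have PiH : Pi ^t* = Pi.
  rewrite hadj_sum; apply: eq_bigr => a _.
  by rewrite !hadj_mul !trmxCK !mulmxA.
have PiPi : Pi *m Pi = Pi.
  rewrite mulmx_suml; apply: eq_bigr => a aA.
  rewrite mulmx_sumr (bigD1 a) //= big1 ?addr0 => [|b /andP[bA ba]].
    rewrite !mulmxA -(mulmxA _ (_ ^t*) (E a)) unitarymx_mulVmx // mulmx1.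
    by rewrite -(mulmxA _ (V ^t*) V) VV mulmx1.
  rewrite !mulmxA -(mulmxA (E a *m V)) -(mulmxA (E a *m V)) -(mulmxA (E a *m V)).
  by rewrite orth ?mulmx0 ?mul0mx // eq_sym.
(* Off the recognised spaces the decoder resets to a fixed basis state [l0], which makes it trace
   preserving. *)
pose e s : 'M[C]_(#|L|, #|S|) := mkmx (fun l x => ((l == l0) && (x == s))%:R).
pose K (j : I + S) : 'M[C]_(#|L|, #|S|) :=
  match j with
  | inl a => if a \in A then V ^t* *m (E a) ^t* else 0
  | inr s => e s *m (1%:M - Pi)
  end.
have eE s : (e s) ^t* *m e s = mkmx (fun x y => ((x == s) && (y == s))%:R).
  apply: mentP => x y; rewrite ment_mul ment_mkmx (bigD1 l0) //= big1 => [|l /negPf ll].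
    by rewrite addr0 ment_adj !ment_mkmx eqxx conjC_nat -natrM mulnb.
  by rewrite [X in _ * X]ment_mkmx ll mulr0.
have e1 : \sum_s (e s) ^t* *m e s = 1%:M.
  apply: mentP => x y; rewrite ment_sum ment1.
  under eq_bigr do rewrite eE ment_mkmx.
  rewrite (bigD1 x) //= big1 ?addr0 ?eqxx 1?eq_sym //.
  by move=> s /negPf; rewrite eq_sym => ->.
have K1 : \sum_j (K j) ^t* *m K j = 1%:M.
  rewrite big_sumType /=.
  transitivity (Pi + (1%:M - Pi) ^t* *m (1%:M - Pi)).
    congr (_ + _).
      rewrite /Pi [RHS]big_mkcond /=; apply: eq_bigr => a _; case: ifP => _.
        by rewrite hadj_mul !trmxCK !mulmxA.
      by rewrite mulmx0.
    rewrite -[X in _ = X *m _]mulmx1 -e1 mulmx_sumr mulmx_suml; apply: eq_bigr => s _.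
    by rewrite hadj_mul !mulmxA.
  rewrite hadjB hadj1 PiH mulmxBr mulmx1 mulmxBl mul1mx PiPi subrr subr0.
  by rewrite addrC subrK.
pose M (ja : (I + S) * I) : op R L :=
  (sqrtC (pr ja.2)%:C%C) *: (K ja.1 *m (E ja.2 *m V)).
have compE : kraus K \o noise \o enc = kraus M.
  apply/funext => rho; rewrite /= encE noiseE /kraus sum_pair.
  apply: eq_bigr => j _; rewrite mulmx_sumr mulmx_suml; apply: eq_bigr => a _.
  transitivity ((pr a)%:C%C *: (K j *m (E a *m V) *m rho *m (K j *m (E a *m V)) ^t*)).
    by rewrite -scalemxAr -scalemxAl !hadj_mul !mulmxA.
  rewrite /M /= hadjZ geC0_conj ?sqrtC_ge0 ?lecR // -!scalemxAl -scalemxAr scalerA.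
  by rewrite -expr2 sqrtCK.
have chK : is_channel (kraus K) := kraus_channel K1.
(* [X] is the entanglement fidelity of the decoded channel. *)
pose X : C := \sum_ja `|\tr (M ja) / #|L|%:R| ^+ 2.
have X0 : 0 <= X by apply: sumr_ge0 => ja _; rewrite exprn_ge0.
have XE : (complex.Re X)%:C%C = X by apply: RRe_real; rewrite ger0_real.
have AX : (\sum_(a in A) pr a)%:C%C <= X.
  rewrite /X sum_pair big_sumType /= rmorph_sum /= -[leLHS]addr0; apply: lerD; last first.
    by apply: sumr_ge0 => s _; apply: sumr_ge0 => a _; rewrite exprn_ge0.
  rewrite big_mkcond /=; apply: ler_sum => a _; case: ifP => aA; last first.
    by apply: sumr_ge0 => b _; rewrite exprn_ge0.
  rewrite (bigD1 a) //= -[leLHS]addr0; apply: lerD; last first.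
    by apply: sumr_ge0 => b _; rewrite exprn_ge0.
  rewrite /M /= aA !mulmxA -(mulmxA _ (_ ^t*) (E a)) unitarymx_mulVmx // mulmx1 VV.
  rewrite linearZ /= mxtrace1 -mulrA divff ?pnatr_eq0 -?lt0n // mulr1.
  by rewrite ger0_norm ?sqrtC_ge0 ?lecR // sqrtCK.
have AX' : \sum_(a in A) pr a <= complex.Re X by rewrite -lecR XE.
(* The columns of [G] are the images of the entangled vector under the Kraus operators, so the
   decoded state is a Gram operator, as [fidelity_rank_one_ge] expects. *)
pose G : 'M[C]_(#|{: L * L}|, #|{: (I + S) * I}|) :=
  \matrix_(i, j) (tens1 L (M (enum_val j)) *m maxent L) i 0.
have GE : tens_id (kraus K \o noise \o enc) (max_entangled R L) = G *m G ^t*.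
  rewrite compE tens_id_kraus /kraus max_entangledE.
  apply/matrixP => i j; rewrite summxE mxE sum_enum_rank; apply: eq_bigr => ja _.
  rewrite mulmxA -mulmxA -hadj_mul mxE big_ord1 !mxE !enum_rankK.
  by rewrite (_ : ord0 = 0) //; exact: val_inj.
apply: (@le_trans _ _ (purified_distance (max_entangled R L)
   (tens_id (kraus K \o noise \o enc) (max_entangled R L)))).
  apply: ge_inf; last by exists (kraus K).
  by exists 0 => _ [D _ <-]; exact: sqrtr_ge0.
rewrite /purified_distance ler_wsqrtr // lerD2l lerN2 (le_trans AX') //.
rewrite GE max_entangledE; apply: fidelity_rank_one_ge.
- exact: maxent_unit.
- rewrite XE; apply/matrixP => i j; rewrite !ord1 [in RHS]mxE eqxx mulr1n.
  rewrite mulmxA -mulmxA -[G ^t* *m _]trmxCK hadj_mul trmxCK mxE sum_enum_rank.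
  apply: eq_bigr => ja _; rewrite [X in _ * X]mxE [X in _ * _ X]mxE -normCK.
  congr (`|_| ^+ 2).
  have /matrixP/(_ 0 0) := maxent_tens1 (M ja).
  rewrite [RHS]mxE eqxx mulr1n => <-.
  rewrite -mulmxA [LHS]mxE [RHS]mxE; apply: eq_bigr => k _.
  by rewrite [in LHS]/G [X in _ * X = _]mxE enum_rankK.
- by rewrite -lecR XE.
Qed.

End Kraus.

(** * Pauli operators *)

Section BitStrings.
Variable n : nat.
Implicit Types u v w : bits n.

Definition bxor u v : bits n := [tuple tnth u i (+) tnth v i | i < n].
Definition bzero : bits n := [tuple false | i < n].

Lemma bxorA u v w : bxor u (bxor v w) = bxor (bxor u v) w.
Proof. by apply: eq_from_tnth => i; rewrite !tnth_mktuple addbA. Qed.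

Lemma bxorC u v : bxor u v = bxor v u.
Proof. by apply: eq_from_tnth => i; rewrite !tnth_mktuple addbC. Qed.

Lemma bxor0 u : bxor u bzero = u.
Proof. by apply: eq_from_tnth => i; rewrite !tnth_mktuple addbF. Qed.

Lemma bxorv u : bxor u u = bzero.
Proof. by apply: eq_from_tnth => i; rewrite !tnth_mktuple addbb. Qed.

Lemma bxorK u v : bxor u (bxor u v) = v.
Proof. by rewrite bxorA bxorv bxorC bxor0. Qed.

Lemma bxor_eq0 u v : (bxor u v == bzero) = (u == v).
Proof.
apply/eqP/eqP => [e|->]; last exact: bxorv.
by rewrite -[LHS]bxor0 -e bxorK.
Qed.

Lemma sum_prod_bits (A : comPzSemiRingType) (F : 'I_n -> bool -> A) :
  \sum_(v : bits n) \prod_(i < n) F i (tnth v i) = \prod_(i < n) \sum_b F i b.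
Proof.
rewrite bigA_distr_bigA (reindex (fun f : {ffun 'I_n -> bool} => [tuple f i | i < n])).
  by apply: eq_bigr => f _; apply: eq_bigr => i _; rewrite tnth_mktuple.
exists (fun v : bits n => [ffun i => tnth v i]) => [f|v] _.
  by apply/ffunP => i; rewrite ffunE tnth_mktuple.
by apply: eq_from_tnth => i; rewrite tnth_mktuple ffunE.
Qed.

End BitStrings.

Section Pauli.
Variables (R : realType).
Local Notation C := R[i].

(** Paulis up to phase as vectors of F_2^(2n), an X part and a Z part; products of Paulis become
    sums of labels. *)
Definition label n := (bits n * bits n)%type.

Definition ladd n (s t : label n) : label n := (bxor s.1 t.1, bxor s.2 t.2).
Definition lzero n : label n := (bzero n, bzero n).

Lemma laddA n (s t r : label n) : ladd s (ladd t r) = ladd (ladd s t) r.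
Proof. by rewrite /ladd !bxorA. Qed.

Lemma laddC n (s t : label n) : ladd s t = ladd t s.
Proof. by congr pair; rewrite bxorC. Qed.

Lemma ladd0 n (s : label n) : ladd s (lzero n) = s.
Proof. by case: s => a b; rewrite /ladd !bxor0. Qed.

Lemma laddv n (s : label n) : ladd s s = lzero n.
Proof. by rewrite /ladd !bxorv. Qed.

Lemma laddK n (s t : label n) : ladd s (ladd s t) = t.
Proof. by rewrite laddA laddv laddC ladd0. Qed.

Lemma ladd_eq0 n (s t : label n) : (ladd s t == lzero n) = (s == t).
Proof. by case: s t => [a b] [c d]; rewrite !xpair_eqE !bxor_eq0. Qed.

Definition went (a b u v : bool) : C := (u == a (+) v)%:R * (-1) ^+ (b && v).

(* [W (x, z)] is X^x Z^z. *)
Definition W n (s : label n) : op R (bits n) :=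
  mkop (fun u v => \prod_(i < n)
    went (tnth s.1 i) (tnth s.2 i) (tnth u i) (tnth v i)).

Definition bsgn n (z x : bits n) : C := \prod_(i < n) (-1) ^+ (tnth z i && tnth x i).

Lemma ment_W n (s : label n) u v : ment (W s) u v = \prod_(i < n)
    went (tnth s.1 i) (tnth s.2 i) (tnth u i) (tnth v i).
Proof. exact: ment_mkmx. Qed.

Lemma bsgn_xorl n (z z' x : bits n) : bsgn (bxor z z') x = bsgn z x * bsgn z' x.
Proof.
rewrite /bsgn -big_split /=; apply: eq_bigr => i _; rewrite tnth_mktuple.
by case: (tnth z i); case: (tnth z' i); case: (tnth x i); rewrite /= ?expr0 ?expr1 ?(mul1r, mulr1, mulrNN).
Qed.

Lemma bsgnC n (z x : bits n) : bsgn z x = bsgn x z.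
Proof. by apply: eq_bigr => i _; rewrite andbC. Qed.

Lemma bsgn_cases n (z x : bits n) : (bsgn z x == 1) || (bsgn z x == -1).
Proof.
apply: (big_ind (fun c : C => (c == 1) || (c == -1))) => [|c d|i _].
- by rewrite eqxx.
- by do 2![case/orP => /eqP->]; rewrite ?(mul1r, mulr1, mulrNN) eqxx ?orbT.
- by case: (_ && _); rewrite ?expr0 ?expr1 eqxx ?orbT.
Qed.

Lemma bsgn_sqr n (z x : bits n) : bsgn z x * bsgn z x = 1.
Proof. by case/orP: (bsgn_cases z x) => /eqP->; rewrite ?mulrNN mulr1. Qed.

Lemma W_mul n (s t : label n) : W s *m W t = bsgn s.2 t.1 *: W (ladd s t).
Proof.
apply: mentP => u v; rewrite ment_mul mentZ.
under eq_bigr do rewrite !ment_W -big_split /=.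
rewrite (sum_prod_bits (fun i b => went (tnth s.1 i) (tnth s.2 i) (tnth u i) b *
   went (tnth t.1 i) (tnth t.2 i) b (tnth v i))) ment_W /bsgn -big_split /=.
apply: eq_bigr => i _; rewrite big_bool /went !tnth_mktuple.
case: (tnth s.1 i); case: (tnth s.2 i); case: (tnth t.1 i); case: (tnth t.2 i);
case: (tnth u i); case: (tnth v i); rewrite /= ?expr0 ?expr1; ring.
Qed.

Lemma W0 n : W (lzero n) = 1%:M.
Proof.
apply: mentP => u v; rewrite ment_W ment1.
have [->|/eqP uv] := eqVneq u v.
  by apply: big1 => i _; rewrite /went !tnth_mktuple addFb eqxx mulr1.
have [i uvi] : exists i, tnth u i != tnth v i.
  apply/existsP; apply: contraT => /existsPn h; case: uv.
  by apply: eq_from_tnth => i; apply/eqP; move/negPn: (h i).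
by rewrite (bigD1 i) //= /went !tnth_mktuple addFb (negPf uvi) !mul0r.
Qed.

Lemma W_adj n (s : label n) : (W s) ^t* = bsgn s.1 s.2 *: W s.
Proof.
apply: mentP => u v; rewrite ment_adj mentZ !ment_W rmorph_prod /bsgn -big_split /=.
apply: eq_bigr => i _; rewrite /went.
case: (tnth s.1 i); case: (tnth s.2 i); case: (tnth u i); case: (tnth v i);
rewrite /= ?expr0 ?expr1 rmorphM /= ?rmorphN ?conjC_nat ?rmorph1; ring.
Qed.

Lemma W_mul_self n (s : label n) : W s *m W s = bsgn s.1 s.2 *: 1%:M.
Proof. by rewrite W_mul laddv W0 bsgnC. Qed.

Lemma W_unitary n (s : label n) : W s \is unitarymx.
Proof.
by apply/unitarymxP; rewrite W_adj -scalemxAr W_mul_self scalerA bsgn_sqr scale1r.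
Qed.

Lemma tr_W_neq0 n (s : label n) : s != lzero n -> \tr (W s) = 0.
Proof.
move=> s0; rewrite tr_ment; under eq_bigr do rewrite ment_W.
rewrite (sum_prod_bits (fun i b => went (tnth s.1 i) (tnth s.2 i) b b)).
have [i si] : exists i, tnth s.1 i || tnth s.2 i.
  apply/existsP; apply: contraNT s0 => /existsPn h; apply/eqP.
  case: s h => a b /= h; congr pair; apply: eq_from_tnth => i; rewrite tnth_mktuple;
  by move: (h i); case: (tnth a i); case: (tnth b i).
rewrite (bigD1 i) //= big_bool /went; move: si.
by case: (tnth s.1 i); case: (tnth s.2 i) => // _; rewrite /= ?expr0 ?expr1 ?mul0r ?mul1r ?addNr ?add0r ?mul0r.
Qed.

Lemma unitarymx_neq0 n (U : op R (bits n)) : U \is unitarymx -> U != 0.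
Proof.
move=> /unitarymxP UU; apply/eqP => U0.
have := congr1 mxtrace UU; rewrite U0 mul0mx mxtrace0 mxtrace1 => /esym/eqP.
by rewrite pnatr_eq0 card_tuple card_bool expn_eq0.
Qed.

(** Distinct Paulis are orthogonal for the trace form, since a nontrivial Pauli is traceless. *)
Lemma W_inj n (s t : label n) c : W s = c *: W t -> s = t.
Proof.
move=> e; apply/eqP; rewrite -ladd_eq0; apply/negPn/negP => st.
have : \tr ((W t) ^t* *m W s) = c * \tr (1%:M : op R (bits n)).
  by rewrite e -scalemxAr linearZ /= unitarymx_mulVmx // W_unitary.
rewrite W_adj -scalemxAl W_mul laddC scalerA linearZ /= tr_W_neq0 // mulr0 mxtrace1.
move/esym/eqP; rewrite mulf_eq0 pnatr_eq0 card_tuple card_bool expn_eq0 /= orbF => /eqP c0.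
by have := unitarymx_neq0 (W_unitary s); rewrite e c0 scale0r eqxx.
Qed.

(** The symplectic form as a sign: 1 for commuting Paulis, -1 for anticommuting ones. *)
Definition om n (s t : label n) : C := bsgn s.2 t.1 * bsgn s.1 t.2.

Lemma omC n (s t : label n) : om s t = om t s.
Proof. by rewrite /om mulrC (bsgnC s.1) (bsgnC s.2). Qed.

Lemma om_addl n (s s' t : label n) : om (ladd s s') t = om s t * om s' t.
Proof. by rewrite /om /= !bsgn_xorl mulrACA. Qed.

Lemma om_cases n (s t : label n) : (om s t == 1) || (om s t == -1).
Proof.
rewrite /om; case/orP: (bsgn_cases s.2 t.1) => /eqP->;
case/orP: (bsgn_cases s.1 t.2) => /eqP->;
by rewrite ?(mul1r, mulr1, mulrNN) eqxx ?orbT.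
Qed.

Lemma W_comm n (s t : label n) : W s *m W t = om s t *: (W t *m W s).
Proof.
by rewrite !W_mul scalerA laddC /om (bsgnC t.2) -mulrA bsgn_sqr mulr1.
Qed.

Lemma om_self n (s : label n) : om s s = 1.
Proof. by rewrite /om (bsgnC s.2) bsgn_sqr. Qed.

Definition bone n (i : 'I_n) : bits n := [tuple j == i | j < n].

Lemma bsgn_bone n (i : 'I_n) (x : bits n) : bsgn (bone i) x = (-1) ^+ tnth x i.
Proof.
rewrite /bsgn (bigD1 i) //= tnth_mktuple eqxx big1 ?mulr1 //.
by move=> j /negPf ji; rewrite tnth_mktuple ji.
Qed.

Lemma bsgn0l n (x : bits n) : bsgn (bzero n) x = 1.
Proof. by apply: big1 => i _; rewrite tnth_mktuple. Qed.

Lemma om_xbone n (i : 'I_n) (s : label n) : om (bone i, bzero n) s = (-1) ^+ tnth s.2 i.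
Proof. by rewrite /om /= bsgn0l bsgn_bone mul1r. Qed.

Lemma om_zbone n (i : 'I_n) (s : label n) : om (bzero n, bone i) s = (-1) ^+ tnth s.1 i.
Proof. by rewrite /om /= bsgn0l bsgn_bone mulr1. Qed.

Lemma om_nondeg n (s : label n) : s != lzero n -> exists r, om r s = -1.
Proof.
move=> s0; have [i si] : exists i, tnth s.1 i || tnth s.2 i.
  apply/existsP; apply: contraNT s0 => /existsPn h; apply/eqP.
  case: s h => a b /= h; congr pair; apply: eq_from_tnth => i; rewrite tnth_mktuple;
  by move: (h i); case: (tnth a i); case: (tnth b i).
case e : (tnth s.1 i) si => /= si.
  by exists (bzero n, bone i); rewrite om_zbone e.
by exists (bone i, bzero n); rewrite om_xbone si.
Qed.

(** If a Pauli anticommuting with [s] commutes with [t], and one anticommuting with [t] commutes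
    with [s], their product anticommutes with both. It is the stopover in [clifford_trans]. *)
Lemma om_separate n (s t : label n) : s != lzero n -> t != lzero n ->
  exists r, om r s = -1 /\ om r t = -1.
Proof.
have omE r q : (om r q == 1) || (om r q == -1 :> C) := @om_cases n r q.
move=> /om_nondeg[r1 r1s] /om_nondeg[r2 r2t].
case/orP: (omE r1 t) => /eqP r1t; last by exists r1.
case/orP: (omE r2 s) => /eqP r2s; last by exists r2.
by exists (ladd r1 r2); rewrite !om_addl r1s r2s r1t r2t mulr1 mul1r.
Qed.

Definition isP n (A : op R (bits n)) := exists (a : nat) (s : label n), A = 'i ^+ a *: W s.

Lemma isP_W n (s : label n) : isP (W s).
Proof. by exists 0, s; rewrite expr0 scale1r. Qed.

Lemma isP_Z n (a : nat) (A : op R (bits n)) : isP A -> isP ('i ^+ a *: A).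
Proof. by move=> [b [s ->]]; exists (a + b)%N, s; rewrite scalerA exprD. Qed.

Definition pauli_x (P : pauli) := if P is (PauliX | PauliY) then true else false.
Definition pauli_z (P : pauli) := if P is (PauliZ | PauliY) then true else false.
Definition pauli_of (a b : bool) : pauli :=
  if a then (if b then PauliY else PauliX) else (if b then PauliZ else PauliI).

Lemma pauli_entryE P x y : pauli_entry R P x y =
  'i ^+ (pauli_x P && pauli_z P) * went (pauli_x P) (pauli_z P) x y.
Proof.
by case: P; case: x; case: y; rewrite /went /= ?expr0 ?expr1 /=; ring.
Qed.

Lemma pauli_stringE n (s : 'I_n -> pauli) :
  pauli_string R s = 'i ^+ (\sum_(i < n) (pauli_x (s i) && pauli_z (s i)))%N *:
    W ([tuple pauli_x (s i) | i < n], [tuple pauli_z (s i) | i < n]).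
Proof.
apply: mentP => u v; rewrite [LHS]ment_mkmx [RHS]mentZ [X in _ * X]ment_W.
rewrite expr_sum -big_split /=; apply: eq_bigr => i _.
by rewrite pauli_entryE !tnth_mktuple.
Qed.

Lemma iexp4 (m : nat) : ('i : C) ^+ (4 * m) = 1.
Proof. by rewrite exprM (exprM _ 2 2) sqrCi sqrrN expr1n expr1n. Qed.

Lemma pauli_groupE n : pauli_group R n = [set A | isP A].
Proof.
apply/seteqP; split => [A [a [s ->]]|A [a [s ->]]].
  by rewrite pauli_stringE scalerA -exprD; eexists; eexists.
pose q i := pauli_of (tnth s.1 i) (tnth s.2 i).
set m := (\sum_(i < n) (pauli_x (q i) && pauli_z (q i)))%N.
(* [pauli_string] contributes a factor ['i] for each of its [m] letters Y; [3 * m] more complete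
   them to fourth powers. *)
exists (a + 3 * m)%N, q; rewrite pauli_stringE -/m scalerA -exprD.
have -> : (a + 3 * m + m = a + 4 * m)%N by lia.
rewrite exprD iexp4 mulr1; congr (_ *: W _).
by case: s @q @m => x z q m; congr pair; apply: eq_from_tnth => i;
   rewrite tnth_mktuple /q /=; case: (tnth x i); case: (tnth z i).
Qed.

End Pauli.

(** * Operators supported on a window of the line *)

Section Windows.
Implicit Types (n w o : nat).

Definition bpatch n w o (x : bits n) (t : bits w) : bits n :=
  [tuple if (o <= i < o + w)%N then nth false t (i - o) else tnth x i | i < n].

Lemma bitsP n (x y : bits n) :
  (forall i, (i < n)%N -> nth false x i = nth false y i) -> x = y.
Proof.
by move=> xy; apply: eq_from_tnth => i; rewrite !(tnth_nth false) xy.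
Qed.

Lemma nth_mktuple_bits n (f : 'I_n -> bool) i (lin : (i < n)%N) :
  nth false [tuple f i | i < n] i = f (Ordinal lin).
Proof. by rewrite -(tnth_nth false _ (Ordinal lin)) tnth_mktuple. Qed.

Lemma nth_slice n w o (x : bits n) t : (t < w)%N ->
  nth false (slice w o x) t = nth false x (o + t).
Proof. by move=> tw; rewrite nth_mktuple_bits. Qed.

Lemma nth_patch n w o (x : bits n) (t : bits w) i : (i < n)%N ->
  nth false (bpatch o x t) i =
  if (o <= i < o + w)%N then nth false t (i - o) else nth false x i.
Proof. by move=> lin; rewrite nth_mktuple_bits (tnth_nth false). Qed.

Lemma nth_bxor n (u v : bits n) i : nth false (bxor u v) i = nth false u i (+) nth false v i.
Proof.
have [lin|nli] := ltnP i n; first by rewrite nth_mktuple_bits !(tnth_nth false).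
by rewrite !nth_default ?size_tuple.
Qed.

Lemma nth_bzero n i : nth false (bzero n) i = false.
Proof.
have [lin|nli] := ltnP i n; first by rewrite nth_mktuple_bits.
by rewrite !nth_default ?size_tuple.
Qed.

Lemma slice_patch n w o (x : bits n) (t : bits w) : (o + w <= n)%N ->
  slice w o (bpatch o x t) = t.
Proof.
move=> own; apply: bitsP => i iw; rewrite nth_slice // nth_patch; last by lia.
by rewrite leq_addr ltn_add2l iw addKn.
Qed.

Lemma slice_patch_disj n w o w' o' (x : bits n) (t : bits w) :
  (o' + w' <= n)%N -> (o + w <= o')%N || (o' + w' <= o)%N ->
  slice w' o' (bpatch o x t) = slice w' o' x.
Proof.
move=> own dis; apply: bitsP => i iw; rewrite !nth_slice // nth_patch; last by lia.
by case: ifP => // ?; lia.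
Qed.

Lemma patch_slice n w o (x : bits n) : bpatch o x (slice w o x) = x.
Proof.
apply: bitsP => i ni; rewrite !nth_patch //; case: ifP => // iow.
by rewrite nth_slice; [congr nth|]; lia.
Qed.

Lemma slice_slice n m w o o' (x : bits n) : (o' + w <= m)%N ->
  slice w o' (slice m o x) = slice w (o + o') x.
Proof.
move=> owm; apply: bitsP => i iw; rewrite !nth_slice ?addnA //; lia.
Qed.

Lemma slice_full n (x : bits n) : slice n 0 x = x.
Proof. by apply: bitsP => i ni; rewrite nth_slice. Qed.

Lemma slice_bzero n w o : slice w o (bzero n) = bzero w.
Proof. by apply: bitsP => i iw; rewrite nth_slice // !nth_bzero. Qed.

Definition offeq n w o (x y : bits n) : bool :=
  [forall i : 'I_n, ~~ (o <= i < o + w)%N ==> (tnth x i == tnth y i)].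

Lemma offeqP n w o (x y : bits n) :
  reflect (forall i, (i < n)%N -> ~~ (o <= i < o + w)%N -> nth false x i = nth false y i)
    (offeq w o x y).
Proof.
apply: (iffP forallP) => [xy i ni iow|xy i].
  by have := xy (Ordinal ni); rewrite iow /= !(tnth_nth false) => /eqP.
by apply/implyP => iow; rewrite !(tnth_nth false) xy.
Qed.

Lemma offeq_patch n w o (x : bits n) (t : bits w) : offeq w o x (bpatch o x t).
Proof. by apply/offeqP => i ni /negPf iow; rewrite nth_patch // iow. Qed.

Lemma offeq_slice n w o (x y : bits n) : offeq w o x y -> bpatch o x (slice w o y) = y.
Proof.
move/offeqP => xy; apply: bitsP => i ni; rewrite nth_patch //.
case: ifPn => iow; last exact: xy.
by rewrite nth_slice; [congr nth|]; lia.
Qed.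

Lemma offeq_patch_sliceP n w o w' o' (x y : bits n) :
  reflect (forall i, (i < n)%N -> ~~ (o <= i < o + w)%N -> ~~ (o' <= i < o' + w')%N ->
      nth false x i = nth false y i)
    (offeq w' o' (bpatch o x (slice w o y)) y).
Proof.
apply: (iffP (offeqP _ _ _ _)) => xy i ni => [iow iow'|iow'].
  by rewrite -xy // nth_patch // (negPf iow).
rewrite nth_patch //; case: ifPn => iow; last exact: xy.
by rewrite nth_slice; [congr nth|]; lia.
Qed.

Lemma offeq_sym n w o (x y : bits n) : offeq w o x y = offeq w o y x.
Proof. by apply/offeqP/offeqP => xy i ni iow; rewrite xy. Qed.

Lemma offeq_patchl n w o (x y : bits n) (t : bits w) :
  offeq w o (bpatch o x t) y = offeq w o x y.
Proof.
apply/offeqP/offeqP => xy i ni iow; rewrite -xy // nth_patch //;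
by rewrite (negPf iow).
Qed.

Lemma offeq_full n (x y : bits n) : offeq n 0 x y.
Proof. by apply/offeqP => i ni; rewrite leq0n add0n ni. Qed.

Lemma sum_offeq (V : nmodType) n w o (x : bits n) (F : bits n -> V) : (o + w <= n)%N ->
  \sum_(z | offeq w o x z) F z = \sum_(t : bits w) F (bpatch o x t).
Proof.
move=> own; rewrite (reindex_onto (bpatch o x) (@slice n w o)) /=; last first.
  by move=> z; exact: offeq_slice.
by apply: eq_bigl => t; rewrite offeq_patch slice_patch // eqxx.
Qed.

End Windows.

Section Embedding.
Variable R : realType.
Local Notation C := R[i].
Implicit Types (n w o : nat).

Lemma ment_emb n w o (A : op R (bits w)) x y :
  ment (emb n o A) x y = ment A (slice w o x) (slice w o y) * (offeq w o x y)%:R.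
Proof. exact: ment_mkmx. Qed.

Lemma emb_mull n w o (T : finType) (A : op R (bits w)) (M : 'M[C]_(#|{: bits n}|, #|T|)) x y :
  (o + w <= n)%N ->
  ment (emb n o A *m M) x y = \sum_t ment A (slice w o x) t * ment M (bpatch o x t) y.
Proof.
move=> own; rewrite ment_mul.
transitivity (\sum_(z | offeq w o x z) ment A (slice w o x) (slice w o z) * ment M z y).
  rewrite [RHS]big_mkcond; apply: eq_bigr => z _; rewrite ment_emb.
  by case: offeq; rewrite ?mulr1 ?mulr0 ?mul0r.
by rewrite sum_offeq //; apply: eq_bigr => t _; rewrite slice_patch.
Qed.

Lemma emb_mulr n w o (T : finType) (A : op R (bits w)) (M : 'M[C]_(#|T|, #|{: bits n}|)) x y :
  (o + w <= n)%N ->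
  ment (M *m emb n o A) x y = \sum_t ment M x (bpatch o y t) * ment A t (slice w o y).
Proof.
move=> own; rewrite ment_mul.
transitivity (\sum_(z | offeq w o y z) ment M x z * ment A (slice w o z) (slice w o y)).
  rewrite [RHS]big_mkcond; apply: eq_bigr => z _; rewrite ment_emb offeq_sym.
  by case: offeq; rewrite ?mulr1 ?mulr0.
by rewrite sum_offeq //; apply: eq_bigr => t _; rewrite slice_patch.
Qed.

Lemma emb_mul n w o (A B : op R (bits w)) : (o + w <= n)%N ->
  emb n o A *m emb n o B = emb n o (A *m B).
Proof.
move=> own; apply: mentP => x y; rewrite [LHS]emb_mull // [RHS]ment_emb ment_mul mulr_suml.
by apply: eq_bigr => t _; rewrite ment_emb slice_patch // offeq_patchl mulrA.
Qed.

Lemma emb1 n w o : emb n o (1%:M : op R (bits w)) = 1%:M.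
Proof.
apply: mentP => x y; rewrite [LHS]ment_emb !ment1 -natrM mulnb; congr (_%:R).
have [->|xy] := eqVneq x y; first by rewrite eqxx (_ : offeq w o y y) //; apply/offeqP.
case: andP => // -[/eqP sxy /offeq_slice e]; case/eqP: xy.
by rewrite -e -sxy patch_slice.
Qed.

Lemma emb_adj n w o (A : op R (bits w)) : (emb n o A) ^t* = emb n o (A ^t*).
Proof.
apply: mentP => x y; rewrite [LHS]ment_adj !ment_emb ment_adj rmorphM /= conjC_nat.
by rewrite offeq_sym.
Qed.

Lemma emb_unitary n w o (A : op R (bits w)) : (o + w <= n)%N ->
  A \is unitarymx -> emb n o A \is unitarymx.
Proof.
move=> own AU; apply/unitarymxP; rewrite emb_adj emb_mul //.
by rewrite (unitarymxP AU) emb1.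
Qed.

(** The last factor asks for agreement off both windows, so the formula is symmetric in the two
    operators; this yields [emb_comm]. *)
Lemma ment_emb_disj n w w' o o' (A : op R (bits w)) (B : op R (bits w')) x y :
  (o + w <= n)%N -> (o' + w' <= n)%N -> (o + w <= o')%N || (o' + w' <= o)%N ->
  ment (emb n o A *m emb n o' B) x y =
  ment A (slice w o x) (slice w o y) * ment B (slice w' o' x) (slice w' o' y) *
  (offeq w' o' (bpatch o x (slice w o y)) y)%:R.
Proof.
move=> own own' dis; rewrite [LHS]emb_mull // (bigD1 (slice w o y)) //= big1 ?addr0.
  by rewrite ment_emb slice_patch_disj // mulrA.
move=> t ty; rewrite ment_emb.
case e : offeq; last by rewrite !mulr0.
move: ty; rewrite -(slice_patch x t own).
suff -> : slice w o (bpatch o x t) = slice w o y by rewrite eqxx.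
apply: bitsP => i iw; rewrite !nth_slice //; move/offeqP : e; apply; lia.
Qed.

Lemma emb_comm n w w' o o' (A : op R (bits w)) (B : op R (bits w')) :
  (o + w <= n)%N -> (o' + w' <= n)%N -> (o + w <= o')%N || (o' + w' <= o)%N ->
  emb n o A *m emb n o' B = emb n o' B *m emb n o A.
Proof.
move=> own own' dis; apply: mentP => x y.
rewrite [LHS]ment_emb_disj // [RHS]ment_emb_disj //; last by rewrite orbC.
rewrite [X in X * _]mulrC; congr (_ * _%:R).
by congr nat_of_bool; apply/offeq_patch_sliceP/offeq_patch_sliceP => xy i ni h h'; apply: xy.
Qed.

Lemma emb_emb n m w o o' (A : op R (bits w)) : (o' + w <= m)%N -> (o + m <= n)%N ->
  emb n o (emb m o' A) = emb n (o + o') A.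
Proof.
move=> own omn; apply: mentP => x y; rewrite [LHS]ment_emb [RHS]ment_emb [in LHS]ment_emb.
rewrite !slice_slice // -mulrA -natrM mulnb; congr (_ * _%:R); congr nat_of_bool.
apply/andP/offeqP => [[/offeqP sxy /offeqP xy] i ni iow|xy].
  have [iom|iom] := boolP (o <= i < o + m)%N; last exact: xy.
  have := sxy (i - o)%N; rewrite !nth_slice ?subnKC; try lia; move=> ->//; lia.
split; apply/offeqP => i ni iow; last by apply: xy => //; lia.
by rewrite !nth_slice // xy //; lia.
Qed.

Lemma emb_full n (A : op R (bits n)) : emb n 0 A = A.
Proof.
by apply: mentP => x y; rewrite [LHS]ment_emb !slice_full offeq_full mulr1.
Qed.

Definition lslice n w o (s : label n) : label w := (slice w o s.1, slice w o s.2).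
Definition lpatch n w o (s : label n) (t : label w) : label n :=
  (bpatch o s.1 t.1, bpatch o s.2 t.2).

Lemma lslice_patch n w o (s : label n) (t : label w) : (o + w <= n)%N ->
  lslice w o (lpatch o s t) = t.
Proof. by move=> own; case: t => a b; rewrite /lslice !slice_patch. Qed.

Lemma lslice_patch_disj n w o w' o' (s : label n) (t : label w) :
  (o' + w' <= n)%N -> (o + w <= o')%N || (o' + w' <= o)%N ->
  lslice w' o' (lpatch o s t) = lslice w' o' s.
Proof. by move=> own dis; rewrite /lslice !slice_patch_disj. Qed.

Lemma lslice_slice n m w o o' (s : label n) : (o' + w <= m)%N ->
  lslice w o' (lslice m o s) = lslice w (o + o') s.
Proof. by move=> owm; rewrite /lslice !slice_slice. Qed.

Lemma lslice0 n w o : lslice w o (lzero n) = lzero w.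
Proof. by rewrite /lslice !slice_bzero. Qed.

Definition offW n w o (s : label n) (u v : bits n) : C :=
  \prod_(i < n | ~~ (o <= i < o + w)%N)
    went R (nth false s.1 i) (nth false s.2 i) (nth false u i) (nth false v i).

Lemma prod_window n w o (F : nat -> C) : (o + w <= n)%N ->
  \prod_(i < n) F i = (\prod_(t < w) F (o + t)%N) * \prod_(i < n | ~~ (o <= i < o + w)%N) F i.
Proof.
move=> own; rewrite (bigID (fun i : 'I_n => (o <= i < o + w)%N)) /=; congr (_ * _).
rewrite -(big_mkord (fun i => (o <= i < o + w)%N) F) -(big_mkord xpredT (fun t => F (o + t)%N)).
rewrite (big_cat_nat _ (n := o)) //=; last by lia.
rewrite (big_cat_nat _ (n := o + w) (m := o)) //=; last by lia.
rewrite big_nat_cond big1 ?mul1r => [|i /andP[/andP[_ io] /andP[oi _]]]; last by lia.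
rewrite [X in _ * X]big_nat_cond [X in _ * X]big1 ?mulr1 => [|i /andP[/andP[owi _] /andP[oi iow]]]; last by lia.
rewrite big_nat_cond -[X in index_iota X]add0n big_addn.
rewrite addKn.
rewrite [RHS]big_nat_cond; apply: eq_big => i; last by rewrite addnC.
lia.
Qed.

Lemma W_window n w o (s : label n) u v : (o + w <= n)%N ->
  ment (W R s) u v = ment (W R (lslice w o s)) (slice w o u) (slice w o v) * offW w o s u v.
Proof.
move=> own; rewrite !ment_W.
under eq_bigr do rewrite !(tnth_nth false).
rewrite (prod_window (fun i => went R (nth false s.1 i) (nth false s.2 i)
   (nth false u i) (nth false v i)) own); congr (_ * _).
by apply: eq_bigr => i _; rewrite !tnth_mktuple.
Qed.

Lemma offW_patch n w o (s : label n) (t : label w) u v (a b : bits w) :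
  offW w o (lpatch o s t) (bpatch o u a) (bpatch o v b) = offW w o s u v.
Proof. by apply: eq_bigr => i /negPf iow; rewrite !nth_patch // iow. Qed.

(** Entries of a Pauli factor over the window and its complement, so operators on the window change
    only that part of the label. [A] and [B] are separate so that conjugations in both directions
    and one-sided products are covered. *)
Lemma emb_W_emb n w o (s : label n) (A B : op R (bits w)) c t : (o + w <= n)%N ->
  A *m W R (lslice w o s) *m B = c *: W R t ->
  emb n o A *m W R s *m emb n o B = c *: W R (lpatch o s t).
Proof.
move=> own ABt; apply: mentP => u v; rewrite [LHS]emb_mulr // mentZ.
have -> : ment (W R (lpatch o s t)) u v =
    ment (W R t) (slice w o u) (slice w o v) * offW w o s u v.
  rewrite (W_window _ _ _ own) lslice_patch // -[in LHS](patch_slice w o u) -[in LHS](patch_slice w o v).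
  by rewrite offW_patch !patch_slice.
rewrite mulrA -mentZ -ABt [in RHS]ment_mul mulr_suml; apply: eq_bigr => b _.
rewrite emb_mull // ment_mul !mulr_suml; apply: eq_bigr => a _.
rewrite (W_window _ _ _ own) !slice_patch //.
have sE : lpatch o s (lslice w o s) = s.
  by case: (s) => x z; rewrite /lpatch !patch_slice.
rewrite -[in LHS]sE offW_patch sE; ring.
Qed.

End Embedding.

(** * The Clifford group *)

Section Clifford.
Variable R : realType.
Local Notation C := R[i].
Local Notation W := (@W R _).
Local Notation isP := (@isP R _).

Lemma cliffordP n (U : op R (bits n)) : clifford R n U <->
  [/\ U \is unitarymx, \det U = 1, forall s, isP (U *m W s *m U ^t*)
    & forall s, isP (U ^t* *m W s *m U)].
Proof.
rewrite /clifford pauli_groupE /=; split=> [[UU dU UP]|[UU dU UP PU]].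
  have WP (s : label n) : [set A | isP A] (W s) by exact: isP_W.
  split=> // s.
    have : [set U *m P *m U ^t* | P in [set A | isP A]] (U *m W s *m U ^t*).
      by exists (W s).
    by rewrite UP.
  have := WP s; rewrite -UP => -[P PP <-].
  by rewrite !mulmxA unitarymx_mulVmx // mul1mx -mulmxA unitarymx_mulVmx // mulmx1.
split=> //; apply/seteqP; split=> [_ [A [a [s ->]] <-]|A [a [s ->]]].
  by rewrite -scalemxAr -scalemxAl; apply: isP_Z.
exists ('i ^+ a *: (U ^t* *m W s *m U)); first exact: isP_Z.
rewrite -scalemxAr -scalemxAl !mulmxA (unitarymxP UU) mul1mx -mulmxA.
by rewrite (unitarymxP UU) mulmx1.
Qed.

Lemma clifford1 n : clifford R n 1%:M.
Proof.
apply/cliffordP; split; rewrite ?det1 ?unitarymx1 // => s;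
by rewrite hadj1 mul1mx mulmx1; exact: isP_W.
Qed.

Lemma isP_conj n (U A : op R (bits n)) : (forall s, isP (U *m W s *m U ^t*)) ->
  isP A -> isP (U *m A *m U ^t*).
Proof. by move=> UP [a [s ->]]; rewrite -scalemxAr -scalemxAl; apply: isP_Z. Qed.

Lemma clifford_adj n (U : op R (bits n)) : clifford R n U -> clifford R n (U ^t*).
Proof.
move=> /cliffordP[UU dU UP PU]; apply/cliffordP; rewrite trmxCK.
split; [exact: unitarymx_adj | | exact: PU | exact: UP].
by rewrite det_map_mx det_tr dU rmorph1.
Qed.

Lemma clifford_mul n (U V : op R (bits n)) :
  clifford R n U -> clifford R n V -> clifford R n (U *m V).
Proof.
move=> /cliffordP[UU dU UP PU] /cliffordP[VU dV VP PV]; apply/cliffordP.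
split; first exact: (mul_unitarymx UU VU).
- by rewrite det_mulmx dU dV mulr1.
- move=> s; rewrite hadj_mul !mulmxA -(mulmxA U) -(mulmxA U).
  exact: isP_conj.
- move=> s; rewrite hadj_mul !mulmxA -(mulmxA (V ^t*)) -(mulmxA (V ^t*)).
  by rewrite -[X in _ *m X](trmxCK V); apply: isP_conj; rewrite ?trmxCK.
Qed.

(* [U = (1 + K) / sqrt 2] where [K] is the multiple of [W k] with [K ^ 2 = -1]. *)
Lemma isP_rotation n (k : label n) : exists2 U : op R (bits n), U \is unitarymx &
  forall s, (om R k s = 1 -> U *m W s *m U ^t* = W s /\ U ^t* *m W s *m U = W s) /\
            (om R k s = -1 -> exists a b : nat, U *m W s *m U ^t* = 'i ^+ a *: W (ladd k s) /\
               U ^t* *m W s *m U = 'i ^+ b *: W (ladd k s)).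
Proof.
have [a KK] : exists a : nat, ('i ^+ a *: W k) *m ('i ^+ a *: W k) = - 1%:M.
  case/orP: (bsgn_cases R k.1 k.2) => /eqP e.
    exists 1%N; rewrite -scalemxAl -scalemxAr W_mul_self e !scalerA mulr1 -expr2 sqrCi.
    by rewrite scaleN1r.
  by exists 0%N; rewrite expr0 scale1r W_mul_self e scaleN1r.
set K := _ *: _ in KK.
have KKh : K *m K ^t* = 1%:M.
  rewrite /K hadjZ -scalemxAl -scalemxAr (unitarymxP (W_unitary _ k)) scalerA.
  by rewrite rmorphXn /= conjCi -exprMn mulrN -expr2 sqrCi opprK expr1n scale1r.
have Kh : K ^t* = - K.
  by rewrite -[LHS]mul1mx -[1%:M]opprK -KK -mulNmx -mulmxA KKh mulmx1.
pose r : C := (sqrtC 2)^-1.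
have rh : r^* = r by rewrite fmorphV /= geC0_conj // sqrtC_ge0 ler0n.
have rr : r * r = 2^-1 by rewrite -invfM -expr2 sqrtCK.
pose U : op R (bits n) := r *: (1%:M + K).
have Uh : U ^t* = r *: (1%:M - K) by rewrite hadjZ rh hadjD hadj1 Kh.
have mul2 (A : op R (bits n)) (B : op R (bits n)) : A = B + B -> (r * r) *: A = B.
  move=> ->; rewrite rr -[B + B]mulr2n -[B *+ 2]scaler_nat scalerA mulVf ?scale1r //.
pose P : op R (bits n) := 1%:M + K; pose Q : op R (bits n) := 1%:M - K.
have PQ : P *m Q = 1%:M + 1%:M.
  by rewrite mulmxDl mul1mx mulmxBr mulmx1 KK opprK addrA subrK.
have QP : Q *m P = 1%:M + 1%:M.
  by rewrite mulmxBl mul1mx mulmxDr mulmx1 KK opprD opprK addrA addrK.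
have PP : P *m P = K + K.
  by rewrite mulmxDl mul1mx mulmxDr mulmx1 KK addrC addrA subrK.
have QQ : Q *m Q = - (K + K).
  by rewrite mulmxBl mul1mx mulmxBr mulmx1 KK opprK opprD addrC addrA subrK opprD.
have conjE (A B S D : op R (bits n)) : S *m A *m B = D + D -> r *: S *m A *m (r *: B) = D.
  by move=> e; rewrite -scalemxAl -scalemxAl -scalemxAr scalerA; apply: mul2.
exists U.
  apply/unitarymxP; rewrite Uh /U -scalemxAl -scalemxAr scalerA; exact: mul2.
move=> s; have KW : K *m W s = om R k s *: (W s *m K).
  by rewrite /K -scalemxAl W_comm -scalemxAr !scalerA mulrC.
rewrite Uh; split=> ks; rewrite ks ?scale1r ?scaleN1r in KW.
  have PA : P *m W s = W s *m P by rewrite mulmxDl mulmxDr mul1mx mulmx1 KW.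
  have QA : Q *m W s = W s *m Q by rewrite mulmxBl mulmxBr mul1mx mulmx1 KW.
  split; apply: conjE.
    by rewrite PA -mulmxA PQ mulmxDr mulmx1.
  by rewrite QA -mulmxA QP mulmxDr mulmx1.
have PA : P *m W s = W s *m Q by rewrite mulmxDl mulmxBr mul1mx mulmx1 KW.
have QA : Q *m W s = W s *m P by rewrite mulmxBl mulmxDr mul1mx mulmx1 KW opprK.
have [c cE] : exists c : nat, K *m W s = 'i ^+ c *: W (ladd k s).
  rewrite /K -scalemxAl W_mul scalerA.
  case/orP: (bsgn_cases R k.2 s.1) => /eqP->; first by exists a; rewrite mulr1.
  by exists (a + 2)%N; rewrite exprD sqrCi.
exists c, (c + 2)%N; rewrite exprD sqrCi mulrN1 scaleNr -cE.
split; apply: conjE.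
  by rewrite PA -mulmxA QQ mulmxN mulmxDr KW opprD.
by rewrite QA -mulmxA PP mulmxDr KW opprK.
Qed.

(** [clifford] asks for determinant 1, so the phase [z] is a root of [1 / \det U] of order the
    dimension. It has modulus 1 because the determinant of a unitary has, and it cancels in
    conjugations. *)
Lemma clifford_scale n (U : op R (bits n)) : U \is unitarymx ->
  (forall s, isP (U *m W s *m U ^t*)) -> (forall s, isP (U ^t* *m W s *m U)) ->
  exists2 z : C, z * z^* = 1 & clifford R n (z *: U).
Proof.
move=> UU UP PU; set m := #|{: bits n}|.
have m0 : (0 < m)%N by rewrite /m card_tuple card_bool expn_gt0.
have dd : \det U * (\det U)^* = 1.
  have := congr1 determinant (unitarymxP UU).
  by rewrite det_mulmx det1 det_map_mx det_tr.
pose z := m.-root (\det U)^-1.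
have zm : z ^+ m = (\det U)^-1 by rewrite rootCK.
have zz : z * z^* = 1.
  have nz : `|z| ^+ m = 1.
    rewrite -normrX zm normfV; apply/eqP; rewrite invr_eq1.
    by rewrite -(@pexpr_eq1 _ _ 2) // normCK dd.
  by rewrite -normCK; move/eqP: nz; rewrite pexpr_eq1 // => /eqP->; rewrite expr1n.
have zz' : z^* * z = 1 by rewrite mulrC.
exists z; first exact: zz.
apply/cliffordP; split.
- by apply/unitarymxP; rewrite hadjZ -scalemxAl -scalemxAr scalerA zz scale1r (unitarymxP UU).
- rewrite detZ zm mulVf //; apply: contra_eq_neq dd => ->.
  by rewrite mul0r eq_sym oner_eq0.
- by move=> s; rewrite hadjZ -!scalemxAl -scalemxAr scalerA zz scale1r.
- by move=> s; rewrite hadjZ -!scalemxAl -scalemxAr scalerA zz' scale1r.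
Qed.

(** The Pauli with label [ladd s t] anticommutes with [W s], so the rotation about it multiplies one
    by the other and turns [s] into [t]. *)
Lemma clifford_anticomm n (s t : label n) : om R s t = -1 ->
  exists2 U, clifford R n U & exists c : C, U *m W s *m U ^t* = c *: W t.
Proof.
move=> st; have [U UU Uc] := isP_rotation (ladd s t).
have UP q : isP (U *m W q *m U ^t*) /\ isP (U ^t* *m W q *m U).
  have [] := Uc q; case/orP: (om_cases R (ladd s t) q) => /eqP -> h1 h2.
    by have [-> ->] := h1 erefl; split; exact: isP_W.
  by have [a [b [-> ->]]] := h2 erefl; split; apply/isP_Z/isP_W.
have [z zz zU] := clifford_scale UU (fun q => (UP q).1) (fun q => (UP q).2).
exists (z *: U) => //; have [_ []] := Uc s.
  by rewrite om_addl om_self mul1r omC.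
move=> a [b [e _]]; exists ('i ^+ a).
rewrite hadjZ -!scalemxAl -scalemxAr scalerA zz scale1r e.
by rewrite [ladd s t]laddC -laddA laddv ladd0.
Qed.

Lemma clifford_trans n (s t : label n) : s != lzero n -> t != lzero n ->
  exists2 U, clifford R n U & exists c : C, U *m W s *m U ^t* = c *: W t.
Proof.
move=> s0 t0; have [r [rs rt]] := om_separate R s0 t0.
have [U Uc [c cE]] := @clifford_anticomm n s r (etrans (omC _ _ _) rs).
have [V Vc [d dE]] := @clifford_anticomm n r t rt.
exists (V *m U); first exact: clifford_mul.
exists (c * d); rewrite hadj_mul !mulmxA -(mulmxA V) -(mulmxA V) cE.
by rewrite -scalemxAr -scalemxAl dE scalerA.
Qed.

(** Heisenberg action on Paulis up to phase, in the direction [U^* P U] that pulls an error back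
    through an encoder; hence the left factor of a product acts first. The label is unique by
    [W_inj], and for a Clifford the default of [xget] is never reached. *)
Definition act n (U : op R (bits n)) (s : label n) : label n :=
  xget (lzero n) [set t | exists c : C, U ^t* *m W s *m U = c *: W t].

Lemma actP n (U : op R (bits n)) s : clifford R n U ->
  exists c : C, U ^t* *m W s *m U = c *: W (act U s).
Proof.
move=> /cliffordP[_ _ _ /(_ s)[a [t e]]].
apply: (@xgetPex _ (lzero n) [set t | exists c : C, U ^t* *m W s *m U = c *: W t]).
by exists t, ('i ^+ a).
Qed.

Lemma W_scaled_inj n (A : op R (bits n)) (s t : label n) (c d : C) : A \is unitarymx ->
  A = c *: W s -> A = d *: W t -> s = t.
Proof.
move=> AU ec ed.
have c0 : c != 0.
  by apply: contraTneq (unitarymx_neq0 AU) => c0; rewrite ec c0 scale0r eqxx.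
apply: (@W_inj R _ s t (c^-1 * d)).
by rewrite -scalerA -ed ec scalerA mulVf // scale1r.
Qed.

Lemma conj_unitary n (U A : op R (bits n)) : U \is unitarymx -> A \is unitarymx ->
  U ^t* *m A *m U \is unitarymx.
Proof. by move=> UU AU; exact: (mul_unitarymx (mul_unitarymx (unitarymx_adj UU) AU) UU). Qed.

Lemma act_eq n (U : op R (bits n)) s t c : clifford R n U ->
  U ^t* *m W s *m U = c *: W t -> act U s = t.
Proof.
move=> Uc e; have [d dE] := actP s Uc.
have [UU _ _ _] := (cliffordP U).1 Uc.
by apply: (W_scaled_inj (conj_unitary UU (W_unitary R s)) dE e).
Qed.

Lemma act0 n (U : op R (bits n)) : clifford R n U -> act U (lzero n) = lzero n.
Proof.
move=> Uc; have [UU _ _ _] := (cliffordP U).1 Uc.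
by apply: (@act_eq _ _ _ _ 1 Uc); rewrite !W0 mulmx1 unitarymx_mulVmx // scale1r.
Qed.

Lemma act_mul n (U V : op R (bits n)) s : clifford R n U -> clifford R n V ->
  act (U *m V) s = act V (act U s).
Proof.
move=> Uc Vc; have [c cE] := actP s Uc; have [d dE] := actP (act U s) Vc.
apply: (@act_eq _ _ _ _ (c * d) (clifford_mul Uc Vc)).
rewrite hadj_mul !mulmxA -(mulmxA (V ^t*)) -(mulmxA (V ^t*)) cE.
by rewrite -scalemxAr -scalemxAl dE scalerA.
Qed.

Lemma act1 n (s : label n) : act 1%:M s = s.
Proof.
by apply: (@act_eq _ _ _ _ 1 (clifford1 n)); rewrite hadj1 mul1mx mulmx1 scale1r.
Qed.

Lemma act_trans n (s t : label n) : s != lzero n -> t != lzero n ->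
  exists2 U, clifford R n U & act U s = t.
Proof.
move=> s0 t0; have [U Uc [c cE]] := clifford_trans s0 t0.
exists (U ^t*); first exact: clifford_adj.
by apply: (@act_eq _ _ _ _ c (clifford_adj Uc)); rewrite trmxCK.
Qed.

Lemma act_adjK n (U : op R (bits n)) : clifford R n U ->
  cancel (act U) (act (U ^t*)) .
Proof.
move=> Uc s; have [UU _ _ _] := (cliffordP U).1 Uc.
by rewrite -(act_mul _ Uc (clifford_adj Uc)) (unitarymxP UU) act1.
Qed.

Lemma act_neq0 n (U : op R (bits n)) s : clifford R n U -> s != lzero n ->
  act U s != lzero n.
Proof.
move=> Uc; apply: contra_neq => e.
by rewrite -(act_adjK Uc s) e (act0 (clifford_adj Uc)).
Qed.

Section Uniform.
(** Finiteness of the Clifford group enters as an enumeration [X]. The final estimates split on it: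
    [uniform_mean] over an infinite support is 0, and the bounds are immediate there. *)
Variables (n : nat) (X : {fset op R (bits n)}).
Hypothesis XE : X =i clifford R n.

Lemma mem_clifford (U : X) : clifford R n (val U).
Proof. by apply/set_mem; rewrite -XE; exact: valP. Qed.

(** Right multiplication by a Clifford taking [t] to [t'] injects one fibre into the other. The
    image of a nontrivial Pauli is thus uniform on the [4 ^ n - 1] nontrivial labels. *)
Lemma leq_card_act (s t t' : label n) : t != lzero n -> t' != lzero n ->
  (#|[pred U : X | act (val U) s == t]| <= #|[pred U : X | act (val U) s == t']|)%N.
Proof.
move=> t0 t0'; have [V Vc Vt] := act_trans t0 t0'.
have Vm (U : X) : val U *m V \in X.
  by rewrite XE; apply/mem_set/clifford_mul => //; exact: mem_clifford.
pose f (U : X) : X := [` Vm U]%fset.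
have [VU _ _ _] := (cliffordP V).1 Vc.
have f_inj : injective f.
  move=> U U' /(congr1 val) /= /(congr1 (mulmx^~ (V ^t*))).
  by rewrite -!mulmxA (unitarymxP VU) !mulmx1 => /val_inj.
rewrite -(card_imset _ f_inj); apply/subset_leq_card/fintype.subsetP => _ /imsetP[U + ->].
by rewrite !inE /= => /eqP e; rewrite (act_mul _ (mem_clifford U) Vc) e Vt eqxx.
Qed.

Lemma card_act (s t : label n) : s != lzero n -> t != lzero n ->
  (#|[pred U : X | act (val U) s == t]| * (4 ^ n).-1 = #|{: X}|)%N.
Proof.
move=> s0 t0.
transitivity (\sum_(t' | t' != lzero n) #|[pred U : X | act (val U) s == t']|)%N.
  rewrite (eq_bigr (fun=> #|[pred U : X | act (val U) s == t]|)); last first.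
    by move=> t' t0'; apply/eqP; rewrite eqn_leq !leq_card_act.
  rewrite sum_nat_const mulnC; congr (_ * _)%N.
  rewrite (eq_card (B := predC1 (lzero n))) // cardC1.
  by rewrite /label card_prod !card_tuple card_bool -expnMn.
under eq_bigr do rewrite -sum1_card.
rewrite (exchange_big_dep xpredT) //= -[X in _ = X]sum1_card; apply: eq_bigr => U _.
rewrite (big_pred1 (act (val U) s)) // => t' /=; rewrite inE [in RHS]eq_sym.
by case: (act (val U) s =P t') => [<-|]; rewrite ?andbF // andbT act_neq0 //; exact: mem_clifford.
Qed.

Lemma card_act_in (Q : {set label n}) (s : label n) : s != lzero n -> lzero n \notin Q ->
  (#|[pred U : X | act (val U) s \in Q]| * (4 ^ n).-1 = #|Q| * #|{: X}|)%N.
Proof.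
move=> s0 Q0; have t0 t : t \in Q -> t != lzero n by apply: contraTneq => ->.
rewrite -sum_nat_const -(eq_bigr _ (fun t tQ => card_act s0 (t0 t tQ))) -big_distrl; congr (_ * _)%N => /=.
under eq_bigr do rewrite -sum1_card.
rewrite (exchange_big_dep xpredT) //= -[LHS]sum1_card [LHS]big_mkcond; apply: eq_bigr => U _ /=; apply/esym.
rewrite inE; case: ifP => UQ.
  rewrite (big_pred1 (act (val U) s)) // => t' /=; rewrite inE [in RHS]eq_sym.
  by case: (act (val U) s =P t') => [<-|]; rewrite ?andbF // UQ.
rewrite big_pred0 // => t'; rewrite inE; case: (act (val U) s =P t') => [<-|]; rewrite ?andbF //.
by rewrite UQ.
Qed.

End Uniform.

End Clifford.

(** * Maximum-likelihood decoding of coupling noise *)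

Section MaximumLikelihood.
Variable R : realType.

(* [a] is corrected when it is more likely than every error it can be confused
   with; the failure bound below comes from [pr a <= sqrt (pr a * pr b)]. *)
Definition ml_correctable (I : finType) (pr : I -> R) (u : rel I) : {set I} :=
  [set a | [forall b, (b != a) && (pr a <= pr b) ==> ~~ u a b]]%SET.

Lemma ml_correctableP (I : finType) (pr : I -> R) (u : rel I) : symmetric u ->
  {in ml_correctable pr u &, forall a b, a != b -> ~~ u a b}.
Proof.
move=> us a b; rewrite !inE => /forallP/(_ b)/implyP ha /forallP/(_ a)/implyP hb ab.
have [le|/ltW le] := leP (pr a) (pr b); first by apply: ha; rewrite eq_sym ab.
by rewrite us; apply: hb; rewrite ab.
Qed.

Lemma ml_failure_le (I : finType) (pr : I -> R) (u : rel I) :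
  (forall a, 0 <= pr a) -> \sum_a pr a = 1 ->
  1 - \sum_(a in ml_correctable pr u) pr a <=
  \sum_a \sum_(b | b != a) Num.sqrt (pr a * pr b) * (u a b)%:R.
Proof.
move=> pr0 pr1; rewrite -{1}pr1 (bigID (mem (ml_correctable pr u))) /= addrC addrK.
rewrite big_mkcond; apply: ler_sum => a _.
have S0 b : 0 <= Num.sqrt (pr a * pr b) * (u a b)%:R by rewrite mulr_ge0 // sqrtr_ge0.
case: ifPn => [|_]; last by apply: sumr_ge0 => b _; exact: S0.
rewrite inE => /forallPn[b]; rewrite negb_imply negbK => /andP[/andP[ba le] uab].
rewrite (bigD1 b) //= uab mulr1 -[leLHS]addr0; apply: lerD; last by apply: sumr_ge0 => c _; exact: S0.
by rewrite -[leLHS](@ger0_norm _ (pr a)) // -sqrtr_sqr ler_wsqrtr // expr2 ler_wpM2l.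
Qed.

End MaximumLikelihood.

(** * Coupling noise as random Z-strings *)

Section ZZNoise.
Variable R : realType.
Local Notation C := R[i].

(* The Z-string of the couplings [b]: qubit [i] lies on couplings [i - 1] and [i]. *)
Definition zlab n (b : bits n.-1) : bits n :=
  [tuple nth false b i (+) (if val i is j.+1 then nth false b j else false) | i < n].

Lemma nth_zlab n (b : bits n.-1) i : (i < n)%N -> nth false (zlab b) i =
  nth false b i (+) (if i is j.+1 then nth false b j else false).
Proof. by move=> ni; rewrite nth_mktuple_bits. Qed.

Lemma zlab_xor n (a b : bits n.-1) : zlab (bxor a b) = bxor (zlab a) (zlab b).
Proof.
apply: bitsP => i ni; rewrite nth_bxor !nth_zlab // nth_bxor.
case: i ni => [|i] ni /=; rewrite ?nth_bxor ?addbF //.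
by rewrite addbACA.
Qed.

(** On an open line the first qubit lies on one coupling only, so the couplings can be read off the
    Z-string from left to right. *)
Lemma zlab_eq0 n (b : bits n.-1) : zlab b = bzero n -> b = bzero n.-1.
Proof.
move=> zb; apply: bitsP => i; rewrite nth_bzero; elim: i => [|i IH] ni.
  have ni' : (0 < n)%N by lia.
  by have := nth_bzero n 0; rewrite -zb nth_zlab //= addbF.
have ni' : (i.+1 < n)%N by lia.
by have := nth_bzero n i.+1; rewrite -zb nth_zlab //= IH ?addbF //; lia.
Qed.

(** Summation by parts: the parity of [x] over the Z-string is regrouped by couplings. *)
Lemma bsgn_zlab n (b : bits n.-1) (x : bits n) : bsgn R (zlab b) x =
  \prod_(i < n.-1) (-1) ^+ (tnth b i && (nth false x i (+) nth false x i.+1)).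
Proof.
have sg (d e f : bool) : (-1) ^+ ((d (+) e) && f) = (-1) ^+ (d && f) * (-1) ^+ (e && f) :> C.
  by case: d; case: e; case: f; rewrite /= ?expr0 ?expr1 ?(mul1r, mulr1, mulrNN).
case: n b x => [|n] b x; first by rewrite /bsgn !big_ord0.
rewrite /= in b *.
transitivity ((\prod_(i < n.+1) (-1) ^+ (nth false b i && nth false x i)) *
   \prod_(i < n.+1) (-1) ^+ ((if val i is j.+1 then nth false b j else false) && nth false x i) : C).
  rewrite /bsgn -big_split; apply: eq_bigr => i _ /=.
  by rewrite tnth_mktuple (tnth_nth false x); exact: sg.
(* There are [n] couplings on [n + 1] qubits, so index [n] reads the default [false]. *)
rewrite big_ord_recr /= [X in _ * X * _](_ : _ = 1); last by rewrite nth_default ?size_tuple.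
rewrite mulr1 [X in _ * X]big_ord_recl /= expr0 mul1r -big_split; apply: eq_bigr => i _ /=.
rewrite (tnth_nth false) /bump /= add1n.
by case: (nth false b i); case: (nth false x i); case: (nth false x i.+1);
   rewrite /= ?expr0 ?expr1 ?(mul1r, mulr1, mulrNN).
Qed.

Lemma ment_Wz n (z x y : bits n) :
  ment (W R (bzero n, z)) x y = (x == y)%:R * bsgn R z x.
Proof.
rewrite ment_W; have [->|xy] := eqVneq x y.
  rewrite mul1r; apply: eq_bigr => i _; rewrite /went tnth_mktuple addFb eqxx mul1r.
  by [].
rewrite mul0r; have [i xyi] : exists i, tnth x i != tnth y i.
  apply/existsP; apply: contraT => /existsPn h; case/eqP: xy.
  by apply: eq_from_tnth => i; apply/eqP; move/negPn: (h i).
by rewrite (bigD1 i) //= /went !tnth_mktuple addFb (negPf xyi) !mul0r.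
Qed.

Lemma Wz_mulE n (z : bits n) (A : op R (bits n)) x y :
  ment (W R (bzero n, z) *m A) x y = bsgn R z x * ment A x y.
Proof.
rewrite ment_mul (bigD1 x) //= big1 ?addr0 => [|t tx].
  by rewrite ment_Wz eqxx mul1r.
by rewrite ment_Wz eq_sym (negPf tx) !mul0r.
Qed.

Lemma Wz_mulrE n (z : bits n) (A : op R (bits n)) x y :
  ment (A *m W R (bzero n, z)) x y = bsgn R z y * ment A x y.
Proof.
rewrite ment_mul (bigD1 y) //= big1 ?addr0 => [|t ty].
  by rewrite ment_Wz eqxx mul1r mulrC.
by rewrite ment_Wz (negPf ty) mul0r mulr0.
Qed.

Lemma Wz_adj n (z : bits n) : (W R (bzero n, z)) ^t* = W R (bzero n, z).
Proof. by rewrite W_adj /= bsgn0l scale1r. Qed.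

Lemma pauliZ_atE n i : pauliZ_at R n i = W R (bzero n, [tuple (j == i :> nat) | j < n]).
Proof.
rewrite /pauliZ_at pauli_stringE.
rewrite [X in 'i ^+ X](_ : _ = 0)%N ?expr0 ?scale1r; last first.
  by apply: big1 => j _; case: (_ == _).
by congr (W R (_, _)); apply: eq_from_tnth => j; rewrite !tnth_mktuple; case: (_ == _).
Qed.

Lemma bsgn_delta n i (x : bits n) :
  bsgn R [tuple (j == i :> nat) | j < n] x = (-1) ^+ nth false x i.
Proof.
have [lin|nli] := ltnP i n.
  rewrite /bsgn (bigD1 (Ordinal lin)) //= tnth_mktuple eqxx big1 ?mulr1.
    by rewrite (tnth_nth false).
  by move=> j; rewrite -val_eqE /= tnth_mktuple => /negPf ->.
rewrite nth_default ?size_tuple //; apply: big1 => j _; rewrite tnth_mktuple.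
by rewrite ltn_eqF // (leq_trans (ltn_ord j)).
Qed.

Definition zz_prob (p : R) m (b : bits m) : R :=
  \prod_(i < m) (if tnth b i then p else 1 - p).

Lemma zz_prob_ge0 p m (b : bits m) : 0 <= p <= 1 -> 0 <= zz_prob p b.
Proof. by case/andP=> p0 p1; apply: prodr_ge0 => i _; case: ifP; rewrite ?subr_ge0. Qed.

Lemma zz_prob_sum p m : \sum_(b : bits m) zz_prob p b = 1.
Proof.
rewrite (sum_prod_bits (fun _ (b : bool) => if b then p else 1 - p)).
by apply: big1 => i _; rewrite big_bool /= addrC subrK.
Qed.

(** Couplings are diagonal, so the noise multiplies the entry [(x, y)] by a product over couplings
    of [1 - p + p s], with [s] a sign; expanding this product gives the sum over patterns. *)
Lemma zz_noise_kraus p n (rho : op R (bits n)) : zz_noise p n rho =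
  \sum_(b : bits n.-1) (zz_prob p b)%:C%C *:
    (W R (bzero n, zlab b) *m rho *m (W R (bzero n, zlab b)) ^t*).
Proof.
apply: mentP => x y.
pose s (i : nat) : C := (-1) ^+ (nth false x i (+) nth false x i.+1) *
  (-1) ^+ (nth false y i (+) nth false y i.+1).
transitivity ((\prod_(i < n.-1) ((1 - p)%:C%C + p%:C%C * s i)) * ment rho x y).
  rewrite /zz_noise.
  suff H : forall rho, ment ((\big[comp/id]_(i < n.-1) zz_coupling p i) rho) x y =
     (\prod_(i < n.-1) ((1 - p)%:C%C + p%:C%C * s i)) * ment rho x y by rewrite H.
  apply: (big_ind2 (fun (f : op R (bits n) -> op R (bits n)) c =>
    forall rho, ment (f rho) x y = c * ment rho x y)) => [r|f c g d fc gd r|i _ r].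
  - by rewrite mul1r.
  - by rewrite /= fc gd mulrA.
  rewrite /zz_coupling !pauliZ_atE mentD !mentZ mulrDl; congr (_ + _).
  rewrite -!mulmxA Wz_mulE Wz_mulE !mulmxA Wz_mulrE Wz_mulrE !bsgn_delta -mulrA.
  congr (_ * _); rewrite !mulrA; congr (_ * _); rewrite /s !signr_addb; ring.
rewrite ment_sum.
transitivity (\sum_(b : bits n.-1) (\prod_(i < n.-1) ((if tnth b i then p else 1 - p)%:C%C *
   (if tnth b i then s i else 1))) * ment rho x y).
  rewrite -mulr_suml; congr (_ * _).
  rewrite (sum_prod_bits (fun i (b : bool) => (if b then p else 1 - p)%:C%C * (if b then s i else 1))).
  by apply: eq_bigr => i _; rewrite big_bool /= mulr1 addrC.
apply: eq_bigr => b _; rewrite mentZ Wz_adj Wz_mulrE Wz_mulE !bsgn_zlab mulrA mulrA.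
congr (_ * _); rewrite big_split /= /zz_prob rmorph_prod; congr (_ * _).
rewrite -big_split /=; apply: eq_bigr => i _; case: (tnth b i) => /=.
  by rewrite /s mulrC.
by rewrite !expr0 mulr1.
Qed.

(* Bhattacharyya coefficient of the error distribution and its translate by [b]. *)
Definition bhatt (p : R) m (b : bits m) : R :=
  \prod_(i < m) (if tnth b i then 2 * Num.sqrt (p * (1 - p)) else 1).

Lemma sqrtr_prod (I : finType) (F : I -> R) : (forall i, 0 <= F i) ->
  Num.sqrt (\prod_i F i) = \prod_i Num.sqrt (F i).
Proof.
move=> F0; suff [] : 0 <= \prod_i F i /\ Num.sqrt (\prod_i F i) = \prod_i Num.sqrt (F i) by [].
elim/big_rec2 : _ => [|i y x _ [x0 <-]]; first by rewrite sqrtr1.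
by rewrite mulr_ge0 // sqrtrM.
Qed.

Lemma bhatt_sum p m (c : bits m) : 0 <= p <= 1 ->
  \sum_(a : bits m) Num.sqrt (zz_prob p a * zz_prob p (bxor a c)) = bhatt p c.
Proof.
case/andP=> p0 p1; have q0 : 0 <= 1 - p by rewrite subr_ge0.
pose q (b : bool) := if b then p else 1 - p.
have qq b : 0 <= q b by case: b.
transitivity (\sum_(a : bits m) \prod_(i < m) Num.sqrt (q (tnth a i) * q (tnth a i (+) tnth c i))).
  apply: eq_bigr => a _; rewrite /zz_prob -big_split /= -sqrtr_prod => [|i].
    by congr Num.sqrt; apply: eq_bigr => i _; rewrite tnth_mktuple.
  by rewrite mulr_ge0.
rewrite (sum_prod_bits (fun i b => Num.sqrt (q b * q (b (+) tnth c i)))).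
apply: eq_bigr => i _; rewrite big_bool /q; case: (tnth c i) => /=.
  by rewrite [(1 - p) * p]mulrC -mulr2n mulr_natl.
by rewrite -!expr2 !sqrtr_sqr !ger0_norm // addrC subrK.
Qed.

Lemma bhatt_ge0 p m (b : bits m) : 0 <= bhatt p b.
Proof. by apply: prodr_ge0 => i _; case: ifP => // _; rewrite mulr_ge0 // sqrtr_ge0. Qed.

Definition detected n (L : finType) (V : 'M[C]_(#|{: bits n}|, #|L|)) (s : label n) : bool :=
  V ^t* *m W R s *m V == 0.

Lemma sum_neq_bxor n (V : nmodType) (a : bits n) (F : bits n -> V) :
  \sum_(b | b != a) F b = \sum_(c | c != bzero n) F (bxor a c).
Proof.
rewrite (reindex_inj (can_inj (bxorK a))); apply: eq_bigl => b.
by rewrite -(bxor_eq0 (bxor a b) a) (bxorC _ a) bxorK.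
Qed.

(** The failure probability [f] is kept explicit: its second bound is linear in the detection
    indicators, ready for averaging over the gates, and [f <= 1] gives the trivial bound on the
    error. *)
Lemma zz_choi_error_le p n (L : finType) (V : 'M[C]_(#|{: bits n}|, #|L|))
    (enc : op R L -> op R (bits n)) :
  0 <= p <= 1 -> (0 < #|L|)%N -> V ^t* *m V = 1%:M ->
  (forall rho, enc rho = V *m rho *m V ^t*) ->
  exists2 f : R, choi_error (zz_noise p n) enc <= Num.sqrt f & f <= 1 /\
    f <= \sum_(b : bits n.-1 | b != bzero _)
           bhatt p b * (~~ detected V (bzero n, zlab b))%:R.
Proof.
move=> p01 L0 VV encE.
pose u (a b : bits n.-1) := ~~ detected V (bzero n, zlab (bxor a b)).
have us : symmetric u by move=> a b; rewrite /u bxorC.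
have pr0 (b : bits n.-1) : 0 <= zz_prob p b by exact: zz_prob_ge0.
pose A := ml_correctable (@zz_prob p _) u.
exists (1 - \sum_(a in A) zz_prob p a).
  apply: (choi_error_le (E := fun b => W R (bzero n, zlab b)) L0 VV _ pr0 _ encE).
  - by move=> b; exact: W_unitary.
  - exact: zz_noise_kraus.
  - move=> a b aA bA ab; have := ml_correctableP us aA bA ab.
    rewrite /u /detected negbK => /eqP d0; rewrite Wz_adj -(mulmxA (V ^t*)).
    by rewrite W_mul /= bsgnC bsgn0l scale1r /ladd /= bxorv -zlab_xor.
split; first by rewrite gerBl sumr_ge0.
apply: (le_trans (ml_failure_le u pr0 (zz_prob_sum p _))).
apply: (@le_trans _ _ (\sum_(a : bits n.-1) \sum_(c : bits n.-1 | c != bzero _)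
   Num.sqrt (zz_prob p a * zz_prob p (bxor a c)) * (~~ detected V (bzero n, zlab c))%:R)).
  apply: ler_sum => a _; rewrite le_eqVlt; apply/orP; left; apply/eqP.
  by rewrite [LHS]sum_neq_bxor; apply: eq_bigr => b _; rewrite /u (bxorK a b).
rewrite exchange_big /=; apply: ler_sum => c _.
by rewrite -mulr_suml bhatt_sum.
Qed.

(* A Z-string supported in [S] is determined by the values on [S] of the
   couplings that create it, since these are constant off [S]. *)
Lemma sum_bhatt_supp_le p n (S : pred nat) : 0 <= p <= 1 ->
  \sum_(b : bits n.-1 | [forall i : 'I_n, tnth (zlab b) i ==> S i]) bhatt p b <=
  \prod_(i < n) (if S i then 1 + 2 * Num.sqrt (p * (1 - p)) else 1).
Proof.
move=> p01; set beta := 2 * _.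
have b0 : 0 <= beta by rewrite mulr_ge0 // sqrtr_ge0.
have b1 : beta <= 1.
  have h : Num.sqrt (p * (1 - p)) <= 2^-1.
    rewrite -[leRHS]ger0_norm ?invr_ge0 // -sqrtr_sqr ler_wsqrtr //.
    have := sqr_ge0 (p - 2^-1); rewrite !expr2; nra.
  rewrite /beta; lra.
pose B : pred (bits n.-1) := fun b => [forall i : 'I_n, tnth (zlab b) i ==> S i].
pose mask (b : bits n.-1) : bits n.-1 := [tuple tnth b i && S i | i < n.-1].
(* Weight of a masked pattern: [beta] or 1 on [S], while off [S] only the value [false] is
   allowed. *)
pose G (i : 'I_n.-1) (b : bool) : R := if S i then (if b then beta else 1) else (~~ b)%:R.
have G0 i b : 0 <= G i b by rewrite /G; case: ifP => _; [case: ifP|].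
(* Where the Z-string vanishes at qubit [i + 1], couplings [i] and [i + 1] agree; so the masked
   pattern determines the pattern from left to right. *)
have maskI : {in B &, injective mask}.
  move=> a b /forallP Ba /forallP Bb e; apply: bitsP => i; elim: i => [|i IH] ni.
    have [S0|nS0] := boolP (S 0%N).
      have /(congr1 (fun c : bits n.-1 => nth false c 0)) := e.
      by rewrite !nth_mktuple_bits /= S0 !andbT !(tnth_nth false).
    have ni' : (0 < n)%N by lia.
    have := Ba (Ordinal ni'); have := Bb (Ordinal ni').
    by rewrite !tnth_mktuple /= !implybE (negPf nS0) !orbF !addbF => /negPf-> /negPf->.
  have [Si|nSi] := boolP (S i.+1).
    have /(congr1 (fun c : bits n.-1 => nth false c i.+1)) := e.
    by rewrite !nth_mktuple_bits /= Si !andbT !(tnth_nth false).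
  have ni' : (i.+1 < n)%N by lia.
  have := Ba (Ordinal ni'); have := Bb (Ordinal ni').
  rewrite !tnth_mktuple /= !implybE (negPf nSi) !orbF IH ?(ltnW ni) //.
  by case: (nth false b i); case: (nth false a i.+1); case: (nth false b i.+1).
(* Masking only removes factors [beta <= 1]. *)
apply: (@le_trans _ _ (\sum_(b | B b) \prod_(i < n.-1) G i (tnth (mask b) i))).
  apply: ler_sum => b _; apply: ler_prod => i _; rewrite /G tnth_mktuple.
  by case: (tnth b i); case: (S i); rewrite //= ?b0 ?b1 ?ler01 ?lexx.
apply: (@le_trans _ _ (\sum_(c : bits n.-1) \prod_(i < n.-1) G i (tnth c i))).
  rewrite -(big_imset (fun c => \prod_(i < n.-1) G i (tnth c i)) maskI) /=.
  rewrite [leRHS](bigID (mem [set mask x | x in B]%SET)) /= lerDl.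
  by apply: sumr_ge0 => c _; apply: prodr_ge0.
rewrite sum_prod_bits.
case: n @B @mask @G G0 maskI => [|n] B mask G G0 _; first by rewrite !big_ord0.
(* The last qubit starts no coupling; its factor on the right is at least 1. *)
rewrite [leRHS]big_ord_recr /= -[leLHS]mulr1; apply: ler_pM => //.
- by apply: prodr_ge0 => i _; apply: sumr_ge0.
- by apply: ler_prod => i _; rewrite big_bool /G /=; case: (S i); rewrite ?add0r ?lexx ?ler01 // addrC lexx andbT addr_ge0.
- by case: ifP => // _; rewrite lerDl.
Qed.

End ZZNoise.

(** * Undetected errors in the double-layer ensemble *)

Section DomainWalls.
Variable R : realType.
Implicit Types (eta g : R) (M : nat).

Lemma prod_pairs (F : nat -> R) M :
  \prod_(r < (2 * M.+1)%N) F r = \prod_(i < M.+1) (F (2 * i)%N * F (2 * i + 1)%N).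
Proof.
elim: M => [|M IH]; first by rewrite !big_ord_recr !big_ord0 /= !mul1r.
rewrite [RHS]big_ord_recr -IH /= (_ : 2 * M.+2 = (2 * M.+1).+2)%N; last by lia.
by rewrite !big_ord_recr /= mulrA addn1.
Qed.

Lemma prod_inner_pairs (F : nat -> R) M :
  \prod_(r < (2 * M.+1)%N) F r =
  F 0 * F (2 * M + 1)%N * \prod_(j < M) (F (2 * j + 1)%N * F (2 * j + 2)%N).
Proof.
elim: M => [|M IH]; first by rewrite !big_ord_recr !big_ord0 /= mul1r mulr1.
rewrite [in RHS]big_ord_recr /= (_ : 2 * M.+2 = (2 * M.+1).+2)%N; last by lia.
rewrite 2!big_ord_recr /= IH.
rewrite (_ : 2 * M.+1 = 2 * M + 2)%N; last by lia.
rewrite (_ : (2 * M + 2).+1 = 2 * M + 2 + 1)%N; last by lia.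
ring.
Qed.

Lemma prod_bonds (F : nat -> R) M :
  \prod_(r < (2 * M + 1)%N) F r =
  (\prod_(i < M.+1) F (2 * i)%N) * \prod_(j < M) F (2 * j + 1)%N.
Proof.
elim: M => [|M IH]; first by rewrite !big_ord_recr !big_ord0 /= mul1r mulr1.
rewrite [in X in _ = X * _]big_ord_recr [in X in _ = _ * X]big_ord_recr /=.
rewrite (_ : 2 * M.+1 + 1 = (2 * M + 1).+2)%N; last by lia.
rewrite 2!big_ord_recr /= IH (_ : (2 * M + 1).+1 = 2 * M.+1)%N; last by lia.
ring.
Qed.

Definition wall eta (a b : bool) : R := if a != b then eta else 1.

(** Transfer matrix of an open Ising chain: both row sums are [1 + eta], and the factor 2 is the
    choice of the first spin. *)
Lemma sum_walls eta m :
  \sum_(t : bits m.+1) \prod_(r < m) wall eta (nth false t r) (nth false t r.+1) =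
  2 * (1 + eta) ^+ m.
Proof.
have sumS k (F : bits k.+1 -> R) : \sum_(t : bits k.+1) F t =
    \sum_(a : bool) \sum_(t : bits k) F [tuple of a :: t].
  rewrite pair_bigA (reindex (fun at_ : bool * bits k => [tuple of at_.1 :: at_.2])) //=.
  exists (fun t : bits k.+1 => (thead t, [tuple of behead t])) => [[a t]|t] _ /=.
    by rewrite theadE; congr pair; apply: val_inj.
  by rewrite -tuple_eta.
pose Z k a := \sum_(t : bits k) \prod_(r < k) wall eta (nth false (a :: t) r) (nth false t r).
have ZE k a : Z k a = (1 + eta) ^+ k.
  elim: k a => [|k IH] a.
    rewrite /Z (eq_bigr (fun=> 1)) => [|t _]; last by rewrite big_ord0.
    by rewrite sumr_const card_tuple expn0 expr0.
  rewrite /Z sumS.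
  transitivity (\sum_(b : bool) wall eta a b * Z k b).
    apply: eq_bigr => b _; rewrite mulr_sumr; apply: eq_bigr => t _.
    by rewrite big_ord_recl.
  by rewrite big_bool /= !IH -mulrDl exprS; case: a; rewrite /wall /= ?[eta + 1]addrC.
transitivity (\sum_a Z m a); first exact: sumS.
by rewrite big_bool !ZE mulr2n mulrDl mul1r.
Qed.

(** The induction runs on the sharper bound [1 + x + x ^ 2] with [x = m * eta]; at the end [x <= 1]
    absorbs the square. *)
Lemma bernoulli_quadratic eta m : 0 <= eta -> m%:R * eta <= 1 ->
  (1 + eta) ^+ m <= 1 + 2 * m%:R * eta.
Proof.
move=> e0 me; apply: (@le_trans _ _ (1 + m%:R * eta + (m%:R * eta) ^+ 2)); last first.
  have := mulr_ge0 (ler0n R m) e0; nra.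
elim: m me => [|m IH] me; first by rewrite expr0; nra.
rewrite -natr1 in me *.
have m0 : (0 : R) <= m%:R := ler0n R m.
have me' : m%:R * eta <= 1 by apply: le_trans me; rewrite ler_wpM2r // lerDl.
rewrite exprSr; apply: (le_trans (ler_wpM2r _ (IH me'))); first by rewrite addr_ge0.
have : (m%:R * eta) * (m%:R * (eta * eta)) <= 1 * (m%:R * (eta * eta)).
  by rewrite ler_wpM2r // !mulr_ge0.
have := mulr_ge0 e0 e0; rewrite !expr2; nra.
Qed.

(** The fully active pattern has no wall and gives the first term. For all others the region factors
    are bounded by 1, which leaves the wall sum without its two constant patterns: [2 (1 + eta) ^ (2
    M + 1) - 2 <= 4 (2 M + 1) eta]. *)
Lemma sum_patterns_le eta g M : 0 <= eta -> 0 <= g -> g * eta <= 1 ->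
  (2 * M.+1)%:R * eta <= 1 ->
  \sum_(t : bits (2 * M.+1) | t != bzero _)
     ((\prod_(r < (2 * M.+1)%N) (if nth false t r then g * eta else 1)) *
      \prod_(r < (2 * M + 1)%N) wall eta (nth false t r) (nth false t r.+1)) <=
  (g * eta) ^+ (2 * M.+1) + 8 * M.+1%:R * eta.
Proof.
move=> e0 g0 ge1 Me.
have ge0 : 0 <= g * eta by rewrite mulr_ge0.
pose t1 : bits (2 * M.+1) := [tuple true | i < (2 * M.+1)%N].
pose wl (t : bits (2 * M.+1)) := \prod_(r < (2 * M + 1)%N) wall eta (nth false t r) (nth false t r.+1).
have t10 : t1 != bzero _.
  apply/eqP => /(congr1 (fun t : bits _ => nth false t 0)).
  by rewrite nth_bzero nth_mktuple_bits //; lia.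
have wl0 t : 0 <= wl t by apply: prodr_ge0 => r _; rewrite /wall; case: ifP.
have wlz : wl (bzero _) = 1 by apply: big1 => r _; rewrite !nth_bzero /wall.
have wlo : wl t1 = 1.
  by apply: big1 => r _; rewrite /wall !nth_mktuple_bits //; have := ltn_ord r; lia.
have wls : \sum_t wl t = 2 * (1 + eta) ^+ (2 * M + 1).
  rewrite -sum_walls /wl; have -> // : (2 * M.+1 = (2 * M + 1).+1)%N by lia.
rewrite (bigD1 t1) //= lerD //.
  rewrite -/(wl t1) wlo mulr1 -[leRHS](_ : \prod_(r < (2 * M.+1)%N) (g * eta) = _); last first.
    by rewrite prodr_const card_ord.
  rewrite le_eqVlt; apply/orP; left; apply/eqP; apply: eq_bigr => r _.
  by rewrite nth_mktuple_bits.
apply: (@le_trans _ _ (\sum_(t | (t != bzero _) && (t != t1)) wl t)).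
  apply: ler_sum => t _; rewrite ler_piMl ?wl0 //; apply: Num.Theory.prodr_ile1 => r _.
  by case: ifP; rewrite ?ge0 ?ge1 ?lexx ?ler01.
have : \sum_t wl t = 1 + 1 + \sum_(t | (t != bzero _) && (t != t1)) wl t.
  rewrite (bigD1 (bzero _)) //= wlz (bigD1 t1) //= wlo addrA; congr (_ + _).
rewrite wls => H.
have := @bernoulli_quadratic eta (2 * M + 1) e0.
have -> : (2 * M + 1)%:R * eta <= 1.
  apply: le_trans Me; rewrite ler_wpM2r // ler_nat; lia.
move=> /(_ isT); rewrite natrD natrM => B.
have : 8 * M.+1%:R * eta = 8 * (M%:R * eta) + 8 * eta by rewrite -natr1; ring.
nra.
Qed.

End DomainWalls.

(** * Probabilities for a single random Clifford gate *)

Section Counting.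
Variable R : realType.

Lemma lslice_eq0P n w o (s : label n) :
  reflect (forall i, (i < w)%N -> nth false s.1 (o + i) = false /\ nth false s.2 (o + i) = false)
    (lslice w o s == lzero w).
Proof.
apply: (iffP eqP) => [e i iw|s0].
  have /(congr1 (fun t : label w => nth false t.1 i)) := e.
  have /(congr1 (fun t : label w => nth false t.2 i)) := e.
  by rewrite /= !nth_slice // nth_bzero.
by congr pair; apply: bitsP => i iw; rewrite nth_slice // nth_bzero; case: (s0 i iw).
Qed.

Lemma lslice_double_eq0 n w o (s : label n) :
  (lslice (2 * w) o s == lzero (2 * w)) =
  (lslice w o s == lzero w) && (lslice w (o + w) s == lzero w).
Proof.
apply/lslice_eq0P/andP => [s0|[/lslice_eq0P s0 /lslice_eq0P s1] i iw].
  split; apply/lslice_eq0P => i iw; first by apply: s0; lia.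
  by rewrite -addnA; apply: s0; lia.
have [iw'|wi] := ltnP i w; first exact: s0.
have -> : (o + i = o + w + (i - w))%N by lia.
apply: s1; lia.
Qed.

Variables (w : nat) (X : {fset op R (bits w)}).
Hypothesis XE : X =i clifford R w.

(** The exact probability is [(#|Q| - 1) / (4 ^ w - 1)]; adding 1 to numerator and denominator can
    only increase a ratio that is at most 1. *)
Lemma card_act_le (Q : {set label w}) (s : label w) : s != lzero w -> lzero w \in Q ->
  (#|[pred U : X | act (val U) s \in Q]| * 4 ^ w <= #|Q| * #|{: X}|)%N.
Proof.
move=> s0 Q0; set a := #|[pred U : X | act (val U) s \in Q]|.
have aX : (a <= #|{: X}|)%N by exact: max_card.
have aE : a = #|[pred U : X | act (val U) s \in (Q :\ lzero w)%SET]|.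
  apply: eq_card => U; rewrite !inE act_neq0 //; exact: mem_clifford.
have := card_act_in XE (Q := (Q :\ lzero w)%SET) s0; rewrite -aE => H.
have {}H : (a * (4 ^ w).-1 = #|(Q :\ lzero w)%SET| * #|{: X}|)%N.
  by apply: H; rewrite !inE eqxx.
have := cardsD1 (lzero w) Q; rewrite Q0 => ->.
have : (0 < 4 ^ w)%N by rewrite expn_gt0.
move: H aX; case: (4 ^ w)%N => // m /= H aX _.
by rewrite mulnS H mulnDl mul1n leq_add2r.
Qed.

End Counting.

Section HalfCounting.
Variables (R : realType) (xi kappa : nat) (X : {fset op R (bits (2 * xi)%N)}).
Hypothesis XE : X =i clifford R (2 * xi)%N.
Hypothesis kx : (kappa <= xi)%N.
Let eta : R := (2 ^+ (xi - kappa))^-1.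

Lemma card_bits m : #|{: bits m}| = (2 ^ m)%N.
Proof. by rewrite card_tuple card_bool. Qed.

Lemma card_label m : #|{: label m}| = (4 ^ m)%N.
Proof. by rewrite card_prod !card_bits -expnMn. Qed.

(** An X part on an ancilla flips it out of state 0 and is noticed, a Z part is not. Labels are
    unconstrained on the logical qubits, the first [kappa] of each of the two regions. *)
Definition undetectable : {set label (2 * xi)} :=
  [set t | [forall j : 'I_(2 * xi), (kappa <= j %% xi)%N ==> ~~ tnth t.1 j]]%SET.

Lemma card_supported m (P : pred nat) :
  #|[set x : bits m | [forall j : 'I_m, P j ==> ~~ tnth x j]]%SET| =
  (\prod_(j < m) (if P j then 1 else 2))%N.
Proof.
rewrite -sum1_card.
transitivity (\sum_(x : bits m) \prod_(j < m) (P j ==> ~~ tnth x j : nat))%N.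
  rewrite big_mkcond; apply: eq_bigr => x _; rewrite inE; case: ifPn => [/forallP h|/forallPn[j /negPf h]].
    by rewrite big1 // => j _; rewrite h.
  by rewrite (bigD1 j) //= h.
rewrite (sum_prod_bits (fun j b => (P (val j) ==> ~~ b : nat))).
by apply: eq_bigr => j _; rewrite big_bool /=; case: (P j).
Qed.

Lemma card_undetectable : #|undetectable| = (2 ^ (2 * xi) * 2 ^ (2 * kappa))%N.
Proof.
transitivity #|finset.setX [set x : bits (2 * xi) | [forall j : 'I_(2 * xi),
   (kappa <= j %% xi)%N ==> ~~ tnth x j]]%SET [set: bits (2 * xi)]%SET|.
  by apply: eq_card => -[a b]; rewrite !inE andbT.
rewrite cardsX (card_supported _ (fun j => kappa <= j %% xi)%N) cardsT card_bits mulnC.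
congr (_ * _)%N; rewrite -(big_mkord xpredT (fun j => if (kappa <= j %% xi)%N then 1 else 2)%N).
have H k : (\prod_(xi * k <= j < xi * k.+1) (if (kappa <= j %% xi)%N then 1 else 2))%N = (2 ^ kappa)%N.
  rewrite (big_cat_nat _ (n := xi * k + kappa)) /=; try lia.
  rewrite [X in (_ * X)%N]big_nat_cond [X in (_ * X)%N]big1 => [|j /andP[/andP[h1 h2] _]]; last first.
    have -> : j = (k * xi + (j - xi * k))%N by lia.
    rewrite modnMDl modn_small; last by lia.
    by rewrite ifT //; lia.
  rewrite muln1 big_nat_cond (eq_bigr (fun=> 2%N)) => [|j /andP[/andP[h1 h2] _]]; last first.
    have -> : j = (k * xi + (j - xi * k))%N by lia.
    rewrite modnMDl modn_small; last by lia.
    by rewrite ifF //; lia.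
  by rewrite -big_nat_cond prod_nat_const_nat addKn.
rewrite (big_cat_nat _ (n := xi)) /=; try lia.
have := H 0%N; rewrite muln0 muln1 => ->.
have := H 1%N; rewrite muln1 [(xi * 2)%N]mulnC => ->.
by rewrite -expnD addnn mul2n.
Qed.

(** The undetectable labels are a fraction [2 ^ (2 xi) * 2 ^ (2 kappa) / 4 ^ (2 xi) = eta ^ 2] of
    all. *)
Lemma card_act_undetectable (s : label (2 * xi)) : s != lzero _ ->
  #|[pred U : X | act (val U) s \in undetectable]|%:R <= eta ^+ 2 * #|{: X}|%:R.
Proof.
move=> s0.
have z : lzero (2 * xi) \in undetectable.
  by rewrite inE; apply/forallP => j; rewrite tnth_mktuple implybT.
have := card_act_le XE s0 z; rewrite card_undetectable.
set a := #|[pred U : X | _]| => H.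
have E : (2 ^ ((xi - kappa) * 2) * (2 ^ (2 * xi) * 2 ^ (2 * kappa)) = 4 ^ (2 * xi))%N.
  by rewrite -!expnD -[4%N]/(2 ^ 2)%N -expnM; congr (2 ^ _)%N; lia.
rewrite /eta exprVn mulrC ler_pdivlMr ?exprn_gt0 // -exprM -natrX -natrM ler_nat.
rewrite -(@leq_pmul2r (2 ^ (2 * xi) * 2 ^ (2 * kappa))%N) ?muln_gt0 ?expn_gt0 //.
by rewrite [leqRHS]mulnC -mulnA E.
Qed.

Definition half_nz (t : label (2 * xi)) : bool * bool :=
  (lslice xi 0 t != lzero xi, lslice xi xi t != lzero xi).

Lemma half_nzE (t : label (2 * xi)) : (t != lzero _) = (half_nz t).1 || (half_nz t).2.
Proof.
rewrite -[t in LHS](_ : lslice (2 * xi) 0 t = t); last first.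
  by case: t => a b; rewrite /lslice !slice_full.
by rewrite lslice_double_eq0 add0n negb_and.
Qed.

Lemma card_half0_le (o : nat) : o \in [:: 0; xi]%N ->
  (#|[set t : label (2 * xi) | lslice xi o t == lzero xi]%SET| <= 4 ^ xi)%N.
Proof.
move=> o0; rewrite -card_label.
rewrite -(card_in_imset (f := fun t => lslice xi (xi - o) t)); first exact: max_card.
move=> s t; rewrite !inE => /lslice_eq0P s0 /lslice_eq0P t0 e.
have st i : (i < xi)%N -> nth false s.1 (xi - o + i) = nth false t.1 (xi - o + i) /\
    nth false s.2 (xi - o + i) = nth false t.2 (xi - o + i).
  move=> ix; have /(congr1 (fun t : label _ => nth false t.1 i)) := e.
  have /(congr1 (fun t : label _ => nth false t.2 i)) := e.
  by rewrite /= !nth_slice.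
have H i : (i < 2 * xi)%N -> nth false s.1 i = nth false t.1 i /\ nth false s.2 i = nth false t.2 i.
  move=> ix; have [h|h] := boolP (o <= i < o + xi)%N.
    have -> : (i = o + (i - o))%N by lia.
    by have [-> ->] := s0 (i - o)%N ltac:(lia); have [-> ->] := t0 (i - o)%N ltac:(lia).
  move: o0; rewrite !inE => /orP[] /eqP o0.
    have -> : (i = xi - o + (i - xi))%N by lia.
    apply: st; lia.
  have -> : (i = xi - o + i)%N by lia.
  apply: st; lia.
case: s t {s0 t0 e st} H => [a b] [d f] /= H.
by congr pair; apply: bitsP => i ix; case: (H i ix).
Qed.

(** The natural bound [4 ^ - xi] is weakened to [eta ^ 2 = 4 ^ - (xi - kappa)], so that walls inside
    a cell and inside a block get the same weight. *)
Lemma card_act_half0 (o : nat) (s : label (2 * xi)) : o \in [:: 0; xi]%N -> s != lzero _ ->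
  #|[pred U : X | lslice xi o (act (val U) s) == lzero xi]|%:R <= eta ^+ 2 * #|{: X}|%:R.
Proof.
move=> o0 s0.
have z : lzero (2 * xi) \in [set t : label (2 * xi) | lslice xi o t == lzero xi]%SET.
  by rewrite inE lslice0.
have := card_act_le XE s0 z.
set a := #|[pred U : X | _]| => H.
have -> : #|[pred U : X | lslice xi o (act (val U) s) == lzero xi]| = a.
  by apply: eq_card => U; rewrite !inE.
have {}H : (a * 4 ^ xi <= #|{: X}|)%N.
  rewrite -(@leq_pmul2r (4 ^ xi)) ?expn_gt0 // -mulnA -expnD addnn -mul2n.
  by apply: (leq_trans H); rewrite mulnC leq_mul // card_half0_le.
rewrite /eta exprVn mulrC ler_pdivlMr ?exprn_gt0 // -exprM -natrX -natrM ler_nat.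
apply: leq_trans H; rewrite leq_mul2l -[4%N]/(2 ^ 2)%N -expnM leq_exp2l //.
by apply/orP; right; lia.
Qed.

(** A Clifford gate preserves triviality of a label, so outcomes violating this get the factor 0; an
    outcome with exactly one trivial half costs [eta ^ 2], and the others are bounded by 1. *)
Lemma card_act_half (s : label (2 * xi)) (ab : bool * bool) :
  #|[pred U : X | half_nz (act (val U) s) == ab]|%:R <=
  ((s != lzero _) == (ab.1 || ab.2))%:R * (if ab.1 (+) ab.2 then eta ^+ 2 else 1) * #|{: X}|%:R.
Proof.
set c := #|[pred U : X | _]|.
have XX : c%:R <= 1 * #|{: X}|%:R :> R by rewrite mul1r ler_nat max_card.
have c0 : ~~ (ab.1 || ab.2) = (s != lzero _) -> c%:R <= 0 :> R.
  move=> h; rewrite lern0 /c; apply/eqP/eq_card0 => U; rewrite !inE; apply/negbTE.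
  have Uc := mem_clifford XE U.
  have act0E : (act (val U) s != lzero _) = (s != lzero _).
    by have [->|/(act_neq0 Uc)->//] := eqVneq s (lzero _); rewrite act0 ?eqxx.
  by apply/eqP => hU; move: h; rewrite -act0E half_nzE hU; case: (_ || _).
case e : ((s != lzero _) == (ab.1 || ab.2)); last first.
  rewrite !mul0r; apply: c0; move: e.
  by case: (s != _); case: (ab.1 || ab.2).
rewrite mul1r; case: ifP => // ab12; move: e => /eqP; rewrite (_ : ab.1 || ab.2); last first.
  by move: ab12; case: ab.1; case: ab.2.
move=> s0; case: ab @c XX {c0} ab12 => -[] [] c _ // _; rewrite {}/c /=.
  apply: (le_trans _ (card_act_half0 (o := xi) _ s0)); last by rewrite !inE eqxx orbT.
  rewrite ler_nat; apply/subset_leq_card/fintype.subsetP => U; rewrite !inE.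
  by rewrite /half_nz => /eqP[_ /negbFE].
apply: (le_trans _ (card_act_half0 (o := 0) _ s0)); last by rewrite !inE eqxx.
rewrite ler_nat; apply/subset_leq_card/fintype.subsetP => U; rewrite !inE.
by rewrite /half_nz => /eqP[/negbFE].
Qed.

End HalfCounting.

Section Layers.
Variable R : realType.
Local Notation C := R[i].

(** The windows are disjoint, so each gate acts on its own slice of the label. The induction adds
    the rightmost gate of the product, which conjugates last. *)
Lemma layer_conj n w e M (g : 'I_M -> op R (bits w)) (s : label n) :
  (e + M * w <= n)%N -> (forall i, clifford R w (g i)) ->
  let U := \big[mulmx/1%:M]_(i < M) emb n (e + i * w) (g i) in
  exists s' : label n, [/\ exists c : C, U ^t* *m W R s *m U = c *: W R s',
    forall i : 'I_M, lslice w (e + i * w) s' = act (g i) (lslice w (e + i * w) s) &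
    forall w' o', (o' + w' <= n)%N -> (o' + w' <= e)%N || (e + M * w <= o')%N ->
      lslice w' o' s' = lslice w' o' s].
Proof.
elim: M g => [|M IH] g eMn gc /=.
  exists s; split=> //; last by case.
  by exists 1; rewrite big_ord0 hadj1 mul1mx mulmx1 scale1r.
have [|s' [[c cE] s'i s'o]] := IH (fun i => g (widen_ord (leqnSn M) i)) _ (fun i => gc _); first by lia.
rewrite big_ord_recr /=.
move: cE; set U := \big[_/_]_(i < M) _ => cE.
set o := (e + M * w)%N.
have own : (o + w <= n)%N by rewrite /o; lia.
have [d dE] := actP (lslice w o s') (gc ord_max).
have so : lslice w o s' = lslice w o s by apply: s'o => //; rewrite leqnn orbT.
exists (lpatch o s' (act (g ord_max) (lslice w o s'))); split.
- exists (c * d); rewrite hadj_mul emb_adj !mulmxA -(mulmxA (emb n o _)) -(mulmxA (emb n o _)) cE.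
  by rewrite -scalemxAr -scalemxAl (emb_W_emb own dE) scalerA.
- move=> i; have [lt|] := ltnP i M.
    have iw : (i * w + w <= M * w)%N by rewrite -mulSnr leq_mul2r lt orbT.
    rewrite lslice_patch_disj; [|by rewrite /o in own; lia|by apply/orP; right; rewrite /o; lia].
    have := s'i (Ordinal lt); rewrite /= => ->.
    by congr (act (g _) _); apply: val_inj.
  move=> Mi; have iM : i = ord_max by apply: val_inj => /=; have := ltn_ord i; lia.
  rewrite {}iM /= -/o.
  by rewrite (lslice_patch _ _ own) so.
- move=> w' o' own' dis; rewrite lslice_patch_disj //; last by rewrite /o; lia.
  by apply: s'o => //; lia.
Qed.

End Layers.

(** * Sharing gate weights between regions and walls *)

Section Weights.
Variable R : realType.

Lemma cell_lt N j : (j < N.-1)%N -> (2 * j + 1 < 2 * N)%N /\ (2 * j + 2 < 2 * N)%N.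
Proof. by lia. Qed.

Lemma inner_region N r : r <> 0%N -> r <> (2 * N - 1)%N -> (r < 2 * N)%N ->
  exists2 j, (j < N.-1)%N & if odd r then (2 * j + 1 = r /\ 2 * j + 2 = r.+1)%N
                            else (2 * j + 1 = r.-1 /\ 2 * j + 2 = r)%N.
Proof. by move=> r0 r1 rN; exists (r - 1)./2; [lia | case: ifP => ro; lia]. Qed.

(** Regions where the physical error may live when [T] records the nontrivial regions of its
    pull-back through the second layer: end regions are unchanged, and either member of an active
    inner cell may carry the error. *)
Definition region_active (N : nat) (T : nat -> bool) (r : nat) : bool :=
  if (r == 0) || (r == 2 * N - 1)%N then T r
  else if odd r then T r || T r.+1 else T r.-1 || T r.

(* Every active region carries a factor [g * eta]; what is left of the block and
   cell weights is one [eta] per domain wall of the pattern [T]. *)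
Lemma weights_le M (T : nat -> bool) (eta g : R) : 0 <= eta -> 0 <= g -> g * eta <= 1 ->
  (\prod_(i < M.+1) (if T (2 * i)%N || T (2 * i + 1)%N then eta ^+ 2 else 1)) *
  (\prod_(j < M) (if T (2 * j + 1)%N (+) T (2 * j + 2)%N then eta ^+ 2 else 1)) *
  (\prod_(r < (2 * M.+1)%N) (if region_active M.+1 T r then g else 1)) <=
  (\prod_(r < (2 * M.+1)%N) (if T r then g * eta else 1)) *
  \prod_(r < (2 * M + 1)%N) wall eta (T r) (T r.+1).
Proof.
move=> e0 g0 ge1.
pose cg (b : bool) : R := if b then g else 1; pose ce (b : bool) : R := if b then eta else 1.
have cg0 b : 0 <= cg b by case: b.
have ce0 b : 0 <= ce b by case: b.
have -> : \prod_(r < (2 * M.+1)%N) (if T r then g * eta else 1) =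
   (\prod_(r < (2 * M.+1)%N) cg (T r)) * \prod_(r < (2 * M.+1)%N) ce (T r).
  by rewrite -big_split; apply: eq_bigr => r _; rewrite /cg /ce /=; case: (T r); rewrite ?mulr1.
rewrite (prod_inner_pairs (fun r => cg (T r))) (prod_pairs (fun r => ce (T r))).
rewrite (prod_inner_pairs (fun r => if region_active M.+1 T r then g else 1)).
rewrite (prod_bonds (fun r => wall eta (T r) (T r.+1))).
have -> : region_active M.+1 T 0 = T 0%N by rewrite /region_active eqxx.
have -> : region_active M.+1 T (2 * M + 1) = T (2 * M + 1)%N.
  by rewrite /region_active ifT //; apply/orP; right; apply/eqP; lia.
rewrite -[if T 0%N then g else 1]/(cg (T 0%N)) -[if T (2 * M + 1)%N then _ else _]/(cg (T (2 * M + 1)%N)).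
set c0 := cg (T 0%N); set c1 := cg (T (2 * M + 1)%N).
(* An active block pays [eta ^ 2]: one [eta] per active region and, if only one region is active,
   the other for the wall inside the block. *)
have -> : \prod_(i < M.+1) (if T (2 * i)%N || T (2 * i + 1)%N then eta ^+ 2 else 1) =
   (\prod_(i < M.+1) (ce (T (2 * i)%N) * ce (T (2 * i + 1)%N))) *
   \prod_(i < M.+1) wall eta (T (2 * i)%N) (T (2 * i).+1).
  rewrite -big_split; apply: eq_bigr => i _; rewrite /= addn1 /ce /wall.
  by case: (T (2 * i)%N); case: (T (2 * i).+1); rewrite /= ?expr2 ?mulr1 ?mul1r.
set A := \prod_(i < M.+1) _; set B := \prod_(i < M.+1) _.
have A0 : 0 <= A by apply: prodr_ge0 => i _; rewrite mulr_ge0.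
have w0 a b : 0 <= wall eta a b by rewrite /wall; case: ifP.
have B0 : 0 <= B by apply: prodr_ge0.
(* Block and end factors match exactly; what remains is local to a cell. A mixed cell has
   [eta ^ 2 * g ^ 2] on the left and [g * eta] on the right, which is where [g * eta <= 1]
   enters. *)
suff H : (\prod_(j < M) (if T (2 * j + 1)%N (+) T (2 * j + 2)%N then eta ^+ 2 else 1)) *
   \prod_(j < M) ((if region_active M.+1 T (2 * j + 1) then g else 1) *
                  (if region_active M.+1 T (2 * j + 2) then g else 1)) <=
   (\prod_(j < M) (cg (T (2 * j + 1)%N) * cg (T (2 * j + 2)%N))) *
   \prod_(j < M) wall eta (T (2 * j + 1)%N) (T (2 * j + 1).+1).
  have := ler_wpM2l (mulr_ge0 (mulr_ge0 A0 B0) (mulr_ge0 (cg0 (T 0%N)) (cg0 (T (2 * M + 1)%N)))) H.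
  rewrite -/c0 -/c1; set x := \prod_(j < M) _; set y := \prod_(j < M) _; set z := \prod_(j < M) _.
  set v := \prod_(j < M) _.
  by rewrite [leLHS](_ : _ = A * B * x * (c0 * c1 * y)) 1?[leRHS](_ : _ = c0 * c1 * z * A * (B * v)) //; ring.
rewrite -!big_split; apply: ler_prod => j _ /=.
have -> : region_active M.+1 T (2 * j + 1) = T (2 * j + 1)%N || T (2 * j + 2)%N.
  rewrite /region_active ifF ?ifT; [by congr (_ || T _); lia | lia | have := ltn_ord j; lia].
have -> : region_active M.+1 T (2 * j + 2) = T (2 * j + 1)%N || T (2 * j + 2)%N.
  rewrite /region_active ifF ?ifF; [by congr (T _ || _); lia | lia | have := ltn_ord j; lia].
have -> : ((2 * j + 1).+1 = 2 * j + 2)%N by lia.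
have ge0 : 0 <= g * eta by rewrite mulr_ge0.
have gg : (g * eta) * (g * eta) <= g * eta by rewrite ler_piMl.
case: (T (2 * j + 1)%N); case: (T (2 * j + 2)%N); rewrite /cg /wall /= ?mulr1 ?mul1r ?lexx ?ler01 ?mulr_ge0 ?exprn_ge0 //=;
nra.
Qed.

Lemma prod_regions (F : nat -> R) m xi : (0 < xi)%N ->
  \prod_(i < (m * xi)%N) F (i %/ xi)%N = \prod_(r < m) F r ^+ xi.
Proof.
move=> xi0; rewrite -(big_mkord xpredT (fun i => F (i %/ xi)%N)).
elim: m => [|m IH]; first by rewrite mul0n big_geq // big_ord0.
rewrite (big_cat_nat _ (n := (m * xi)%N)) //=; last by rewrite leq_mul2r leqnSn orbT.
rewrite IH big_ord_recr /=; congr (_ * _).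
rewrite (eq_big_nat _ _ (F2 := fun=> F m)) => [|i /andP[h1 h2]].
  by rewrite prodr_const_nat mulSn addnK.
congr F; have -> : i = (m * xi + (i - m * xi))%N by lia.
rewrite divnMDl // divn_small ?addn0 //; rewrite mulSn in h2; lia.
Qed.

End Weights.

(** * Average over both layers *)

Section CoreBound.
Variables (R : realType) (N xi kappa n : nat).
Variable X : {fset op R (bits (2 * xi)%N)}.
Hypothesis XE : X =i clifford R (2 * xi)%N.
Hypotheses (N0 : (0 < N)%N) (xi0 : (0 < xi)%N) (nE : n = (2 * N * xi)%N).
Hypothesis kx : (kappa <= xi)%N.
Let eta : R := (2 ^+ (xi - kappa))^-1.
Let G1 := {ffun 'I_N -> X}.
Let G2 := {ffun 'I_N.-1 -> X}.
(** [s2 h s] stands for the label [s] pulled back through the second layer, and [u h1 h2 s] for the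
    event that the code leaves [s] undetected. *)
Variables (s2 : G2 -> label n -> label n) (u : G1 -> G2 -> label n -> bool).
Hypothesis s2_cell : forall h s (j : 'I_N.-1),
  lslice (2 * xi) ((2 * j + 1) * xi) (s2 h s) =
  act (val (h j)) (lslice (2 * xi) ((2 * j + 1) * xi) s).
Hypothesis s2_first : forall h s, lslice xi 0 (s2 h s) = lslice xi 0 s.
Hypothesis s2_last : forall h s,
  lslice xi ((2 * N - 1) * xi) (s2 h s) = lslice xi ((2 * N - 1) * xi) s.
Hypothesis u_block : forall h1 h2 s, u h1 h2 s -> forall i : 'I_N,
  act (val (h1 i)) (lslice (2 * xi) (2 * i * xi) (s2 h2 s)) \in undetectable xi kappa.

Definition region_nz (s : label n) (r : nat) : bool := lslice xi (r * xi) s != lzero xi.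

(* Regions on which the error, once spread by the second layer, is nontrivial. *)
Definition pattern (s : label n) : bits (2 * N) := [tuple region_nz s r | r < (2 * N)%N].

Definition block_weight (t : bits (2 * N)) : R := \prod_(i < N)
  (if nth false t (2 * i) || nth false t (2 * i + 1) then eta ^+ 2 else 1).

Definition cell_weight (t : bits (2 * N)) : R := \prod_(j < N.-1)
  (if nth false t (2 * j + 1) (+) nth false t (2 * j + 2) then eta ^+ 2 else 1).

(** Necessary condition for the error [s] to produce the pattern [t]: a gate preserves triviality of
    its cell, and the end regions are untouched. *)
Definition compatible (s : label n) (t : bits (2 * N)) : bool :=
  [&& region_nz s 0 == nth false t 0, region_nz s (2 * N - 1) == nth false t (2 * N - 1)
    & [forall j : 'I_N.-1, (region_nz s (2 * j + 1) || region_nz s (2 * j + 2)) ==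
        (nth false t (2 * j + 1) || nth false t (2 * j + 2))]].

Lemma region_nz2 (s : label n) r :
  (lslice (2 * xi) (r * xi) s != lzero _) = region_nz s r || region_nz s r.+1.
Proof. by rewrite lslice_double_eq0 negb_and /region_nz mulSnr. Qed.

Lemma sum_bool_card (T : finType) (P : pred T) : \sum_x (P x)%:R = #|P|%:R :> R.
Proof.
rewrite -sum1_card natr_sum [RHS]big_mkcond; apply: eq_bigr => x _.
by rewrite unfold_in; case: (P x).
Qed.

(** The first-layer gates are independent, so the sum over families is a product of sums over single
    gates; every block with nontrivial input must land on an undetectable label. *)
Lemma blocks_le (h2 : G2) s : \sum_(h1 : G1) (u h1 h2 s)%:R <=
  #|{: X}|%:R ^+ N * block_weight (pattern (s2 h2 s)).
Proof.
apply: (@le_trans _ _ (\sum_(h1 : G1) \prod_(i < N)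
   (act (val (h1 i)) (lslice (2 * xi) (2 * i * xi) (s2 h2 s)) \in undetectable xi kappa)%:R)).
  apply: ler_sum => h1 _; case uh: (u _ _ _); last by apply: prodr_ge0.
  by rewrite big1 // => i _; rewrite (u_block uh).
rewrite -(bigA_distr_bigA (fun (i : 'I_N) (U : X) =>
  (act (val U) (lslice (2 * xi) (2 * i * xi) (s2 h2 s)) \in undetectable xi kappa)%:R)).
rewrite -[N in _ ^+ N]card_ord -prodr_const -big_split /=; apply: ler_prod => i _.
have i2 : (2 * i < 2 * N)%N by have := ltn_ord i; lia.
have i3 : (2 * i + 1 < 2 * N)%N by have := ltn_ord i; lia.
rewrite sumr_ge0 //= sum_bool_card !nth_mktuple_bits /= addn1 -region_nz2.
case: ifPn => [s0|_]; last by rewrite mulr1 ler_nat max_card.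
by rewrite mulrC; exact: card_act_undetectable.
Qed.

Lemma cells_le s t : \sum_(h2 : G2) (pattern (s2 h2 s) == t)%:R <=
  (compatible s t)%:R * cell_weight t * #|{: X}|%:R ^+ N.-1.
Proof.
have first_lt : (0 < 2 * N)%N by rewrite muln_gt0 N0.
have last_lt : (2 * N - 1 < 2 * N)%N by rewrite subn1 ltn_predL.
pose ends := (region_nz s 0 == nth false t 0) &&
  (region_nz s (2 * N - 1) == nth false t (2 * N - 1)).
pose hp j := (nth false t (2 * j + 1), nth false t (2 * j + 2)).
apply: (@le_trans _ _ (\sum_(h2 : G2) (ends%:R * \prod_(j < N.-1)
   (half_nz (act (val (h2 j)) (lslice (2 * xi) ((2 * j + 1) * xi) s)) == hp j)%:R))).
  apply: ler_sum => h2 _; case: eqP => [pt|_]; last by rewrite mulr_ge0 // prodr_ge0.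
  have T r : (r < 2 * N)%N -> nth false t r = region_nz (s2 h2 s) r.
    by move=> rN; rewrite -pt nth_mktuple_bits.
  rewrite /ends (T 0%N first_lt) (T _ last_lt).
  rewrite /region_nz mul0n s2_first s2_last !eqxx mul1r big1 // => j _.
  have jN := ltn_ord j.
  have [c1 c2] := cell_lt jN.
  rewrite /hp (T _ c1) (T _ c2) -s2_cell /half_nz /region_nz.
  have xx : (xi + xi <= 2 * xi)%N by rewrite addnn mul2n.
  rewrite (lslice_slice _ _ xx) (lslice_slice _ _ (_ : 0 + xi <= 2 * xi)%N); last first.
    by rewrite add0n leq_pmull.
  by rewrite addn0 -mulSnr -[(2 * j + 1).+1]addn1 -addnA eqxx.
rewrite -mulr_sumr -(bigA_distr_bigA (fun (j : 'I_N.-1) (U : X) =>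
   (half_nz (act (val U) (lslice (2 * xi) ((2 * j + 1) * xi) s)) == hp j)%:R)).
rewrite /compatible andbA -/ends -[Y in _ ^+ Y]card_ord -prodr_const -mulrA -big_split /=.
case: ends; last by rewrite !mul0r.
rewrite mul1r /= -[X in _ <= X]mulr1.
set cf := [forall j, _].
have -> : cf%:R = \prod_(j < N.-1) ((region_nz s (2 * j + 1) || region_nz s (2 * j + 2)) ==
        (nth false t (2 * j + 1) || nth false t (2 * j + 2)))%:R :> R.
  rewrite /cf; case: forallP => [H|/forallP/forallPn[j /negPf H]].
    by rewrite big1 // => j _; rewrite H.
  by rewrite (bigD1 j) //= H mul0r.
rewrite mulr1 -big_split /=; apply: ler_prod => j _; rewrite sumr_ge0 //= sum_bool_card.
apply: le_trans (card_act_half XE kx _ _) _.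
rewrite region_nz2 -mulrA (_ : (2 * j + 1).+1 = 2 * j + 2)%N ?lexx //; lia.
Qed.

(** The first layer is summed for a fixed second one; its bound depends on the intermediate label
    only through the pattern, by which the second sum is grouped. *)
Lemma undetected_prob_le s : \sum_(h1 : G1) \sum_(h2 : G2) (u h1 h2 s)%:R <=
  #|{: X}|%:R ^+ N * #|{: X}|%:R ^+ N.-1 *
  \sum_(t | compatible s t) block_weight t * cell_weight t.
Proof.
have bw0 t : 0 <= block_weight t.
  by apply: prodr_ge0 => i _; case: ifP; rewrite ?exprn_ge0 ?invr_ge0 ?exprn_ge0.
rewrite exchange_big /=.
apply: (le_trans (ler_sum _ (fun h2 _ => blocks_le h2 s))).
rewrite -mulr_sumr -mulrA ler_wpM2l ?exprn_ge0 //.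
rewrite (eq_bigr (fun h2 => \sum_t (pattern (s2 h2 s) == t)%:R * block_weight t)); last first.
  move=> h2 _; rewrite (bigD1 (pattern (s2 h2 s))) //= eqxx mul1r big1 ?addr0 //.
  by move=> t; rewrite eq_sym => /negPf ->; rewrite mul0r.
rewrite exchange_big /= mulr_sumr [leRHS]big_mkcond; apply: ler_sum => t _.
rewrite -mulr_suml; apply: (le_trans (ler_wpM2r (bw0 t) (cells_le s t))).
by case: ifP; rewrite ?mul0r // mul1r le_eqVlt; move=> _; apply/orP; left; apply/eqP; ring.
Qed.

Lemma compatible_supp (b : bits n.-1) t : compatible (bzero n, zlab b) t ->
  [forall i : 'I_n, tnth (zlab b) i ==> region_active N (nth false t) (i %/ xi)].
Proof.
move=> /and3P[/eqP c0 /eqP c1 /forallP cj]; apply/forallP => i; apply/implyP => zi.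
have rN : (i %/ xi < 2 * N)%N by rewrite ltn_divLR // -nE.
have nz : region_nz (bzero n, zlab b) (i %/ xi).
  apply/negP => /lslice_eq0P/(_ (i %% xi)%N (ltn_pmod _ xi0))[_].
  by rewrite /= -divn_eq; move: zi; rewrite (tnth_nth false) => ->.
rewrite /region_active; set r := (i %/ xi)%N in rN nz *.
case: eqP => [r0|r0] /=; first by move: nz; rewrite r0 c0.
case: eqP => [r1|r1]; first by move: nz; rewrite r1 c1.
have [j jN rj] := inner_region r0 r1 rN.
have /eqP := cj (Ordinal jN); rewrite /=; move: rj; case: ifP => _ [-> ->].
  by rewrite nz => <-.
by rewrite nz orbT => <-.
Qed.

Lemma compatible_neq0 (b : bits n.-1) t : b != bzero _ ->
  compatible (bzero n, zlab b) t -> t != bzero _.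
Proof.
move=> b0 /compatible_supp/forallP H; apply: contra_neq b0 => t0.
apply: zlab_eq0; apply: bitsP => i ni; rewrite nth_bzero.
have := H (Ordinal ni); rewrite (tnth_nth false) /= t0 /region_active !nth_bzero.
by case: (nth _ _ _) => //; rewrite !if_same.
Qed.

Variables (p : R).
Hypothesis p01 : 0 <= p <= 1.
Let g : R := (1 + 2 * Num.sqrt (p * (1 - p))) ^+ xi.
Hypotheses (ge1 : g * eta <= 1) (Ne1 : (2 * N)%:R * eta <= 1).

Lemma sum_undetected_le : \sum_(h1 : G1) \sum_(h2 : G2)
    \sum_(b : bits n.-1 | b != bzero _) bhatt p b * (u h1 h2 (bzero n, zlab b))%:R <=
  #|{: X}|%:R ^+ N * #|{: X}|%:R ^+ N.-1 * ((g * eta) ^+ (2 * N) + 8 * N%:R * eta).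
Proof.
have e0 : 0 <= eta by rewrite invr_ge0 exprn_ge0.
have b0 : 0 <= 2 * Num.sqrt (p * (1 - p)) by rewrite mulr_ge0 // sqrtr_ge0.
have g0 : 0 <= g by rewrite exprn_ge0 // addr_ge0.
have X0 : 0 <= #|{: X}|%:R ^+ N * #|{: X}|%:R ^+ N.-1 :> R by rewrite mulr_ge0 // exprn_ge0.
pose bc t := block_weight t * cell_weight t.
have bc0 t : 0 <= bc t.
  by apply: mulr_ge0; apply: prodr_ge0 => i _; case: ifP => // _; rewrite !exprn_ge0.
apply: (@le_trans _ _ (\sum_(b : bits n.-1 | b != bzero _) bhatt p b *
    (#|{: X}|%:R ^+ N * #|{: X}|%:R ^+ N.-1 * \sum_(t | compatible (bzero n, zlab b) t) bc t))).
  under eq_bigr do rewrite exchange_big /=.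
  rewrite exchange_big /=; apply: ler_sum => b _.
  under eq_bigr do rewrite -mulr_sumr.
  by rewrite -mulr_sumr ler_wpM2l ?bhatt_ge0 //; exact: undetected_prob_le.
under eq_bigr do rewrite mulrCA.
rewrite -mulr_sumr ler_wpM2l //.
under eq_bigr do rewrite mulr_sumr.
(* With the pattern [t] outside, the inner sum is over Z-strings supported on the regions that [t]
   makes active, and [sum_bhatt_supp_le] gives a factor [g] for each. *)
rewrite (exchange_big_dep (fun t => t != bzero _)) /=; last by move=> b t; exact: compatible_neq0.
have NE : N = N.-1.+1 by rewrite prednK.
have := @sum_patterns_le R eta g N.-1 e0 g0 ge1; rewrite -NE => /(_ Ne1).
apply: le_trans; apply: ler_sum => t t0; rewrite -mulr_suml.
have := @weights_le R N.-1 (nth false t) eta g e0 g0 ge1; rewrite -NE.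
apply: le_trans; rewrite mulrC -/(block_weight t) -/(cell_weight t) -/(bc t) ler_wpM2l //.
have := @sum_bhatt_supp_le R p n (fun i => region_active N (nth false t) (i %/ xi)) p01.
have -> : \prod_(i < n) (if region_active N (nth false t) (i %/ xi) then
   1 + 2 * Num.sqrt (p * (1 - p)) else 1) =
   \prod_(r < (2 * N)%N) (if region_active N (nth false t) r then g else 1).
  rewrite nE (prod_regions (fun r => if region_active N (nth false t) r then
     1 + 2 * Num.sqrt (p * (1 - p)) else 1) _ xi0).
  by apply: eq_bigr => r _; rewrite /g; case: ifP => _; rewrite ?expr1n.
apply: le_trans; rewrite [leLHS]big_mkcond [leRHS]big_mkcond; apply: ler_sum => b _.
case: ifP => [/andP[_ cb]|_]; last by case: ifP => _ //; rewrite bhatt_ge0.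
by rewrite (compatible_supp cb).
Qed.

End CoreBound.

Section Ensemble.
Variables (R : realType) (c : dl_params R).
Local Notation C := R[i].
Local Notation n := (dl_n c).
Local Notation k := (dl_k c).
Local Notation N := (dl_N c).
Local Notation xi := (dl_xi c).
Local Notation kappa := (dl_kappa c).

Lemma dl_n_gt0 : (0 < n)%N.
Proof. by rewrite dl_nE !muln_gt0 dl_N_gt0 dl_xi_gt0. Qed.

Lemma dl_kE : k = (2 * N * kappa)%N.
Proof.
have n0 : (n%:R : R) != 0 by rewrite pnatr_eq0 -lt0n dl_n_gt0.
have := dl_kappaE c => /(congr1 (fun x : R => x * n%:R)).
rewrite mulrAC divfK // -!natrM => /eqP; rewrite eqr_nat {1}dl_nE => /eqP e.
apply/eqP; rewrite -(eqn_pmul2r (dl_xi_gt0 c)) -e; apply/eqP; ring.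
Qed.

Definition dl_embed : 'M[C]_(#|{: bits n}|, #|{: bits k}|) :=
  mkmx (fun x l => ((@logical_part _ c x == l) && @ancillas0 _ c x)%:R).

Lemma with_ancillasE rho : @with_ancillas _ c rho = dl_embed *m rho *m dl_embed ^t*.
Proof.
apply: mentP => x y; rewrite [LHS]ment_mkmx.
rewrite [RHS]ment_mul (bigD1 (@logical_part _ c y)) //= big1 => [|l /negPf ly]; last first.
  by rewrite ment_adj ment_mkmx eq_sym ly conjC0 mulr0.
rewrite addr0 ment_adj ment_mkmx eqxx /= conjC_nat.
rewrite ment_mul (bigD1 (@logical_part _ c x)) //= big1 => [|l /negPf lx]; last first.
  by rewrite ment_mkmx eq_sym lx mul0r.
rewrite addr0 ment_mkmx eqxx /= mulrAC -natrM mulnb mulrC //.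
Qed.

Hypothesis kx : (kappa <= xi)%N.

Definition ext_logical (l : bits k) : bits n :=
  [tuple (i %% xi < kappa)%N && nth false l (i %/ xi * kappa + i %% xi) | i < n].

Lemma logical_ancillasP (x : bits n) (l : bits k) :
  ((@logical_part _ c x == l) && @ancillas0 _ c x) = (x == ext_logical l).
Proof.
have xi0 := dl_xi_gt0 c.
apply/andP/eqP => [[/eqP <- /forallP a0]|->].
  apply: bitsP => i ni; rewrite nth_mktuple_bits /=.
  have [ik|ki] := ltnP (i %% xi) kappa; last first.
    by have := a0 (Ordinal ni); rewrite /= ki (tnth_nth false) => /negPf.
  have iN : (i %/ xi < 2 * N)%N by rewrite ltn_divLR // -dl_nE.
  have lk : (i %/ xi * kappa + i %% xi < k)%N.
    rewrite dl_kE; apply: (@leq_trans ((i %/ xi).+1 * kappa)%N).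
      by rewrite mulSn addnC ltn_add2r.
    by rewrite leq_mul2r iN orbT.
  rewrite nth_mktuple_bits /= divnMDl; last by lia.
  by rewrite (divn_small ik) addn0 modnMDl (modn_small ik) -divn_eq.
split; last first.
  apply/forallP => i; apply/implyP => ki; rewrite tnth_mktuple.
  by rewrite ltnNge ki.
apply/eqP/bitsP => l0 l0k; rewrite nth_mktuple_bits /=.
have k0 : (0 < kappa)%N.
  by move: l0k; rewrite dl_kE; case: (kappa) => //; rewrite muln0.
have lm : (l0 %% kappa < kappa)%N by rewrite ltn_mod.
have lx : (l0 %% kappa < xi)%N by apply: leq_trans kx.
have l0N : (l0 %/ kappa < 2 * N)%N by rewrite ltn_divLR // -dl_kE.
have ni : (l0 %/ kappa * xi + l0 %% kappa < n)%N.
  rewrite dl_nE; apply: (@leq_trans ((l0 %/ kappa).+1 * xi)%N).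
    by rewrite mulSn addnC ltn_add2r.
  by rewrite leq_mul2r l0N orbT.
rewrite nth_mktuple_bits /= modnMDl (modn_small lx) lm /= divnMDl ?dl_xi_gt0 // (divn_small lx) addn0.
by rewrite -divn_eq.
Qed.

Lemma dl_embed_isometry : dl_embed ^t* *m dl_embed = 1%:M.
Proof.
apply: mentP => l l'; rewrite ment_mul ment1.
under eq_bigr do rewrite ment_adj !ment_mkmx !logical_ancillasP conjC_nat.
rewrite (bigD1 (ext_logical l)) //= big1 => [|x /negPf ->]; last by rewrite mul0r.
rewrite eqxx mul1r addr0; congr (_%:R); congr nat_of_bool.
apply/eqP/eqP => [e|-> //].
have := logical_ancillasP (ext_logical l) l; rewrite eqxx => /andP[/eqP <- _].
by have := logical_ancillasP (ext_logical l) l'; rewrite -[ext_logical l']e eqxx => /andP[/eqP].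
Qed.

(** An X part on an ancilla maps the space of zeroed ancillas to an orthogonal one. *)
Lemma embed_W_neq0 (s : label n) : dl_embed ^t* *m W R s *m dl_embed != 0 ->
  forall i, (i < n)%N -> (kappa <= i %% xi)%N -> nth false s.1 i = false.
Proof.
move=> nz i ni ki; apply/negbTE; apply: contraNN nz => si; apply/eqP.
apply: mentP => l l'; rewrite ment0 ment_mul big1 // => y _.
rewrite ment_mul mulr_suml big1 // => x _.
rewrite ment_adj !ment_mkmx.
case: (boolP (_ && ancillas0 x)) => [/andP[_ /forallP ax]|_]; last by rewrite conjC0 !mul0r.
case: (boolP (_ && ancillas0 y)) => [/andP[_ /forallP ay]|_]; last by rewrite mulr0.
have := ax (Ordinal ni); have := ay (Ordinal ni).
rewrite /= ki /= => /negPf yi /negPf xi_.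
by rewrite (bigD1 (Ordinal ni)) //= /went yi xi_ (tnth_nth false) si /= !mul0r !(mulr0, mul0r).
Qed.

Local Notation X := (fset_set (clifford R (2 * xi)%N)).
Hypothesis fin : finite_set (clifford R (2 * xi)%N).

Definition dl_gates_of (h1 : {ffun 'I_N -> X}) (h2 : {ffun 'I_N.-1 -> X}) : dl_gates c :=
  ([ffun i => val (h1 i)], [ffun i => val (h2 i)]).

Lemma XE : X =i clifford R (2 * xi)%N.
Proof. exact: in_fset_set. Qed.

Lemma dl_supportE : dl_support c =
  [set` [seq dl_gates_of h.1 h.2 | h <- enum {: {ffun 'I_N -> X} * {ffun 'I_N.-1 -> X}}]].
Proof.
apply/seteqP; split=> [g [g1 g2]|_ /= /mapP[h _ ->]]; last first.
  by split=> i; rewrite ffunE; apply: mem_clifford; exact: XE.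
have m1 i : g.1 i \in X by rewrite XE; apply/mem_set.
have m2 i : g.2 i \in X by rewrite XE; apply/mem_set.
apply/mapP; exists ([ffun i => [` m1 i]%fset], [ffun i => [` m2 i]%fset]).
  by rewrite mem_enum.
by case: g {g1 g2} m1 m2 => a b m1 m2; congr pair; apply/ffunP => i; rewrite !ffunE.
Qed.

Lemma uniform_mean_support (f : dl_gates c -> R) : uniform_mean (dl_support c) f =
  (\sum_(h1 : {ffun 'I_N -> X}) \sum_(h2 : {ffun 'I_N.-1 -> X}) f (dl_gates_of h1 h2)) /
  (#|{: X}|%:R ^+ N * #|{: X}|%:R ^+ N.-1).
Proof.
set s := [seq dl_gates_of h.1 h.2 | h <- enum {: {ffun 'I_N -> X} * {ffun 'I_N.-1 -> X}}].
have us : uniq s.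
  rewrite map_inj_uniq ?enum_uniq // => -[a b] [a' b'] [/ffunP ea /ffunP eb].
  by congr pair; apply/ffunP => i; apply: val_inj; [have := ea i|have := eb i]; rewrite !ffunE.
have pe : perm_eq (fset_set (dl_support c)) s.
  apply: uniq_perm => //= g; rewrite in_fset_set dl_supportE //.
  by apply/idP/idP => [/set_mem|/mem_set].
rewrite /uniform_mean (perm_big _ pe) /= big_map big_enum /= pair_bigA /=.
congr (_ / _).
by rewrite (perm_size pe) size_map -cardE card_prod !card_ffun !card_ord natrM !natrX.
Qed.

End Ensemble.

(* [fset_set] of an infinite set is empty. *)
Lemma uniform_mean_infinite (R : realType) (T : choiceType) (A : set T) (f : T -> R) :
  ~ finite_set A -> uniform_mean A f = 0.
Proof.
move=> nfin; rewrite /uniform_mean /fset_set; case: pselect => // h.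
by rewrite big_seq_fset0 mul0r.
Qed.

Lemma mulr2_le_sqr (R : realDomainType) (x y : R) : 2 * x * y <= y * y + x * x.
Proof. by have := sqr_ge0 (y - x); rewrite expr2; nra. Qed.

Lemma cell_offset i x : ((2 * i + 1) * x = x + i * (2 * x))%N.
Proof. by lia. Qed.

Lemma block_offset i x : (2 * i * x = 0 + i * (2 * x))%N.
Proof. by lia. Qed.

Lemma last_region_window N x : (0 < N)%N -> ((2 * N - 1) * x + x = 2 * N * x)%N.
Proof. by move=> N0; rewrite -mulSnr subn1 prednK // muln_gt0. Qed.

Lemma cells_window N x : (0 < N)%N -> (x + N.-1 * (2 * x) = (2 * N - 1) * x)%N.
Proof. by case: N => // N _; rewrite mulnBl mulnS; lia. Qed.

(** * Expected Choi error of the ensemble *)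

Section ExpectedError.
Variables (R : realType) (c : dl_params R).
Local Notation C := R[i].
Local Notation n := (dl_n c).
Local Notation k := (dl_k c).
Local Notation N := (dl_N c).
Local Notation xi := (dl_xi c).
Local Notation kappa := (dl_kappa c).
Let V (g : dl_gates c) := dl_unitary c g *m dl_embed c.

Lemma dl_layer2E (g : dl_gates c) :
  \big[mulmx/1%:M]_(i < N.-1) emb n ((2 * i + 1) * xi)%N (g.2 i) =
  \big[mulmx/1%:M]_(i < N.-1) emb n (xi + i * (2 * xi))%N (g.2 i).
Proof. by apply: eq_bigr => i _; congr (emb _ _ _); lia. Qed.

Lemma dl_layer1E (g : dl_gates c) :
  \big[mulmx/1%:M]_(i < N) emb n (2 * i * xi)%N (g.1 i) =
  \big[mulmx/1%:M]_(i < N) emb n (0 + i * (2 * xi))%N (g.1 i).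
Proof. by apply: eq_bigr => i _; congr (emb _ _ _); lia. Qed.

Lemma prod_unitary m M (F : 'I_M -> 'M[C]_m) : (forall i, F i \is unitarymx) ->
  \big[mulmx/1%:M]_(i < M) F i \is unitarymx.
Proof.
move=> FU; elim/big_ind : _ => [|A B AU BU|i _].
- exact: unitarymx1.
- exact: (mul_unitarymx AU BU).
- exact: FU.
Qed.

Lemma window2_le (i : 'I_N.-1) : (xi + i * (2 * xi) + 2 * xi <= n)%N.
Proof.
have iN := ltn_ord i; have N0 := dl_N_gt0 c.
apply: (@leq_trans ((2 * i.+1 + 1) * xi)%N); first by lia.
by rewrite dl_nE leq_mul2r; apply/orP; right; lia.
Qed.

Lemma window1_le (i : 'I_N) : (0 + i * (2 * xi) + 2 * xi <= n)%N.
Proof.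
have iN := ltn_ord i.
apply: (@leq_trans (2 * i.+1 * xi)%N); first by lia.
by rewrite dl_nE leq_mul2r; apply/orP; right; lia.
Qed.

Lemma dl_unitary_unitary g : dl_support c g -> dl_unitary c g \is unitarymx.
Proof.
move=> [g1 g2]; rewrite /dl_unitary dl_layer1E dl_layer2E.
apply: mul_unitarymx; apply: prod_unitary => i; apply: emb_unitary.
- exact: window2_le.
- by have [] := (cliffordP _).1 (g2 i).
- exact: window1_le.
- by have [] := (cliffordP _).1 (g1 i).
Qed.

Hypothesis kx : (kappa <= xi)%N.

Lemma dl_isometry g : dl_support c g -> (V g) ^t* *m V g = 1%:M.
Proof.
move=> gs; rewrite /V hadj_mul mulmxA -(mulmxA _ _ (dl_unitary c g)).
by rewrite (unitarymx_mulVmx (dl_unitary_unitary gs)) mulmx1 dl_embed_isometry.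
Qed.

Lemma dl_encodingE g rho : encoding (dl_unitary c g) rho = V g *m rho *m (V g) ^t*.
Proof. by rewrite /encoding with_ancillasE /V [in RHS]hadj_mul !mulmxA. Qed.

Lemma dl_choi_error_le p g : 0 <= p <= 1 -> dl_support c g ->
  exists2 f : R, choi_error (zz_noise p n) (encoding (dl_unitary c g)) <= Num.sqrt f &
  f <= 1 /\ f <= \sum_(b : bits n.-1 | b != bzero _)
    bhatt p b * (~~ detected (V g) (bzero n, zlab b))%:R.
Proof.
move=> p01 gs; apply: zz_choi_error_le => //.
- by rewrite card_bits expn_gt0.
- exact: dl_isometry.
- exact: dl_encodingE.
Qed.

Section Finite.
Hypothesis fin : finite_set (clifford R (2 * xi)%N).
Local Notation X := (fset_set (clifford R (2 * xi)%N)).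

Lemma dl_gates_of_support h1 h2 : dl_support c (@dl_gates_of _ c h1 h2).
Proof. by split=> i; rewrite ffunE; apply: mem_clifford; exact: (XE fin). Qed.

Lemma dl_sum_undetected_le p (eta := (2 ^+ (xi - kappa))^-1 : R)
    (g := (1 + 2 * Num.sqrt (p * (1 - p))) ^+ xi) :
  0 <= p <= 1 -> g * eta <= 1 -> (2 * N)%:R * eta <= 1 ->
  \sum_(h1 : {ffun 'I_N -> X}) \sum_(h2 : {ffun 'I_N.-1 -> X})
    \sum_(b : bits n.-1 | b != bzero _)
      bhatt p b * (~~ detected (V (@dl_gates_of _ c h1 h2)) (bzero n, zlab b))%:R <=
  #|{: X}|%:R ^+ N * #|{: X}|%:R ^+ N.-1 * ((g * eta) ^+ (2 * N) + 8 * N%:R * eta).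
Proof.
move=> p01 ge1 Ne1.
have N0 := dl_N_gt0 c.
have Xc (U : X) : clifford R (2 * xi) (val U) by apply: mem_clifford; exact: (XE fin).
have wn2 : (xi + N.-1 * (2 * xi) <= n)%N.
  rewrite dl_nE; apply: (@leq_trans ((2 * N.-1 + 1) * xi)%N); first by lia.
  by rewrite leq_mul2r; apply/orP; right; lia.
have wn1 : (0 + N * (2 * xi) <= n)%N by rewrite dl_nE; lia.
have ex2 (hs : {ffun 'I_N.-1 -> X} * label n) : exists s' : label n,
    [/\ exists c' : C, (\big[mulmx/1%:M]_(i < N.-1) emb n (xi + i * (2 * xi)) (val (hs.1 i))) ^t* *m
         W R hs.2 *m (\big[mulmx/1%:M]_(i < N.-1) emb n (xi + i * (2 * xi)) (val (hs.1 i)))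
         = c' *: W R s',
      forall i : 'I_N.-1, lslice (2 * xi) (xi + i * (2 * xi)) s' =
         act (val (hs.1 i)) (lslice (2 * xi) (xi + i * (2 * xi)) hs.2) &
      forall w' o', (o' + w' <= n)%N -> (o' + w' <= xi)%N || (xi + N.-1 * (2 * xi) <= o')%N ->
         lslice w' o' s' = lslice w' o' hs.2].
  by apply: (layer_conj (g := fun i => val (hs.1 i))) => // i; exact: Xc.
have [s2 s2P] := choice ex2.
apply: (@sum_undetected_le R N xi kappa n X (XE fin) N0 (dl_xi_gt0 c) (dl_nE c) kx
   (fun h s => s2 (h, s))
   (fun h1 h2 s => ~~ detected (V (@dl_gates_of _ c h1 h2)) s)) => //.
- move=> h s j; have [_ H _] := s2P (h, s).
  rewrite cell_offset.
  exact: H.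
- move=> h s; have [_ _ H] := s2P (h, s); rewrite H //=.
    by rewrite add0n dl_nE leq_pmull // muln_gt0 N0.
  by rewrite add0n leqnn.
- move=> h s; have [_ _ H] := s2P (h, s); rewrite H //=.
    by rewrite last_region_window // dl_nE.
  by rewrite cells_window // leqnn orbT.
- move=> h1 h2 s nd i.
  have [[c2 c2E] _ _] := s2P (h2, s).
  have [s' [[c1 c1E] s'i _]] := layer_conj (g := fun i => val (h1 i)) (s2 (h2, s)) wn1 (fun i => Xc (h1 i)).
  rewrite block_offset.
  rewrite -s'i inE; apply/forallP => j; apply/implyP => kj.
  rewrite (tnth_nth false) nth_slice //; apply/negbT.
  apply: (embed_W_neq0 (s := s')).
  (* If the bare embedding detects the error pulled back through both layers, the encoder detects
     the original error. *)
  + apply: contraNneq nd => z; rewrite /detected /V.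
    set P2 := \big[_/_]_(i < N.-1) _ in c2E; set P1 := \big[_/_]_(i < N) _ in c1E.
    have -> : dl_unitary c (dl_gates_of h1 h2) = P2 *m P1.
      rewrite /dl_unitary dl_layer1E dl_layer2E.
      by congr (_ *m _); apply: eq_bigr => j' _; rewrite ffunE.
    have -> : (P2 *m P1 *m dl_embed c) ^t* *m W R s *m (P2 *m P1 *m dl_embed c) =
        (dl_embed c) ^t* *m (P1 ^t* *m (P2 ^t* *m W R s *m P2) *m P1) *m dl_embed c.
      by rewrite !hadj_mul !mulmxA.
    rewrite c2E -scalemxAr -scalemxAl c1E -!(scalemxAr, scalemxAl).
    by apply/eqP; rewrite z !scaler0.
  + by apply: leq_trans (window1_le i); rewrite ltn_add2l.
  + by rewrite add0n mulnA modnMDl.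
Qed.

End Finite.

(** Every Clifford occurs as the first gate of a family in the support, because [N > 0]. The final
    bounds can thus split on finiteness of the support. *)
Lemma clifford_finite : finite_set (dl_support c) -> finite_set (clifford R (2 * xi)%N).
Proof.
move=> fin; apply: (@sub_finite_set _ _ [set g.1 (Ordinal (dl_N_gt0 c)) | g in dl_support c]).
  by move=> U Uc; exists ([ffun=> U], [ffun=> U]) => //=; [split=> i|]; rewrite ffunE.
exact: finite_image.
Qed.

Lemma expected_choi_error_le1 p : 0 <= p <= 1 ->
  expected_choi_error c (zz_noise p n) <= 1.
Proof.
move=> p01; rewrite /expected_choi_error.
have [fin|nfin] := pselect (finite_set (dl_support c)); last first.
  by rewrite uniform_mean_infinite.
have cfin := clifford_finite fin; rewrite (uniform_mean_support cfin).
set m := _ * _ ^+ N.-1; have m0 : 0 <= m by rewrite mulr_ge0 // exprn_ge0.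
have [->|mn0] := eqVneq m 0; first by rewrite invr0 mulr0.
rewrite ler_pdivrMr ?lt_neqAle ?m0 1?eq_sym ?mn0 // mul1r.
have -> : m = \sum_(h1 : {ffun 'I_N -> fset_set (clifford R (2 * xi)%N)})
   \sum_(h2 : {ffun 'I_N.-1 -> fset_set (clifford R (2 * xi)%N)}) 1.
  by rewrite !sumr_const !card_ffun !card_ord -mulrnA mulnC natrM !natrX.
apply: ler_sum => h1 _; apply: ler_sum => h2 _.
have [f fE [f1 _]] := dl_choi_error_le p01 (dl_gates_of_support cfin h1 h2).
by apply: (le_trans fE); rewrite -sqrtr1 ler_wsqrtr.
Qed.

Lemma expected_choi_error_le p (eta := (2 ^+ (xi - kappa))^-1 : R)
    (g := (1 + 2 * Num.sqrt (p * (1 - p))) ^+ xi) :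
  0 <= p <= 1 -> g * eta <= 1 -> (2 * N)%:R * eta <= 1 ->
  expected_choi_error c (zz_noise p n) <=
    Num.sqrt ((g * eta) ^+ (2 * N) + 8 * N%:R * eta).
Proof.
move=> p01 ge1 Ne1; rewrite /expected_choi_error.
have [fin|nfin] := pselect (finite_set (dl_support c)); last first.
  by rewrite uniform_mean_infinite // sqrtr_ge0.
have cfin := clifford_finite fin; rewrite (uniform_mean_support cfin).
have := dl_sum_undetected_le cfin p01 ge1 Ne1.
set m := _ * _ ^+ N.-1; set delta := (_ + _ : R) => H.
have eta0 : 0 < eta by rewrite invr_gt0 exprn_gt0.
have d0 : 0 < delta.
  rewrite ltr_wpDl // ?exprn_ge0 ?mulr_gt0 ?ltr0n ?dl_N_gt0 //.
have m0 : 0 <= m by rewrite mulr_ge0 // exprn_ge0.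
have [->|mn0] := eqVneq m 0; first by rewrite invr0 mulr0 sqrtr_ge0.
rewrite ler_pdivrMr ?lt_neqAle ?m0 1?eq_sym ?mn0 //.
set r := Num.sqrt delta; have r0 : 0 < r by rewrite sqrtr_gt0.
have rr : r * r = delta by rewrite -expr2 sqr_sqrtr // ltW.
(* AM-GM: [sqrt f <= (f / r + r) / 2] with [r] the target bound. *)
pose F h1 h2 := \sum_(b : bits n.-1 | b != bzero _)
      bhatt p b * (~~ detected (V (@dl_gates_of _ c h1 h2)) (bzero n, zlab b))%:R.
have amgm h1 h2 : choi_error (zz_noise p n) (encoding (dl_unitary c (dl_gates_of h1 h2))) <=
    2^-1 * r^-1 * F h1 h2 + 2^-1 * r.
  have [f fE [_ fF]] := dl_choi_error_le p01 (dl_gates_of_support cfin h1 h2).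
  apply: (le_trans fE); apply: (@le_trans _ _ (Num.sqrt (F h1 h2))); first exact: ler_wsqrtr.
  have F0 : 0 <= F h1 h2 by apply: sumr_ge0 => b _; rewrite mulr_ge0 // bhatt_ge0.
  set y := Num.sqrt _; have yy : F h1 h2 = y * y by rewrite -expr2 sqr_sqrtr.
  rewrite yy -(ler_pM2l (mulr_gt0 (ltr0n R 2) r0)) mulrDr.
  have -> : 2 * r * (2^-1 * r^-1 * (y * y)) = y * y by field; rewrite gt_eqF.
  have -> : 2 * r * (2^-1 * r) = r * r by field.
  exact: mulr2_le_sqr.
apply: (le_trans (ler_sum _ (fun h1 _ => ler_sum _ (fun h2 _ => amgm h1 h2)))).
under eq_bigr do rewrite big_split /= -mulr_sumr.
rewrite big_split /= -mulr_sumr.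
have -> : \sum_(h1 : {ffun 'I_N -> fset_set (clifford R (2 * xi)%N)})
   \sum_(h2 : {ffun 'I_N.-1 -> fset_set (clifford R (2 * xi)%N)}) 2^-1 * r = 2^-1 * r * m.
  rewrite !sumr_const !card_ffun !card_ord -mulrnA.
  by rewrite -[LHS]mulr_natr natrM !natrX [X in _ * X = _]mulrC.
have h0 : 0 <= 2^-1 * r^-1 by rewrite mulr_ge0 // invr_ge0 ltW.
rewrite -/(F _ _) in H *.
have := ler_wpM2l h0 H; rewrite -rr.
have -> : 2^-1 * r^-1 * (m * (r * r)) = 2^-1 * r * m by field; rewrite gt_eqF.
move=> {}H; apply: (le_trans (lerD H (lexx _))).
by rewrite le_eqVlt; apply/orP; left; apply/eqP; field.
Qed.

End ExpectedError.

(** * Circuit depth *)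

Section Scheduling.
Variable R : realType.
Local Notation C := R[i].

Lemma big_mulmx_comm m (I : Type) (s : seq I) (P : pred I) (F : I -> 'M[C]_m) (A : 'M[C]_m) :
  all (fun x => P x ==> (A *m F x == F x *m A)) s ->
  A *m (\big[mulmx/1%:M]_(x <- s | P x) F x) = (\big[mulmx/1%:M]_(x <- s | P x) F x) *m A.
Proof.
elim: s => [|x s IH] /=; first by rewrite big_nil mulmx1 mul1mx.
case/andP=> hx /IH{}IH; rewrite big_cons; case: (P x) hx => //= /eqP AF.
by rewrite mulmxA AF -!mulmxA IH.
Qed.

(** Stable partition of an ordered product: factors in [P] move right past the later factors outside
    [P], with which they commute. *)
Lemma big_mulmx_separate m (I : Type) (s : seq I) (P : pred I) (F : I -> 'M[C]_m) :
  pairwise [rel x y | P x && ~~ P y ==> (F x *m F y == F y *m F x)] s ->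
  \big[mulmx/1%:M]_(x <- s) F x =
  (\big[mulmx/1%:M]_(x <- s | ~~ P x) F x) *m (\big[mulmx/1%:M]_(x <- s | P x) F x).
Proof.
elim: s => [|x s IH] /=; first by rewrite !big_nil mulmx1.
case/andP=> hx /IH{}IH; rewrite !big_cons IH; case Px: (P x) => /=; last by rewrite mulmxA.
rewrite mulmxA (big_mulmx_comm (P := fun y => ~~ P y)) ?mulmxA //.
by apply: sub_all hx => y /=; rewrite Px; case: (P y).
Qed.

Definition gate := (nat * nat * op R (bits 2))%type.
Definition gpos (x : gate) := x.1.1.
Definition gtime (x : gate) := x.1.2.

Definition gfar : rel gate := [rel x y | ((gpos x).+1 < gpos y)%N || ((gpos y).+1 < gpos x)%N].

Definition circuit n (L : seq gate) : op R (bits n) :=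
  \big[mulmx/1%:M]_(x <- L) emb n (gpos x) x.2.

(** List order is product order. Two gates either have disjoint supports or appear in increasing
    time, so gates of equal time form a layer. Time runs from left to right in the product, against
    the order in which gates act on states. *)
Definition scheduled n D (L : seq gate) : bool :=
  all (fun x => [&& ((gpos x).+1 < n)%N, (gtime x < D)%N & x.2 \is unitarymx]) L &&
  pairwise [rel x y | gfar x y || (gtime x < gtime y)%N] L.

Lemma gfar_sym : symmetric gfar.
Proof. by move=> x y; rewrite /gfar /= orbC. Qed.

Lemma gfar_comm n x y : ((gpos x).+1 < n)%N -> ((gpos y).+1 < n)%N -> gfar x y ->
  emb n (gpos x) x.2 *m emb n (gpos y) y.2 = emb n (gpos y) y.2 *m emb n (gpos x) x.2.
Proof.
by move=> xn yn /orP xy; apply: emb_comm; [lia|lia|apply/orP; case: xy => xy; [left|right]; lia].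
Qed.

Lemma layer_of_far n (L : seq gate) :
  all (fun x => ((gpos x).+1 < n)%N && (x.2 \is unitarymx)) L -> pairwise gfar L ->
  exists (I : {set 'I_n}) (g : 'I_n -> op R (bits 2)),
    [/\ forall i : 'I_n, (i \in I) = (val i \in [seq gpos x | x <- L]),
        forall i : 'I_n, i \in I -> g i \is unitarymx &
        circuit n L = \big[mulmx/1%:M]_(i in I) emb n i (g i)].
Proof.
elim: L => [|x L IH] /=.
  exists finset.set0, (fun=> 1%:M); split=> [i|i|]; rewrite ?inE //.
  by rewrite /circuit big_nil big_pred0 // => i; rewrite inE.
move=> /andP[/andP[xn xU] hL] /andP[far pL]; have [I [g [IE gU LE]]] := IH hL pL.
have xn' : (gpos x < n)%N by lia.
pose i0 := Ordinal xn'.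
have farI (i : 'I_n) : i \in I -> (i.+1 < n)%N /\ ((i0.+1 < i)%N || (i.+1 < i0)%N).
  rewrite IE => /mapP[y yL ->]; split.
    by have /allP/(_ _ yL)/andP[] := hL.
  by have /allP/(_ _ yL) := far.
have i0I : i0 \notin I by apply/negP => /farI[_]; lia.
exists (i0 |: I)%SET, (fun i => if i == i0 then x.2 else g i); split.
- by move=> i; rewrite !inE IE -val_eqE.
- by move=> i; rewrite finset.in_setU1; case: eqP => [_ _|_ /gU //]; exact: xU.
rewrite /circuit big_cons -/(circuit n L) LE -big_filter.
rewrite (big_mulmx_separate (P := predC1 i0)); last first.
  have : {subset [seq i <- index_enum 'I_n | i \in (i0 |: I)%SET] <= (i0 |: I)%SET}.
    by move=> i; rewrite mem_filter => /andP[].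
  elim: [seq i <- _ | _] => //= i s IHs sub; apply/andP; split; last first.
    by apply: IHs => j js; apply: sub; rewrite inE js orbT.
  apply/allP => j js /=; apply/implyP; rewrite negbK => /andP[ii /eqP ->].
  rewrite eqxx (negPf ii).
  have : i \in (i0 |: I)%SET by apply: sub; rewrite inE eqxx.
  rewrite finset.in_setU1 (negPf ii) => /farI[ni fi]; apply/eqP.
  apply: emb_comm; [by rewrite addn2 | by rewrite addn2 | by rewrite !addn2 orbC].
rewrite !big_filter_cond; congr (_ *m _).
  rewrite (big_pred1 i0) ?eqxx // => i /=; rewrite !inE negbK.
  by case: eqP => //= _; rewrite andbF.
apply: eq_big => [i|i iI]; rewrite ?inE.
  by case: eqP => [->|] /=; rewrite ?andbT // (negPf i0I).
by rewrite ifN //; apply: contraNneq i0I => <-.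
Qed.

(** A gate of the last time slot is disjoint from every gate of smaller time that follows it in the
    list, so this slot can be collected at the right as one layer. *)
Lemma scheduled_depth n D (L : seq gate) : scheduled n D L -> nn_depth_le D (circuit n L).
Proof.
elim: D L => [|D IH] L.
  case: L => [|x L]; last by rewrite /scheduled /= andbF.
  move=> _; exists [tuple]; split; first by case.
  by rewrite /circuit !big_nil.
move=> /andP[/allP aL pL].
pose P (x : gate) := gtime x == D.
have [|Vs [Vl VE]] := IH [seq x <- L | ~~ P x].
  apply/andP; split; last exact: pairwise_filter.
  apply/allP => x; rewrite mem_filter => /andP[nx /aL/and3P[-> xt ->]].
  by rewrite andbT /=; move: nx; rewrite /P; lia.
have pF : pairwise gfar [seq x <- L | P x].
  have : all P [seq x <- L | P x] by exact: filter_all.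
  have := pairwise_filter P pL.
  elim: [seq x <- L | P x] => //= x s IHs /andP[h1 h2] /andP[/eqP Px Ps].
  rewrite IHs // andbT; apply/allP => y ys; have /allP/(_ _ ys) := h1.
  by have /allP/(_ _ ys)/eqP Py := Ps; rewrite /= Px Py ltnn orbF.
have aF : all (fun x => ((gpos x).+1 < n)%N && (x.2 \is unitarymx)) [seq x <- L | P x].
  by apply/allP => x; rewrite mem_filter => /andP[_ /aL/and3P[-> _ ->]].
have [I [g [IE gU FE]]] := layer_of_far aF pF.
exists [tuple of rcons Vs (circuit n [seq x <- L | P x])]; split.
  move=> j; rewrite (tnth_nth 1%:M) /= nth_rcons size_tuple.
  case: ltngtP => [lt|gt|_]; last first.
  - rewrite FE; exists I, g; split=> // [i|i j'].
      by rewrite IE => /mapP[x xF ->]; have /allP/(_ _ xF)/andP[] := aF.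
    rewrite !IE => /mapP[x xF ->] /mapP[y yF ->].
    have [->|xy] := eqVneq x y; first by rewrite ltn_eqF.
    have : gfar x y || (x == y).
      move: xF yF pF {xy}; elim: [seq x <- L | P x] => //= z s IHs.
      rewrite !inE => /orP[/eqP ->|xs] /orP[/eqP ->|ys] /andP[/allP h1 h2].
      + by rewrite eqxx orbT.
      + by rewrite h1.
      + by rewrite gfar_sym h1.
      + exact: IHs.
    by rewrite (negPf xy) orbF /gfar /=; lia.
  - by have := ltn_ord j; lia.
  - by have := Vl (Ordinal lt); rewrite (tnth_nth 1%:M).
rewrite /= -cats1 big_cat big_seq1 /= -VE /circuit !big_filter.
rewrite -(big_mulmx_separate (P := P)) //.
have aL' : all (fun x => ((gpos x).+1 < n)%N && (gtime x < D.+1)%N) L.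
  by apply/allP => x /aL/and3P[-> -> _].
move: pL aL'; elim: (L) => //= x s IHs /andP[h1 h2] /andP[/andP[xn xt] sn]; rewrite IHs // andbT.
apply/allP => y ys; apply/implyP => /andP[/eqP Px Py].
have /allP/(_ _ ys)/andP[yn yt] := sn.
apply/eqP/gfar_comm => //; have /allP/(_ _ ys)/orP[//|] := h1.
by rewrite Px ltnNge -ltnS yt.
Qed.

End Scheduling.

(** * Staircases of two-qubit Cliffords *)

Section Synthesis.
Variable R : realType.
Local Notation C := R[i].
Local Notation W := (@W R _).

(* Membership in the Clifford group up to an arbitrary scalar: gates may then be
   multiplied and adjusted freely, without tracking phases or determinants. *)
Definition gcl n (U : op R (bits n)) : Prop :=
  [/\ U \is unitarymx,
      forall s, exists c : C, exists t, U *m W s *m U ^t* = c *: W t &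
      forall s, exists c : C, exists t, U ^t* *m W s *m U = c *: W t].

Lemma clifford_gcl n (U : op R (bits n)) : clifford R n U -> gcl U.
Proof.
move=> /cliffordP[UU _ UP PU]; split=> // s.
  by have [a [t ->]] := UP s; eexists; eexists.
by have [a [t ->]] := PU s; eexists; eexists.
Qed.

Lemma gcl_adj n (U : op R (bits n)) : gcl U -> gcl (U ^t*).
Proof.
by case=> UU UP PU; split; rewrite ?trmxCK; [exact: unitarymx_adj|exact: PU|exact: UP].
Qed.

Lemma gcl_mul n (U V : op R (bits n)) : gcl U -> gcl V -> gcl (U *m V).
Proof.
move=> [UU UP PU] [VU VP PV]; split; first exact: (mul_unitarymx UU VU).
  move=> s; have [c [t e]] := VP s; have [d [r f]] := UP t.
  exists (c * d), r; rewrite hadj_mul !mulmxA -(mulmxA U) -(mulmxA U) e.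
  by rewrite -scalemxAr -scalemxAl f scalerA.
move=> s; have [c [t e]] := PU s; have [d [r f]] := PV t.
exists (c * d), r; rewrite hadj_mul !mulmxA -(mulmxA (V ^t*)) -(mulmxA (V ^t*)) e.
by rewrite -scalemxAr -scalemxAl f scalerA.
Qed.

Lemma W_conj_W n (r s : label n) : exists c : C, W r *m W s *m (W r) ^t* = c *: W s.
Proof.
exists (om R r s); rewrite W_comm -scalemxAl -mulmxA.
by rewrite (unitarymxP (W_unitary R r)) mulmx1.
Qed.

Lemma gcl_W n (r : label n) : gcl (W r).
Proof.
split; first exact: W_unitary.
  by move=> s; have [c e] := W_conj_W r s; exists c, s.
move=> s; have [c e] := W_conj_W r s; exists c, s; rewrite -e W_adj.
by rewrite -scalemxAr -!scalemxAl.
Qed.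

Lemma gcl1 n : gcl (1%:M : op R (bits n)).
Proof. by rewrite -W0; exact: gcl_W. Qed.

Lemma gcl_emb n w o (U : op R (bits w)) : (o + w <= n)%N -> gcl U -> gcl (emb n o U).
Proof.
move=> own [UU UP PU]; split; first exact: emb_unitary.
  move=> s; have [c [t e]] := UP (lslice w o s).
  by exists c, (lpatch o s t); rewrite emb_adj; exact: emb_W_emb.
move=> s; have [c [t e]] := PU (lslice w o s).
by exists c, (lpatch o s t); rewrite emb_adj; exact: emb_W_emb.
Qed.

Definition lX n : label n.+1 := (bone ord0, bzero _).
Definition lZ n : label n.+1 := (bzero _, bone ord0).

Lemma om_lX n (s : label n.+1) : om R (lX n) s = (-1) ^+ nth false s.2 0.
Proof. by rewrite om_xbone (tnth_nth false). Qed.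

Lemma om_lZ n (s : label n.+1) : om R (lZ n) s = (-1) ^+ nth false s.1 0.
Proof. by rewrite om_zbone (tnth_nth false). Qed.

Lemma nth_bone0 n i : nth false (bone (ord0 : 'I_n.+1)) i = (i == 0)%N.
Proof.
have [lt|ge] := ltnP i n.+1; first by rewrite nth_mktuple_bits.
by rewrite nth_default ?size_tuple //; apply/esym/eqP; lia.
Qed.

Lemma lZ_neq0 n : lZ n != lzero _.
Proof.
apply/eqP => /(congr1 (fun s : label n.+1 => nth false s.2 0)).
by rewrite /= nth_bone0 nth_bzero.
Qed.

Lemma labelP n (s t : label n) : (forall i, (i < n)%N ->
  nth false s.1 i = nth false t.1 i /\ nth false s.2 i = nth false t.2 i) -> s = t.
Proof.
case: s t => [a b] [c d] /= H; congr pair; apply: bitsP => i ni; by case: (H i ni).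
Qed.

Lemma nth_lpatch1 n w o (s : label n) (t : label w) i : (i < n)%N ->
  nth false (lpatch o s t).1 i =
  if (o <= i < o + w)%N then nth false t.1 (i - o) else nth false s.1 i.
Proof. exact: nth_patch. Qed.

Lemma nth_lpatch2 n w o (s : label n) (t : label w) i : (i < n)%N ->
  nth false (lpatch o s t).2 i =
  if (o <= i < o + w)%N then nth false t.2 (i - o) else nth false s.2 i.
Proof. exact: nth_patch. Qed.

Lemma nth_lzero1 n i : nth false (lzero n).1 i = false. Proof. exact: nth_bzero. Qed.
Lemma nth_lzero2 n i : nth false (lzero n).2 i = false. Proof. exact: nth_bzero. Qed.
Lemma nth_lX1 n i : nth false (lX n).1 i = (i == 0)%N. Proof. exact: nth_bone0. Qed.
Lemma nth_lX2 n i : nth false (lX n).2 i = false. Proof. exact: nth_bzero. Qed.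
Lemma nth_lZ1 n i : nth false (lZ n).1 i = false. Proof. exact: nth_bzero. Qed.
Lemma nth_lZ2 n i : nth false (lZ n).2 i = (i == 0)%N. Proof. exact: nth_bone0. Qed.
Definition nth_labelE := (nth_lzero1, nth_lzero2, nth_lX1, nth_lX2, nth_lZ1, nth_lZ2).

(* [f q] acts on the pair [(m - q, m - q + 1)]: gates are indexed by the distance
   to the last pair, which is unchanged when a qubit is added in front. *)
Definition stair m (f : nat -> op R (bits 2)) : op R (bits m.+2) :=
  \big[mulmx/1%:M]_(q < m.+1) emb m.+2 (m - q) (f q).

Lemma big_emb n w o M (F : 'I_M -> op R (bits w)) : (o + w <= n)%N ->
  emb n o (\big[mulmx/1%:M]_(i < M) F i) = \big[mulmx/1%:M]_(i < M) emb n o (F i).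
Proof.
move=> own; elim: M F => [|M IH] F; first by rewrite !big_ord0 emb1.
by rewrite !big_ord_recr /= -IH emb_mul.
Qed.

Lemma stairS m f : stair m.+1 f = emb m.+3 1 (stair m f) *m emb m.+3 0 (f m.+1).
Proof.
rewrite /stair big_ord_recr /= subnn; congr (_ *m _).
rewrite big_emb //; apply: eq_bigr => q _; rewrite emb_emb //; last first.
  by have := ltn_ord q; lia.
by congr (emb _ _ _); have := ltn_ord q; lia.
Qed.

Lemma eq_stair m f f' : (forall q, (q <= m)%N -> f q = f' q) -> stair m f = stair m f'.
Proof. by move=> ff; apply: eq_bigr => q _; rewrite ff // -ltnS ltn_ord. Qed.

Lemma stair_gcl m f : (forall q, gcl (f q)) -> gcl (stair m f).
Proof.
move=> fg; rewrite /stair; elim/big_ind : _ => [|A B|q _]; [exact: gcl1|exact: gcl_mul|].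
by apply: gcl_emb => //; have := ltn_ord q; lia.
Qed.

Lemma conj_emb n w o (U : op R (bits w)) (s : label n) (t : label w) (c : C) : (o + w <= n)%N ->
  U ^t* *m W (lslice w o s) *m U = c *: W t ->
  (emb n o U) ^t* *m W s *m emb n o U = c *: W (lpatch o s t).
Proof. by move=> own e; rewrite emb_adj; exact: emb_W_emb. Qed.

Lemma gcl_conj0 n (U : op R (bits n)) : gcl U ->
  U ^t* *m W (lzero n) *m U = 1 *: W (lzero n).
Proof. by case=> UU _ _; rewrite !W0 mulmx1 scale1r unitarymx_mulVmx. Qed.

Definition clears m (f : nat -> op R (bits 2)) (s t : label m.+2) : Prop :=
  exists c : C, (stair m f) ^t* *m W s *m stair m f = c *: W t.

(** Clears all qubits behind the second without acting on the first; it begins the staircase for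
    [Z_0] and the one for [X_0]. *)
Lemma clears_tail m (s : label m.+3) :
  (forall s : label m.+2, s != lzero _ ->
     exists2 f : nat -> op R (bits 2), (forall q, gcl (f q)) & clears f s (lZ _)) ->
  exists2 f : nat -> op R (bits 2), (forall q, gcl (f q)) &
    exists c : C, exists t : label m.+2,
    (emb m.+3 1 (stair m f)) ^t* *m W s *m emb m.+3 1 (stair m f) = c *: W (lpatch 1 s t) /\
    t = if lslice m.+2 1 s == lzero _ then lzero _ else lZ _.
Proof.
move=> IH; case: eqP => [z|/eqP s1].
  exists (fun=> 1%:M) => [_|]; first exact: gcl1.
  exists 1, (lzero _); split=> //; apply: conj_emb => //.
  by rewrite z; apply: gcl_conj0; apply: stair_gcl => _; exact: gcl1.
have [f fg [c cE]] := IH _ s1; exists f => //; exists c, (lZ _); split=> //.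
exact: conj_emb.
Qed.

(* Each gate moves the Pauli off the last qubit it acts on. *)
Lemma stair_clear m (s : label m.+2) : s != lzero _ ->
  exists2 f : nat -> op R (bits 2), (forall q, gcl (f q)) & clears f s (lZ _).
Proof.
elim: m s => [|m IH] s s0.
  have [U Uc Us] := act_trans R s0 (lZ_neq0 1).
  exists (fun=> U) => [_|]; first exact: clifford_gcl.
  by rewrite /clears /stair big_ord_recr big_ord0 /= mul1mx subnn emb_full -Us; exact: actP.
have [f fg [c [t [e1 tE]]]] := clears_tail s IH.
set s1 := lpatch 1 s t in e1 *.
(* Either the tail left a Z on the second qubit, or the tail was trivial and the first qubit is
   not. *)
have s2n : lslice 2 0 s1 != lzero _.
  apply: contraNneq s0 => /eqP/lslice_eq0P z.
  have := z 1%N isT; rewrite add0n /s1 nth_lpatch1 // nth_lpatch2 //= subnn tE.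
  case: ifP => [/lslice_eq0P s1z _|_]; last by rewrite !nth_labelE => -[].
  apply/eqP/labelP => i ni; rewrite !nth_labelE; case: i ni => [|i] ni.
    by have := z 0%N isT; rewrite /s1 nth_lpatch1 // nth_lpatch2.
  by have := s1z i ni; rewrite add1n.
have [U Uc Us] := act_trans R s2n (lZ_neq0 1).
have [d dE] := actP (lslice 2 0 s1) Uc; rewrite Us in dE.
have e2 := conj_emb (n := m.+3) (o := 0) (ltac:(by []) : (0 + 2 <= m.+3)%N) dE.
exists (fun q => if q == m.+1 then U else f q).
  by move=> q; case: ifP => // _; exact: clifford_gcl.
rewrite /clears stairS eqxx (eq_stair (f' := f)) => [|q qm]; last by rewrite ifN //; lia.
exists (c * d); rewrite hadj_mul !mulmxA -(mulmxA ((emb _ 0 _) ^t*)) -(mulmxA ((emb _ 0 _) ^t*)) e1.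
rewrite -scalemxAr -scalemxAl e2 scalerA; congr (_ *: W _).
apply: labelP => i ni; rewrite nth_lpatch1 // nth_lpatch2 // leq0n add0n subn0 !nth_labelE.
case: ltnP => i2 //; rewrite /s1 nth_lpatch1 // nth_lpatch2 //.
have -> : (0 < i < 1 + m.+2)%N by lia.
have -> : (i == 0)%N = false by lia.
rewrite tE; case: ifP => _; rewrite !nth_labelE //; split=> //.
by apply/eqP; lia.
Qed.

(** Here [t] anticommutes with [Z_0]. The rotation about [t X_0] then commutes with [Z_0], and sends
    [t] to [X_0] when these two anticommute; if they commute, [Y_0] is a stopover. *)
Lemma rotate_to_lX (t : label 2) : nth false t.1 0 ->
  exists2 g : op R (bits 2), gcl g &
    g ^t* *m W (lZ 1) *m g = W (lZ 1) /\
    exists c : C, g ^t* *m W t *m g = c *: W (lX 1).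
Proof.
pose good (t u : label 2) := exists2 g : op R (bits 2), gcl g &
    g ^t* *m W (lZ 1) *m g = W (lZ 1) /\
    exists c : C, g ^t* *m W t *m g = c *: W u.
have rot (s u : label 2) : om R s (lZ 1) = -1 -> om R u (lZ 1) = -1 -> om R u s = -1 -> good s u.
  move=> sz uz us; have [g gU gP] := isP_rotation R (ladd s u).
  exists g; first split=> // q.
  - case/orP: (om_cases R (ladd s u) q) => /eqP h; have [h1 h2] := gP q.
      by have [-> _] := h1 h; exists 1, q; rewrite scale1r.
    by have [a [b [-> _]]] := h2 h; eexists; eexists.
  - case/orP: (om_cases R (ladd s u) q) => /eqP h; have [h1 h2] := gP q.
      by have [_ ->] := h1 h; exists 1, q; rewrite scale1r.
    by have [a [b [_ ->]]] := h2 h; eexists; eexists.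
  split.
    by have [/(_ _)[]] := gP (lZ 1); rewrite // om_addl sz uz mulrNN mulr1.
  have [_ /(_ _)[|a [b [_ ->]]]] := gP s; first by rewrite om_addl om_self mul1r.
  by exists ('i ^+ b); rewrite laddC laddK.
have omZ (s : label 2) : nth false s.1 0 -> om R s (lZ 1) = -1.
  by move=> h; rewrite omC om_lZ h.
have omX (s : label 2) : nth false s.2 0 -> om R (lX 1) s = -1.
  by move=> h; rewrite om_lX h.
move=> t1; case t2: (nth false t.2 0).
  by apply: rot; [exact: omZ | apply: omZ; rewrite nth_labelE | exact: omX].
pose y : label 2 := (bone ord0, bone ord0).
have y1 : nth false y.1 0 by rewrite nth_bone0.
have y2 : nth false y.2 0 by rewrite nth_bone0.
have yE : y = ladd (lX 1) (lZ 1).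
  have -> : ladd (lX 1) (lZ 1) = (bxor (bone ord0) (bzero 2), bxor (bzero 2) (bone ord0)) by [].
  by rewrite bxor0 bxorC bxor0.
have [g gg [gZ [c gc]]] : good t y.
  apply: rot; [exact: omZ | exact: omZ |].
  by rewrite yE om_addl om_lX om_lZ t1 t2 mul1r.
have [h hg [hZ [d hd]]] : good y (lX 1).
  by apply: rot; [exact: omZ | apply: omZ; rewrite nth_labelE | exact: omX].
exists (g *m h); first exact: gcl_mul.
split; first by rewrite hadj_mul !mulmxA -(mulmxA (h ^t*)) -(mulmxA (h ^t*)) gZ.
exists (c * d); rewrite hadj_mul !mulmxA -(mulmxA (h ^t*)) -(mulmxA (h ^t*)) gc.
by rewrite -scalemxAr -scalemxAl hd scalerA.
Qed.

Lemma W_sqr n (s : label n) : bsgn R s.1 s.2 = 1 -> W s *m W s = 1%:M.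
Proof. by move=> e; rewrite W_mul_self e scale1r. Qed.

Lemma lZ_sqr n : W (lZ n) *m W (lZ n) = 1%:M.
Proof. by apply: W_sqr; rewrite bsgn0l. Qed.

Lemma lX_sqr n : W (lX n) *m W (lX n) = 1%:M.
Proof. by apply: W_sqr; rewrite bsgnC bsgn0l. Qed.

(** Squaring the relation gives [c ^ 2 = 1]: after a staircase, known up to a scalar, only a sign is
    left to correct. *)
Lemma involution_sign n (U A B : op R (bits n)) (c : C) : U \is unitarymx ->
  A *m A = 1%:M -> B *m B = 1%:M -> U *m A *m U ^t* = c *: B -> c = 1 \/ c = -1.
Proof.
move=> UU AA BB e; have : (U *m A *m U ^t*) *m (U *m A *m U ^t*) = 1%:M.
  rewrite !mulmxA -(mulmxA _ (U ^t*) U) unitarymx_mulVmx // mulmx1 -(mulmxA U) AA mulmx1.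
  exact/unitarymxP.
rewrite e -scalemxAl -scalemxAr BB scalerA => /(congr1 mxtrace).
rewrite linearZ /= mxtrace1 -[RHS]mul1r => /mulIf; rewrite pnatr_eq0 card_bits expn_eq0 => /(_ isT).
by rewrite -expr2 => /eqP; rewrite sqrf_eq1 => /orP[] /eqP; [left|right].
Qed.

Lemma stair_last m f (g : op R (bits 2)) : (forall q, gcl (f q)) -> gcl g ->
  exists2 f' : nat -> op R (bits 2), (forall q, gcl (f' q)) &
    stair m.+1 f' = stair m.+1 f *m emb m.+3 0 g.
Proof.
move=> fg gg; exists (fun q => if q == m.+1 then f q *m g else f q).
  by move=> q; case: ifP => // _; exact: gcl_mul.
rewrite !stairS eqxx -mulmxA emb_mul //; congr (emb _ _ _ *m _).
by apply: eq_stair => q qm; rewrite ifN //; lia.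
Qed.

Lemma emb_W n w o (t : label w) : (o + w <= n)%N ->
  emb n o (W t) = W (lpatch o (lzero n) t).
Proof.
move=> own; rewrite -[RHS]scale1r -(emb_W_emb (A := W t) (B := 1%:M) own).
  by rewrite emb1 W0 !mulmx1.
by rewrite lslice0 W0 !mulmx1 scale1r.
Qed.

Lemma emb_lX m : emb m.+3 0 (W (lX 1)) = W (lX _).
Proof.
rewrite emb_W //; congr W; apply: labelP => i ni.
rewrite nth_lpatch1 // nth_lpatch2 // leq0n add0n subn0 !nth_labelE.
by case: ltnP => // i2; split=> //; apply/esym/eqP; lia.
Qed.

Lemma emb_lZ m : emb m.+3 0 (W (lZ 1)) = W (lZ _).
Proof.
rewrite emb_W //; congr W; apply: labelP => i ni.
rewrite nth_lpatch1 // nth_lpatch2 // leq0n add0n subn0 !nth_labelE.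
by case: ltnP => // i2; split=> //; apply/esym/eqP; lia.
Qed.

Lemma om_lXZ n : om R (lX n) (lZ n) = -1.
Proof. by rewrite om_lX nth_labelE. Qed.

Lemma conj_anticomm n (s t : label n) : om R s t = -1 ->
  (W s) ^t* *m W t *m W s = - W t.
Proof.
move=> st; rewrite -mulmxA W_comm omC st scaleN1r mulmxN mulmxA.
by rewrite unitarymx_mulVmx ?mul1mx // W_unitary.
Qed.

Lemma mulmx_conj m (S U A : 'M[C]_m) :
  (S ^t* *m U) *m A *m (S ^t* *m U) ^t* = S ^t* *m (U *m A *m U ^t*) *m S.
Proof. by rewrite hadj_mul trmxCK !mulmxA. Qed.

Lemma conj_mul m (S T A : 'M[C]_m) :
  (S *m T) ^t* *m A *m (S *m T) = T ^t* *m (S ^t* *m A *m S) *m T.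
Proof. by rewrite hadj_mul !mulmxA. Qed.

Lemma conj_mulmx m (U A B : 'M[C]_m) : U \is unitarymx ->
  (U *m A *m U ^t*) *m (U *m B *m U ^t*) = U *m (A *m B) *m U ^t*.
Proof. by move=> UU; rewrite !mulmxA -(mulmxA _ (U ^t*) U) unitarymx_mulVmx // mulmx1. Qed.

Lemma om_scaled n (s t : label n) (c x : C) : c != 0 ->
  (c *: W s) *m W t = x *: (W t *m (c *: W s)) -> om R s t = x.
Proof.
move=> c0; rewrite -scalemxAl -scalemxAr W_comm !scalerA => /eqP.
rewrite -subr_eq0 -scalerBl scaler_eq0 [x * c]mulrC -mulrBr mulf_eq0 (negPf c0) /=.
case/orP => [|/eqP ts]; first by rewrite subr_eq0 => /eqP.
have := unitarymx_neq0 (mul_unitarymx (W_unitary R t) (W_unitary R s)).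
by rewrite ts eqxx.
Qed.

(* The staircase maps the Pauli [U Z_0 U^*] back to [Z_0]. *)
Lemma peel_Z m (U : op R (bits m.+3)) : gcl U ->
  exists2 f : nat -> op R (bits 2), (forall q, gcl (f q)) &
    ((stair m.+1 f) ^t* *m U) *m W (lZ _) *m ((stair m.+1 f) ^t* *m U) ^t* = W (lZ _).
Proof.
move=> Ug; have [UU UP _] := Ug; have [c [s cE]] := UP (lZ _).
have s0 : s != lzero _.
  apply: contraNneq (lZ_neq0 m.+2) => s0; move: cE; rewrite s0 W0 => cE.
  apply/eqP/(@W_inj R _ _ _ c); rewrite W0.
  transitivity (U ^t* *m (U *m W (lZ _) *m U ^t*) *m U).
    by rewrite !mulmxA unitarymx_mulVmx // mul1mx -mulmxA unitarymx_mulVmx // mulmx1.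
  by rewrite cE -scalemxAr mulmx1 -scalemxAl unitarymx_mulVmx.
have [f fg [d dE]] := stair_clear s0.
have Sg := stair_gcl m.+1 fg; have [SU _ _] := Sg.
have VU : (stair m.+1 f) ^t* *m U \is unitarymx := mul_unitarymx (unitarymx_adj SU) UU.
have cd : (stair m.+1 f) ^t* *m U *m W (lZ _) *m ((stair m.+1 f) ^t* *m U) ^t* = (c * d) *: W (lZ _).
  by rewrite mulmx_conj cE -scalemxAr -scalemxAl dE scalerA.
case: (involution_sign VU (lZ_sqr _) (lZ_sqr _) cd) => cd1.
  by exists f => //; rewrite cd cd1 scale1r.
(* The sign -1 is removed by an X on the first qubit, absorbed in the last gate of the staircase. *)
have [f' fg' f'E] := stair_last m fg (gcl_W (lX 1)).
exists f' => //; rewrite mulmx_conj f'E emb_lX conj_mul -mulmx_conj cd cd1.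
by rewrite -scalemxAr -scalemxAl conj_anticomm ?om_lXZ // scaleN1r opprK.
Qed.

Lemma emb_stair_lZ m f : (forall q, gcl (f q)) ->
  (emb m.+3 1 (stair m f)) ^t* *m W (lZ _) *m emb m.+3 1 (stair m f) = W (lZ _).
Proof.
move=> fg; have Sg := stair_gcl m fg; have [SU _ _] := Sg.
have z : lslice m.+2 1 (lZ m.+2) = lzero _.
  by apply/eqP/lslice_eq0P => i ni; rewrite !nth_labelE.
have := conj_emb (n := m.+3) (o := 1) (leqnn _) (s := lZ _) (t := lzero _) (c := 1) (U := stair m f).
rewrite z => /(_ (gcl_conj0 Sg)) ->; rewrite scale1r; congr W.
apply: labelP => i ni; rewrite nth_lpatch1 // nth_lpatch2 // !nth_labelE.
by case: ifP => // h; split=> //; apply/esym/eqP; lia.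
Qed.

(** The image of [X_0] anticommutes with [Z_0], the image of [Z_0]. Its tail is cleared by gates
    away from the first qubit, and the last gate turns it into [X_0] while fixing [Z_0], so the
    first staircase is not undone. *)
Lemma peel_X m (U : op R (bits m.+3)) : gcl U -> U *m W (lZ _) *m U ^t* = W (lZ _) ->
  exists2 f : nat -> op R (bits 2), (forall q, gcl (f q)) &
    ((stair m.+1 f) ^t* *m U) *m W (lZ _) *m ((stair m.+1 f) ^t* *m U) ^t* = W (lZ _) /\
    ((stair m.+1 f) ^t* *m U) *m W (lX _) *m ((stair m.+1 f) ^t* *m U) ^t* = W (lX _).
Proof.
move=> Ug UZ; have [UU UP _] := Ug; have [c [s cE]] := UP (lX _).
have c0 : c != 0.
  apply: contraTneq (unitarymx_neq0 (mul_unitarymx (mul_unitarymx UU (W_unitary R (lX _))) (unitarymx_adj UU))).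
  by move=> c0; rewrite cE c0 scale0r eqxx.
have sZ : om R s (lZ _) = -1.
  apply: (om_scaled c0); rewrite -cE -[X in _ *m X]UZ -[X in _ *: (X *m _)]UZ.
  by rewrite !(conj_mulmx _ _ UU) W_comm om_lXZ -scalemxAr -scalemxAl.
have s1 : nth false s.1 0.
  move: sZ; rewrite omC om_lZ; case: (nth _ _ _) => //= /eqP.
  by rewrite expr0 -addr_eq0 -(natrD _ 1 1) pnatr_eq0.
have [f fg [c1 [t [e1 tE]]]] := clears_tail s (@stair_clear m).
set s' := lpatch 1 s t in e1.
have s'1 : nth false (lslice 2 0 s').1 0.
  by rewrite nth_slice // add0n nth_lpatch1.
have [g gg [gZ [d dE]]] := rotate_to_lX s'1.
pose f' q := if q == m.+1 then g else f q.
have fg' q : gcl (f' q) by rewrite /f'; case: ifP.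
have SE : stair m.+1 f' = emb m.+3 1 (stair m f) *m emb m.+3 0 g.
  rewrite stairS /f' eqxx; congr (emb _ _ _ *m _).
  by apply: eq_stair => q qm; rewrite ifN //; lia.
have le2 : (0 + 2 <= m.+3)%N by [].
have SZ : (stair m.+1 f') ^t* *m W (lZ _) *m stair m.+1 f' = W (lZ _).
  rewrite SE conj_mul (emb_stair_lZ m fg) -emb_lZ emb_adj.
  by rewrite (emb_mul _ _ le2) (emb_mul _ _ le2) gZ.
have e2 := conj_emb (n := m.+3) (o := 0) (ltac:(by []) : (0 + 2 <= m.+3)%N) dE.
have SX : (stair m.+1 f') ^t* *m (U *m W (lX _) *m U ^t*) *m stair m.+1 f' = (c * c1 * d) *: W (lX _).
  rewrite cE -scalemxAr -scalemxAl SE conj_mul e1 -scalemxAr -scalemxAl e2 !scalerA.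
  congr (_ *: W _); apply: labelP => i ni.
  rewrite nth_lpatch1 // nth_lpatch2 // leq0n add0n subn0 !nth_labelE.
  case: ltnP => i2 //; rewrite /s' nth_lpatch1 // nth_lpatch2 //.
  have -> : (0 < i < 1 + m.+2)%N by lia.
  have -> : (i == 0)%N = false by lia.
  rewrite tE; case: ifP => _; rewrite !nth_labelE //; split=> //.
  by apply/eqP; lia.
have [SU _ _] := stair_gcl m.+1 fg'.
have VU := mul_unitarymx (unitarymx_adj SU) UU.
have sgn : c * c1 * d = 1 \/ c * c1 * d = -1.
  by apply: (involution_sign VU (lX_sqr _) (lX_sqr _)); rewrite mulmx_conj.
case: sgn => sg.
  by exists f'; rewrite ?(mulmx_conj (stair _ f') U) ?UZ ?SX ?sg ?scale1r.
(* A Z on the first qubit flips the sign of [X_0] and keeps [Z_0]. *)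
have [h hg hE] := stair_last m fg' (gcl_W (lZ 1)).
exists h; first exact: hg.
split; rewrite mulmx_conj hE emb_lZ (conj_mul (stair m.+1 f')).
  by rewrite UZ SZ -mulmxA lZ_sqr mulmx1 W_adj bsgn0l scale1r.
by rewrite SX sg -scalemxAr -scalemxAl conj_anticomm 1?omC ?om_lXZ // scaleN1r opprK.
Qed.

End Synthesis.

Section Circuits.
Variable R : realType.
Local Notation C := R[i].
Local Notation W := (@W R _).

Lemma ment_Wx n (x u v : bits n) :
  ment (W (x, bzero n)) u v = (bxor x u == v)%:R.
Proof.
rewrite ment_W; case: eqP => [<-|xuv].
  apply: big1 => i _; rewrite /went !tnth_mktuple andFb expr0 mulr1 addbA addbb addFb.
  by rewrite eqxx.
have [i ni] : exists i, tnth u i != tnth x i (+) tnth v i.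
  apply/existsP; apply: contraT => /existsPn h; case: xuv.
  apply: eq_from_tnth => i; rewrite tnth_mktuple; move/negPn/eqP: (h i) => ->.
  by rewrite addbA addbb.
by rewrite (bigD1 i) //= /went (negPf ni) !mul0r.
Qed.

(** Commuting with [Z_0] kills the entries between different first bits, and commuting with [X_0]
    makes the two diagonal blocks equal. *)
Lemma commuting_tail m (U : op R (bits m.+1)) :
  U *m W (lX _) = W (lX _) *m U -> U *m W (lZ _) = W (lZ _) *m U ->
  U = emb m.+1 1 (mkop (fun t t' : bits m =>
        ment U (bpatch 1 (bzero _) t) (bpatch 1 (bzero _) t'))).
Proof.
move=> UX UZ; apply: mentP => u v; rewrite ment_emb ment_mkmx.
have XE a b : ment U (bxor (bone ord0) a) b = ment U a (bxor (bone ord0) b).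
  have := congr1 (fun A => ment A a b) UX; rewrite /= !ment_mul.
  rewrite (bigD1 (bxor (bone ord0) b)) //= ment_Wx bxorK eqxx mulr1 big1 ?addr0; last first.
    move=> t tb; rewrite ment_Wx; case: eqP => [e|]; last by rewrite mulr0.
    by rewrite -e bxorK eqxx in tb.
  rewrite (bigD1 (bxor (bone ord0) a)) //= ment_Wx eqxx mul1r big1 ?addr0 //.
  by move=> t ta; rewrite ment_Wx eq_sym (negPf ta) mul0r.
have ZE (a b : bits m.+1) : nth false a 0 != nth false b 0 -> ment U a b = 0.
  have := congr1 (fun A => ment A a b) UZ; rewrite /= Wz_mulrE Wz_mulE !bsgn_bone.
  rewrite !(tnth_nth false) /=.
  case: (nth false a 0); case: (nth false b 0); rewrite ?expr0 ?expr1 // ?mul1r ?mulN1r => /eqP h _.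
    by move: h; rewrite eq_sym eqNr => /eqP.
  by move: h; rewrite eqNr => /eqP.
have offE : offeq m 1 u v = (nth false u 0 == nth false v 0).
  apply/offeqP/eqP => [h|h i ni]; first exact: h.
  by case: i ni => // i ni; lia.
rewrite offE; have [uv|uv] := eqVneq (nth false u 0) (nth false v 0); last first.
  by rewrite mulr0 ZE.
rewrite mulr1; have pE (a : bits m.+1) : bpatch 1 (bzero m.+1) (slice m 1 a) =
    if nth false a 0 then bxor (bone ord0) a else a.
  apply: bitsP => i ni; rewrite nth_patch //; case: i ni => [|i] ni.
    by rewrite nth_bzero; case: ifP => a0; rewrite ?nth_bxor ?nth_bone0 ?a0.
  have -> : (0 < i.+1 < 1 + m)%N by lia.
  rewrite subn1 /= nth_slice; last by lia.
  by rewrite add1n; case: ifP => // _; rewrite nth_bxor nth_bone0.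
rewrite !pE -uv; case: ifP => // _; by rewrite XE bxorK.
Qed.

Lemma emb_inj n w o (A B : op R (bits w)) : (o + w <= n)%N ->
  emb n o A = emb n o B -> A = B.
Proof.
move=> own e; apply: mentP => t t'.
have := congr1 (fun M => ment M (bpatch o (bzero n) t) (bpatch o (bzero n) t')) e.
rewrite /= !ment_emb !slice_patch // offeq_patchl.
by rewrite offeq_patch !mulr1.
Qed.

Lemma commute_conj m (U A : 'M[C]_m) : U \is unitarymx -> U *m A *m U ^t* = A ->
  U *m A = A *m U.
Proof. by move=> UU e; rewrite -[in RHS]e -mulmxA unitarymx_mulVmx // mulmx1. Qed.

(** The image Pauli is an operator on the tail, so it commutes with [X_0] and [Z_0]; its label
    therefore vanishes at the first qubit and restricts to the tail. *)
Lemma tail_conj m (V : op R (bits m.+2)) (t : label m.+2) : V \is unitarymx ->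
  (forall s, exists c : C, exists r, emb m.+3 1 V *m W s *m (emb m.+3 1 V) ^t* = c *: W r) ->
  exists c : C, exists r, V *m W t *m V ^t* = c *: W r.
Proof.
move=> VU VP; have [c [r e]] := VP (lpatch 1 (lzero _) t).
have {}e : emb m.+3 1 (V *m W t *m V ^t*) = c *: W r.
  by rewrite -e -emb_W // emb_adj !emb_mul.
exists c, (lslice m.+2 1 r); apply: (@emb_inj m.+3 _ 1) => //; rewrite e.
have c0 : c != 0.
  have VWV : V *m W t *m V ^t* \is unitarymx :=
    mul_unitarymx (mul_unitarymx VU (W_unitary R t)) (unitarymx_adj VU).
  have := unitarymx_neq0 (emb_unitary (leqnn _ : (1 + m.+2 <= m.+3)%N) VWV).
  by rewrite e; apply: contraNneq => ->; rewrite scale0r.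
have W1 (A : op R (bits 1)) : emb m.+3 0 A *m (c *: W r) = (c *: W r) *m emb m.+3 0 A.
  by rewrite -e emb_comm.
have X1 : W (lX m.+2) = emb m.+3 0 (W (lX 0)).
  rewrite emb_W //; congr W; apply: labelP => i ni.
  rewrite nth_lpatch1 // nth_lpatch2 // leq0n add0n subn0 !nth_labelE.
  by case: ltnP => // i2; split=> //; apply/eqP; lia.
have Z1 : W (lZ m.+2) = emb m.+3 0 (W (lZ 0)).
  rewrite emb_W //; congr W; apply: labelP => i ni.
  rewrite nth_lpatch1 // nth_lpatch2 // leq0n add0n subn0 !nth_labelE.
  by case: ltnP => // i2; split=> //; apply/eqP; lia.
have oX : om R (lX _) r = 1 by rewrite omC; apply: (om_scaled c0); rewrite scale1r X1 W1.
have oZ : om R (lZ _) r = 1 by rewrite omC; apply: (om_scaled c0); rewrite scale1r Z1 W1.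
have neg1 : (-1 : C) != 1 by rewrite eq_sym -addr_eq0 -(natrD _ 1 1) pnatr_eq0.
have r2 : nth false r.2 0 = false.
  by move: oX neg1; rewrite om_lX; case: (nth _ _ _) => //=; rewrite expr1 => ->; rewrite eqxx.
have r1 : nth false r.1 0 = false.
  by move: oZ neg1; rewrite om_lZ; case: (nth _ _ _) => //=; rewrite expr1 => ->; rewrite eqxx.
rewrite -[RHS](_ : c *: emb m.+3 1 (W (lslice m.+2 1 r)) = _); last first.
  by apply: mentP => u v; rewrite mentZ !ment_emb mentZ mulrA.
congr (_ *: _); rewrite emb_W //; congr W; apply: labelP => i ni.
rewrite nth_lpatch1 // nth_lpatch2 // !nth_labelE; case: i ni => [|i] ni //=.
have -> : (i.+1 < 1 + m.+2)%N by lia.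
by rewrite subn1 /= !nth_slice ?add1n.
Qed.

Lemma peel m (U : op R (bits m.+3)) : gcl U ->
  exists f g : nat -> op R (bits 2), exists V : op R (bits m.+2),
  [/\ forall q, gcl (f q), forall q, gcl (g q), gcl V &
      U = stair m.+1 f *m stair m.+1 g *m emb m.+3 1 V].
Proof.
move=> Ug; have [f fg fZ] := peel_Z Ug.
have Sg := stair_gcl m.+1 fg; have [SU _ _] := Sg.
have U1g : gcl ((stair m.+1 f) ^t* *m U) := gcl_mul (gcl_adj Sg) Ug.
have [g gg [gZ gX]] := peel_X U1g fZ.
have Tg := stair_gcl m.+1 gg; have [TU _ _] := Tg.
have U2g := gcl_mul (gcl_adj Tg) U1g; have [U2U U2P U2P'] := U2g.
have := commuting_tail (commute_conj U2U gX) (commute_conj U2U gZ).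
set V := mkop _ => VE; exists f, g, V; split=> //; last first.
  by rewrite -VE mulmxA -(mulmxA (stair _ f) (stair _ g)) (unitarymxP TU) mulmx1 mulmxA (unitarymxP SU) mul1mx.
rewrite VE in U2U U2P U2P'.
have VU : V \is unitarymx.
  apply/unitarymxP/(@emb_inj m.+3 _ 1) => //.
  by rewrite -emb_mul // -emb_adj (unitarymxP U2U) emb1.
split=> // s; first exact: tail_conj.
have [|c [r e]] := @tail_conj m (V ^t*) s (unitarymx_adj VU).
  by move=> q; have [c [r e]] := U2P' q; exists c, r; rewrite -emb_adj trmxCK.
by exists c, r; rewrite -e trmxCK.
Qed.

Definition dist_gate_op m (x : gate R) : op R (bits m.+2) := emb m.+2 (m - gpos x) x.2.

(* Peeling one qubit takes two staircases, whose gates at distance [q] are run at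
   times [q] and [q + 2]; the circuit for the other qubits starts at time 4, so
   that all staircases are run in a pipeline and the depth is linear. *)
Lemma clifford_synthesis m (U : op R (bits m.+2)) : gcl U ->
  exists L : seq (gate R),
  [/\ all (fun x => [&& (gpos x <= m)%N, (gpos x <= gtime x)%N, (gtime x <= 5 * m)%N
                      & x.2 \is unitarymx]) L,
      pairwise [rel x y | gfar x y || (gtime x < gtime y)%N] L &
      U = \big[mulmx/1%:M]_(x <- L) dist_gate_op m x].
Proof.
elim: m U => [|m IH] U Ug.
  have [UU _ _] := Ug; exists [:: (0%N, 0%N, U)]; split=> //=; first by rewrite UU.
  by rewrite big_seq1 /dist_gate_op /= emb_full.
have [f [g [V [fg gg Vg UE]]]] := peel Ug.
have [L [aL pL LE]] := IH V Vg.
pose La := [seq ((q, q), f q) : gate R | q <- iota 0 m.+2].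
pose Lb := [seq ((q, q + 2)%N, g q) : gate R | q <- iota 0 m.+2].
pose Lc := [seq ((gpos x, (gtime x + 4)%N), x.2) : gate R | x <- L].
exists (La ++ Lb ++ Lc); split.
(* The recursive circuit ends by time [5 * m + 4] and the staircases by [m + 3]; both fit in
   [5 * m + 5]. *)
- rewrite !all_cat; apply/and3P; split.
  + apply/allP => _ /mapP[q + ->]; rewrite mem_iota /gpos /gtime /= => qm.
    by have [-> _ _] := fg q; rewrite andbT; lia.
  + apply/allP => _ /mapP[q + ->]; rewrite mem_iota /gpos /gtime /= => qm.
    by have [-> _ _] := gg q; rewrite andbT; lia.
  + apply/allP => _ /mapP[x + ->]; rewrite /gpos /gtime /= => /(allP aL)/and4P[h1 h2 h3 ->].
    by rewrite andbT; move: h1 h2 h3; rewrite /gpos /gtime; lia.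
- have pi (h : nat -> gate R) : (forall q, gtime (h q) < gtime (h q.+1))%N ->
      pairwise [rel x y : gate R | gfar x y || (gtime x < gtime y)%N] [seq h q | q <- iota 0 m.+2].
    move=> hm; have mono : {homo (fun q => gtime (h q)) : p q / (p < q)%N}.
      by apply: homo_ltn => //; exact: ltn_trans.
    elim: (m.+2) 0%N => //= k IHk a; rewrite IHk andbT.
    apply/allP => _ /mapP[q + ->]; rewrite mem_iota => /andP[aq _] /=.
    by rewrite mono ?orbT.
  (* Overlapping gates have distances differing by at most 1, whereas each stage is delayed by 2;
     the invariant [gpos <= gtime] extends this to the recursive circuit. *)
  rewrite !pairwise_cat allrel_catr; apply/and3P; split; last apply/and3P; last split.
  + apply/andP; split; apply/allrelP => x0 y0 /mapP[q qi ->].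
      by move=> /mapP[q' qi' ->]; rewrite /gfar /gpos /gtime /=; lia.
    move=> /mapP[x /(allP aL)/and4P[h1 h2 _ _] ->].
    by rewrite /gfar /gpos /gtime /= in h1 h2 *; lia.
  + by apply: pi => q; rewrite /gtime /=.
  + apply/allrelP => x0 y0 /mapP[q qi ->] /mapP[x /(allP aL)/and4P[h1 h2 _ _] ->].
    by rewrite /gfar /gpos /gtime /= in h1 h2 *; lia.
  + by apply: pi => q; rewrite /gtime /= addSn.
  + rewrite pairwise_map; apply: sub_pairwise pL => x y /=.
    by rewrite /gfar /gpos /gtime /= ltn_add2r.
- rewrite !big_cat /= !big_map UE mulmxA.
  have st h : stair m.+1 h = \big[mulmx/1%:M]_(q <- iota 0 m.+2) emb m.+3 (m.+1 - q) (h q).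
    by rewrite /stair -(big_mkord xpredT (fun q => emb m.+3 (m.+1 - q) (h q))) /index_iota subn0.
  rewrite !st; congr (_ *m _ *m _).
  rewrite LE; elim: (L) aL => [|x s IHs] /=; first by rewrite !big_nil emb1.
  case/andP => /and4P[xm _ _ _] /IHs{}IHs; rewrite !big_cons -emb_mul // IHs.
  congr (_ *m _); rewrite /dist_gate_op emb_emb //; last by lia.
  by congr (emb _ _ _); move: xm; rewrite /gpos /=; lia.
Qed.

End Circuits.

Section Depth.
Variable R : realType.
Local Notation C := R[i].

Lemma scheduled_cat n D (L L' : seq (gate R)) : scheduled n D L -> scheduled n D L' ->
  allrel [rel x y | gfar x y || (gtime x < gtime y)%N] L L' -> scheduled n D (L ++ L').
Proof.
move=> /andP[a p] /andP[a' p'] LL'; rewrite /scheduled all_cat pairwise_cat.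
by rewrite a a' p p' LL'.
Qed.

Lemma circuit_cat n (L L' : seq (gate R)) : circuit n (L ++ L') = circuit n L *m circuit n L'.
Proof. by rewrite /circuit big_cat. Qed.

Definition supported_on o w (L : seq (gate R)) : bool :=
  all (fun x => (o <= gpos x)%N && ((gpos x).+1 < o + w)%N) L.

Lemma block_circuit n m o (U : op R (bits m.+2)) : (o + m.+2 <= n)%N -> gcl U ->
  exists L, [/\ scheduled n (5 * m).+1 L, supported_on o m.+2 L & emb n o U = circuit n L].
Proof.
move=> on /clifford_synthesis[L [aL pL ->]].
pose mv (x : gate R) : gate R := ((o + (m - gpos x), gtime x)%N, x.2).
exists [seq mv x | x <- L]; split.
- apply/andP; split.
    apply/allP => _ /mapP[x /(allP aL)/and4P[h1 h2 h3 h4] ->]; rewrite /mv /gpos /gtime /=.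
    by rewrite h4 andbT; rewrite /gpos /gtime in h1 h2 h3; lia.
  rewrite pairwise_map; move: aL pL; elim: (L) => //= x s IH /andP[/and4P[xm _ _ _] as_] /andP[xs ps].
  rewrite IH // andbT; apply/allP => y ys; have /(allP xs) := ys; have /(allP as_)/and4P[ym _ _ _] := ys.
  by rewrite /mv /gfar /gpos /gtime /= in xm ym *; lia.
- apply/allP => _ /mapP[x /(allP aL)/and4P[h1 h2 h3 h4] ->]; rewrite /mv /gpos /gtime /=.
  by rewrite /gpos /gtime in h1 h2 h3; lia.
- move: aL {pL}; elim: (L) => [|x s IH] /=; first by rewrite /circuit !big_nil emb1.
  case/andP => /and4P[xm _ _ _] /IH{}IH; rewrite /circuit !big_cons -emb_mul // IH.
  congr (_ *m _); rewrite /dist_gate_op emb_emb //; move: xm; rewrite /gpos /=; lia.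
Qed.

(** Circuits on disjoint blocks share the same time slots, so the depth does not grow with their
    number. *)
Lemma layer_circuit n m e M (U : 'I_M -> op R (bits m.+2)) : (e + M * m.+2 <= n)%N ->
  (forall i, gcl (U i)) ->
  exists L, [/\ scheduled n (5 * m).+1 L, supported_on e (M * m.+2) L &
    \big[mulmx/1%:M]_(i < M) emb n (e + i * m.+2) (U i) = circuit n L].
Proof.
elim: M U => [|M IH] U eMn Ug; first by exists [::]; rewrite /circuit big_nil big_ord0.
have [|L [sL oL LE]] := IH (fun i => U (widen_ord (leqnSn M) i)) _ (fun i => Ug _); first by lia.
have [|L' [sL' oL' LE']] := @block_circuit n m (e + M * m.+2) _ _ (Ug ord_max); first by lia.
exists (L ++ L'); split.
- apply: scheduled_cat => //; apply/allrelP => x y /(allP oL)/andP[x1 x2] /(allP oL')/andP[y1 y2].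
  by rewrite /gfar /=; lia.
- rewrite /supported_on all_cat; apply/andP; split.
    by apply: sub_all oL => x /andP[x1 x2]; lia.
  by apply: sub_all oL' => x /andP[x1 x2]; lia.
- by rewrite big_ord_recr /= LE LE' circuit_cat.
Qed.

Lemma depth_mul n D D' (L L' : seq (gate R)) : scheduled n D L -> scheduled n D' L' ->
  nn_depth_le (D + D') (circuit n L *m circuit n L').
Proof.
move=> /andP[aL pL] /andP[aL' pL'].
pose sh (x : gate R) : gate R := ((gpos x, D + gtime x)%N, x.2).
have -> : circuit n L *m circuit n L' = circuit n (L ++ [seq sh x | x <- L']).
  by rewrite circuit_cat /circuit big_map.
apply: scheduled_depth; apply: scheduled_cat.
- by apply/andP; split=> //; apply: sub_all aL => x /and3P[-> h ->]; rewrite andbT /=; lia.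
- apply/andP; split.
    apply/allP => _ /mapP[x /(allP aL')/and3P[h1 h2 h3] ->].
    by rewrite /sh /gpos /gtime /= in h1 h2 h3 *; rewrite h1 h3 ltn_add2l h2.
  by rewrite pairwise_map; apply: sub_pairwise pL' => x y; rewrite /gfar /gpos /gtime /= ltn_add2l.
- apply/allrelP => x _ /(allP aL)/and3P[_ xt _] /mapP[y _ ->].
  by rewrite /gfar /gpos /gtime /= in xt *; lia.
Qed.

Lemma dl_depth (c : dl_params R) g : dl_support c g ->
  nn_depth_le (2 * (5 * (2 * dl_xi c - 2)).+1) (dl_unitary c g).
Proof.
move=> [g1 g2]; rewrite /dl_unitary dl_layer1E dl_layer2E mul2n -addnn.
have x0 := dl_xi_gt0 c; have N0 := dl_N_gt0 c.
have w2 : (2 * dl_xi c = (2 * dl_xi c - 2).+2)%N by lia.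
have wn2 : (dl_xi c + (dl_N c).-1 * (2 * dl_xi c) <= dl_n c)%N.
  rewrite dl_nE; apply: (@leq_trans ((2 * (dl_N c).-1 + 1) * dl_xi c)%N); first by lia.
  by rewrite leq_mul2r; apply/orP; right; lia.
have wn1 : (0 + (dl_N c) * (2 * dl_xi c) <= dl_n c)%N by rewrite dl_nE; lia.
case: g g1 g2 => a b /= g1 g2.
move: (2 * dl_xi c - 2)%N w2 a b g1 g2 wn1 wn2 => m w2.
rewrite w2 => a b g1 g2 wn1 wn2.
have [L2 [s2 _ ->]] := layer_circuit wn2 (fun i => clifford_gcl (g2 i)).
have [L1 [s1 _ ->]] := layer_circuit wn1 (fun i => clifford_gcl (g1 i)).
exact: depth_mul.
Qed.

End Depth.

(** * Asymptotics *)

Section Asymptotics.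
Variable R : realType.

Lemma ln2_gt0 : 0 < ln 2 :> R.
Proof. by rewrite ln_gt0 // ltr1n. Qed.

Lemma powR2_log2 (x : R) : 0 < x -> 2 `^ (log2 x) = x.
Proof.
move=> x0; rewrite /powR ifF; last by rewrite pnatr_eq0.
by rewrite /log2 divfK ?gt_eqF ?ln2_gt0 // lnK.
Qed.

Lemma log2_powR (x : R) : log2 (2 `^ x) = x.
Proof. by rewrite /log2 ln_powR mulfK // gt_eqF // ln2_gt0. Qed.

Lemma zz_base_sqr (p : R) : 0 <= p <= 1 ->
  (Num.sqrt (1 - p) + Num.sqrt p) ^+ 2 = 1 + 2 * Num.sqrt (p * (1 - p)).
Proof.
move=> /andP[p0 p1]; rewrite sqrrD !sqr_sqrtr ?subr_ge0 // sqrtrM //.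
by rewrite -[_ *+ 2]mulr_natr; ring.
Qed.

Lemma zz_base_ge1 (p : R) : 0 <= p <= 1 -> 1 <= Num.sqrt (1 - p) + Num.sqrt p.
Proof.
move=> p01; have s0 : 0 <= Num.sqrt (1 - p) + Num.sqrt p by rewrite addr_ge0 // sqrtr_ge0.
rewrite -(@ler_pXn2r _ 2) ?nnegrE // expr1n zz_base_sqr //.
by rewrite lerDl mulr_ge0 // sqrtr_ge0.
Qed.

Lemma zz_rate_le1 (p : R) : 0 <= p <= 1 -> zz_rate p <= 1.
Proof.
move=> p01; rewrite /zz_rate gerBl mulr_ge0 // /log2 divr_ge0 ?(ltW ln2_gt0) //.
by rewrite ln_ge0 // zz_base_ge1.
Qed.

Lemma zz_base_powR (p : R) : 0 <= p <= 1 ->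
  1 + 2 * Num.sqrt (p * (1 - p)) = 2 `^ (1 - zz_rate p).
Proof.
move=> p01; rewrite -zz_base_sqr // /zz_rate opprB addrCA subrr addr0 mulrC powRrM.
rewrite powR2_log2; last by rewrite (lt_le_trans ltr01) // zz_base_ge1.
by rewrite powR_mulrn // (le_trans ler01) // zz_base_ge1.
Qed.

Variable c : dl_params R.
Local Notation n := (dl_n c).
Local Notation k := (dl_k c).
Local Notation N := (dl_N c).
Local Notation xi := (dl_xi c).
Local Notation kappa := (dl_kappa c).
Let r : R := k%:R / n%:R.

Lemma dl_rate : r * xi%:R = kappa%:R.
Proof. by rewrite dl_kappaE. Qed.

Lemma dl_eps_ratio : dl_eps c / n%:R = 2 `^ (- xi%:R).
Proof.
rewrite powRN dl_xiE powR2_log2 ?invf_div //.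
by rewrite divr_gt0 ?dl_eps_gt0 // ltr0n dl_n_gt0.
Qed.

Lemma dl_kappa_lt (p : R) : 0 <= p <= 1 -> r < zz_rate p -> (kappa < xi)%N.
Proof.
move=> p01 rr; have r1 : r < 1 := lt_le_trans rr (zz_rate_le1 p01).
by rewrite -(ltr_nat R) -dl_rate gtr_pMl // ltr0n dl_xi_gt0.
Qed.

Lemma dl_etaE : (kappa <= xi)%N ->
  (2 ^+ (xi - kappa))^-1 = (dl_eps c / n%:R) `^ (1 - r) :> R.
Proof.
move=> kx; rewrite dl_eps_ratio -powRrM mulNr mulrBr mulr1 [_ * r]mulrC dl_rate.
by rewrite -natrB // powRN powR_mulrn.
Qed.

(** The weight [g * eta] of an active region: [1 + beta = 2 ^ (1 - zz_rate p)] per qubit, against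
    [eta = 2 ^ - (xi - kappa)]. The rate condition makes it at most 1. *)
Lemma dl_gain (p : R) : 0 <= p <= 1 -> (kappa <= xi)%N ->
  (1 + 2 * Num.sqrt (p * (1 - p))) ^+ xi * (2 ^+ (xi - kappa))^-1 =
  2 `^ (- xi%:R * (zz_rate p - r)).
Proof.
move=> p01 kx; rewrite zz_base_powR // -powR_mulrn ?powR_ge0 // -powRrM.
rewrite -(powR_mulrn (xi - kappa) (ler0n R 2)) -powRN -powRD; last by rewrite pnatr_eq0 implybT.
by congr (_ `^ _); rewrite natrB // -dl_rate; ring.
Qed.

Lemma dl_first_term (p : R) : 0 <= p <= 1 -> (kappa <= xi)%N ->
  ((1 + 2 * Num.sqrt (p * (1 - p))) ^+ xi * (2 ^+ (xi - kappa))^-1) ^+ (2 * N) =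
  2 `^ (- n%:R * (zz_rate p - r)).
Proof.
move=> p01 kx; rewrite dl_gain // -powR_mulrn ?powR_ge0 // -powRrM; congr (_ `^ _).
by rewrite dl_nE !natrM; ring.
Qed.

(** The numerator is [4 n eta], and [n = 2 N xi] with [xi = log2 (n / eps)]. *)
Lemma dl_second_term : (kappa <= xi)%N ->
  4 * dl_eps c `^ (1 - r) * n%:R `^ r / log2 (n%:R / dl_eps c) =
  8 * N%:R * (2 ^+ (xi - kappa))^-1.
Proof.
move=> kx; have n0 : (0 : R) < n%:R by rewrite ltr0n dl_n_gt0.
have x0 : (xi%:R : R) != 0 by rewrite pnatr_eq0 -lt0n dl_xi_gt0.
have -> : dl_eps c `^ (1 - r) = n%:R `^ (1 - r) * (2 ^+ (xi - kappa))^-1.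
  rewrite dl_etaE // -powRM ?divr_ge0 ?(ltW n0) ?(ltW (dl_eps_gt0 c)) //.
  by rewrite mulrCA divff ?mulr1 // gt_eqF.
rewrite -dl_xiE; set eta := (_ ^+ _)^-1.
have nn : n%:R `^ (1 - r) * n%:R `^ r = 2 * N%:R * xi%:R :> R.
  by rewrite -powRD ?(gt_eqF n0) ?implybT // subrK powRr1 ?(ltW n0) // dl_nE !natrM.
by rewrite mulrA [_ * eta * _]mulrAC -!mulrA [X in 4 * X]mulrA nn; field.
Qed.

Lemma expected_choi_error_le_powR (p : R) : 0 <= p <= 1 -> r < zz_rate p ->
  n%:R * (dl_eps c / n%:R) `^ (1 - r) <= 1 ->
  expected_choi_error c (zz_noise p n) <=
    (2 `^ (- n%:R * (zz_rate p - r)) +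
     4 * dl_eps c `^ (1 - r) * n%:R `^ r / log2 (n%:R / dl_eps c)) `^ (1 / 4).
Proof.
move=> p01 rr ne; have kx := ltnW (dl_kappa_lt p01 rr).
rewrite dl_second_term // -dl_first_term //.
rewrite -dl_etaE // in ne.
have := expected_choi_error_le1 kx p01.
have := @expected_choi_error_le R c kx p p01; set eta := (_ ^+ _)^-1 in ne *.
set g := (_ ^+ xi); set delta := _ + _ => H.
have eta0 : 0 <= eta by rewrite invr_ge0 exprn_ge0.
have g0 : 0 <= g by rewrite exprn_ge0 // addr_ge0 // mulr_ge0 // sqrtr_ge0.
have ge1 : g * eta <= 1.
  rewrite /g /eta dl_gain // -[leRHS](powRr0 2) ler_powR ?ler1n // mulNr oppr_le0.
  by rewrite mulr_ge0 // subr_ge0 ltW.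
(* The hypothesis bounds [n * eta], and [2 * N <= n] since regions are nonempty. *)
have Ne1 : (2 * N)%:R * eta <= 1.
  by apply: le_trans ne; rewrite ler_wpM2r // ler_nat dl_nE leq_pmulr // dl_xi_gt0.
have {}H := H ge1 Ne1; set E := expected_choi_error _ _ in H * => E1.
have d0 : 0 <= delta by rewrite addr_ge0 // ?exprn_ge0 // ?mulr_ge0.
have -> : delta `^ (1 / 4) = Num.sqrt (Num.sqrt delta).
  rewrite -!powR12_sqrt ?sqrtr_ge0 ?powR_ge0 // -powRrM; by congr (_ `^ _); field.
(* For [delta >= 1] the error bound 1 suffices; below 1 a further square root only increases. *)
case: (lerP 1 delta) => d1.
  by apply: (le_trans E1); rewrite -[leLHS]sqrtr1 ler_wsqrtr // -[leLHS]sqrtr1 ler_wsqrtr.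
apply: (le_trans H); rewrite -[leLHS]ger0_norm ?sqrtr_ge0 // -sqrtr_sqr ler_wsqrtr // expr2.
by rewrite ler_piMl ?sqrtr_ge0 // -[leRHS]sqrtr1 ler_wsqrtr // ltW.
Qed.

Lemma choi_error_ge0 (L S : finType) noise enc : 0 <= @choi_error R L S noise enc.
Proof.
rewrite /choi_error; set A := [set _ | _ in _].
have [->|/set0P A0] := eqVneq A set0; first by rewrite inf0.
by apply: lb_le_inf => // _ [D _ <-]; exact: sqrtr_ge0.
Qed.

Lemma expected_choi_error_ge0 noise : 0 <= expected_choi_error c noise.
Proof.
rewrite /expected_choi_error /uniform_mean divr_ge0 //.
by apply: sumr_ge0 => g _; exact: choi_error_ge0.
Qed.

End Asymptotics.

(** The little-o hypothesis is used with constant 1, which gives [n * eta <= 1] for large [m]. *)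
Lemma choi_bound_near (R : realType) (p : R) (c : nat -> dl_params R) :
  0 <= p <= 1 ->
  let n m : R := (dl_n (c m))%:R in
  let k m : R := (dl_k (c m))%:R in
  let eps m : R := dl_eps (c m) in
  (\forall m \near \oo, k m / n m < zz_rate p) ->
  (fun m => (eps m / n m) `^ (1 - k m / n m)) =o_\oo (fun m => (n m)^-1) ->
  \forall m \near \oo,
    expected_choi_error (c m) (zz_noise p (dl_n (c m))) <=
    (2 `^ (- n m * (zz_rate p - k m / n m)) +
     4 * eps m `^ (1 - k m / n m) * n m `^ (k m / n m) /
       log2 (n m / eps m)) `^ (1 / 4).
Proof.
move=> p01 n k eps rr /eqoP/(_ 1 ltr01) no.
near=> m; apply: expected_choi_error_le_powR => //; first by near: m.
have n0 : (0 : R) < n m by rewrite ltr0n dl_n_gt0.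
have : `|(eps m / n m) `^ (1 - k m / n m)| <= 1 * `|(n m)^-1| by near: m.
rewrite mul1r !ger0_norm ?invr_ge0 ?powR_ge0 ?(ltW n0) // => h.
by rewrite mulrC -ler_pdivlMr // div1r.
Unshelve. all: by end_near.
Qed.

(** * A parameter family for each rational rate below the threshold *)

Section Rate.
Variable R : realType.

Section FixedRate.
Variables (a q m : nat).
Hypotheses (q0 : (0 < q)%N).
(** The rate is exactly [a / q]. The number of regions is exponential in [m] and their length
    linear, so the depth is of order [log n]; the factor 2 in [xi] gives [eta <= 4 ^ - (m + 1)] once
    [a < q], which beats [N]. *)
Let N := (2 ^ m.+1)%N.
Let xi := (2 * q * m.+1)%N.
Let kappa := (2 * a * m.+1)%N.
Let n := (2 * N * xi)%N.

Fact rate_N_gt0 : (0 < N)%N. Proof. by rewrite expn_gt0. Qed.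
Fact rate_xi_gt0 : (0 < xi)%N. Proof. by rewrite !muln_gt0 q0. Qed.
Fact rate_n_gt0 : (0 < n)%N. Proof. by rewrite !muln_gt0 rate_N_gt0 q0. Qed.

Fact rate_eps_gt0 : 0 < n%:R / 2 ^+ xi :> R.
Proof. by rewrite divr_gt0 ?exprn_gt0 // ltr0n rate_n_gt0. Qed.

Fact rate_xiE : xi%:R = log2 (n%:R / (n%:R / 2 ^+ xi)) :> R.
Proof.
rewrite invf_div mulrCA divff ?mulr1 ?gt_eqF ?ltr0n ?rate_n_gt0 //.
by rewrite -powR_mulrn // log2_powR.
Qed.

Fact rate_kappaE : kappa%:R = (2 * N * kappa)%:R / n%:R * xi%:R :> R.
Proof.
have nz : (n%:R : R) != 0 by rewrite pnatr_eq0 -lt0n rate_n_gt0.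
apply: (mulIf nz); rewrite mulrAC divfK // -!natrM; congr (_%:R).
by rewrite /n; ring.
Qed.

Definition rate_params : dl_params R :=
  @DLParams R n (2 * N * kappa) (n%:R / 2 ^+ xi) N xi kappa
    rate_N_gt0 rate_xi_gt0 rate_eps_gt0 erefl rate_xiE rate_kappaE.

Lemma rate_paramsE : (dl_k rate_params)%:R / (dl_n rate_params)%:R = a%:R / q%:R :> R.
Proof.
have nz : (n%:R : R) != 0 by rewrite pnatr_eq0 -lt0n rate_n_gt0.
have qz : (q%:R : R) != 0 by rewrite pnatr_eq0 -lt0n.
apply: (mulIf nz); rewrite divfK // mulrAC; apply: (mulIf qz); rewrite divfK // -!natrM.
by congr (_%:R); rewrite /= /n /xi /kappa; ring.
Qed.

Lemma rate_params_gt : (m < dl_n rate_params)%N.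
Proof.
have h : (m < N)%N by apply: leq_ltn_trans (leqnSn m) _; exact: ltn_expl.
rewrite /= /n; have := rate_xi_gt0; nia.
Qed.

Lemma rate_error_le (p : R) : 0 <= p <= 1 -> a%:R / q%:R < zz_rate p ->
  expected_choi_error rate_params (zz_noise p _) <=
    Num.sqrt ((2 `^ (- (zz_rate p - a%:R / q%:R))) ^+ m + 8 * 2^-1 ^+ m).
Proof.
move=> p01 rr; have rr' := rr; rewrite -rate_paramsE in rr'.
have kx := dl_kappa_lt p01 rr'.
have aq : (a < q)%N.
  by move: kx; rewrite /= /xi /kappa ltn_pmul2r // ltn_pmul2l.
have G := @dl_gain R rate_params p p01 (ltnW kx); rewrite rate_paramsE in G.
have eta_le : (2 ^+ (xi - kappa))^-1 <= 2^-1 ^+ (2 * m.+1) :> R.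
  rewrite -exprVn ler_wiXn2l ?invr_ge0 ?invf_le1 ?ler1n // /xi /kappa.
  rewrite -mulnBl -mulnBr leq_mul2r; apply/orP; right; lia.
have eta0 : 0 <= (2 ^+ (xi - kappa))^-1 :> R by rewrite invr_ge0 exprn_ge0.
have NEta : N%:R * (2 ^+ (xi - kappa))^-1 <= 2^-1 ^+ m.+1 :> R.
  apply: (@le_trans _ _ (N%:R * 2^-1 ^+ (2 * m.+1))); first by rewrite ler_wpM2l.
  by rewrite mul2n -addnn exprD mulrA /N natrX exprVn divff ?mul1r // expf_neq0 // pnatr_eq0.
have half1 k : 2^-1 ^+ k <= 1 :> R by rewrite exprn_ile1 ?invr_ge0 ?invf_le1 ?ler1n.
have x1 : (1 : R) <= xi%:R by rewrite ler1n rate_xi_gt0.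
have d0 : 0 < zz_rate p - a%:R / q%:R by rewrite subr_gt0.
have rho1 : 2 `^ (- (zz_rate p - a%:R / q%:R)) <= 1.
  by rewrite -[leRHS](powRr0 2) ler_powR ?ler1n // oppr_le0 ltW.
have gain_le : 2 `^ (- xi%:R * (zz_rate p - a%:R / q%:R)) <= 2 `^ (- (zz_rate p - a%:R / q%:R)).
  by rewrite ler_powR ?ler1n // mulNr lerN2 ler_peMl // ltW.
apply: (le_trans (@expected_choi_error_le R rate_params (ltnW kx) p p01 _ _)).
- by rewrite G (le_trans gain_le).
- rewrite /= natrM -mulrA; apply: (le_trans (ler_wpM2l _ NEta)) => //.
  by rewrite exprS mulrA divff ?mul1r ?pnatr_eq0.
rewrite ler_wsqrtr // G lerD //.
  apply: (@le_trans _ _ ((2 `^ (- (zz_rate p - a%:R / q%:R))) ^+ (2 * N))).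
    by rewrite lerXn2r ?nnegrE ?powR_ge0.
  rewrite ler_wiXn2l ?powR_ge0 //.
  have h : (m < N)%N by apply: leq_ltn_trans (leqnSn m) _; exact: ltn_expl.
  by rewrite (leq_trans (ltnW h)) // leq_pmull.
rewrite -mulrA ler_wpM2l // (le_trans NEta) // ler_wiXn2l ?invr_ge0 ?invf_le1 ?ler1n //.
Qed.

End FixedRate.

Lemma zz_achieves_rate (p : R) : 0 <= p <= 1 -> achieves_rate (zz_noise p) (zz_rate p).
Proof.
move=> p01 r r0 rr.
have [a [q [q0 rE]]] : exists a q : nat, (0 < q)%N /\ ratr r = a%:R / q%:R :> R.
  exists `|numq r|%N, `|denq r|%N; split; first by rewrite absz_gt0 denq_neq0.
  by rewrite /ratr -[in LHS](gez0_abs (_ : 0 <= numq r)) ?numq_ge0 // -[in LHS]absz_denq.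
rewrite rE in rr *.
exists (fun m => rate_params a m q0),
  (fun m => 2 * (5 * (2 * (2 * q * m.+1) - 2)).+1)%N; split.
- apply/cvgryPge => A; near=> m; apply: (@le_trans _ _ m%:R).
    by near: m; exact: nbhs_infty_ger.
  by rewrite ler_nat ltnW // rate_params_gt.
- by move=> m; exact: rate_paramsE.
- by move=> m g; exact: dl_depth.
(* The depth is [40 q (m + 1) - 18], and [n >= 2 ^ (m + 1)] gives [log2 n >= m + 1]. *)
- apply/eqO_exP; exists (40 * q%:R) => /=; first by rewrite mulr_gt0 // ltr0n.
  apply: nearW => m; rewrite ger0_norm //.
  have L : m.+1%:R <= log2 (dl_n (rate_params a m q0))%:R :> R.
    rewrite -[leLHS](@log2_powR R) /log2 ler_pM2r ?invr_gt0 ?ln2_gt0 //.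
    rewrite ler_ln ?posrE ?powR_gt0 // ?ltr0n ?rate_n_gt0 //.
    rewrite powR_mulrn // -natrX ler_nat /=.
    have := rate_xi_gt0 m q0; nia.
  apply: (@le_trans _ _ (40 * q%:R * m.+1%:R)).
    by rewrite -!natrM ler_nat; nia.
  by rewrite ler_wpM2l ?mulr_ge0 // (le_trans L) // ler_norm.
- have rho : `|2 `^ (- (zz_rate p - a%:R / q%:R))| < 1 :> R.
    rewrite ger0_norm ?powR_ge0 // -[ltRHS](powRr0 2) /powR ifF ?pnatr_eq0 //.
    by rewrite ltr_expR mul0r mulNr oppr_lt0 mulr_gt0 ?ln2_gt0 // subr_gt0.
  apply: (squeeze_cvgr (f := fun=> 0) (h := fun m =>
    Num.sqrt ((2 `^ (- (zz_rate p - a%:R / q%:R))) ^+ m + 8 * 2^-1 ^+ m))).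
  + by apply: nearW => m; rewrite expected_choi_error_ge0 rate_error_le.
  + exact: cvg_cst.
  + have half : `|2^-1| < 1 :> R by rewrite ger0_norm ?invr_ge0 // invf_lt1 // ltr1n.
    have H := cvgD (cvg_expr rho) (cvgM (cvg_cst (8 : R)) (cvg_expr half)).
    have := continuous_cvg _ (@sqrt_continuous R _) (H _ _ _).
    by rewrite mulr0 addr0 sqrtr0; apply.
Unshelve. all: by end_near.
Qed.

End Rate.

Theorem corollary7 (R : realType) (p : R) (hp : 0 <= p <= 1) :
  (forall c : nat -> dl_params R,
     let n m : R := (dl_n (c m))%:R in
     let k m : R := (dl_k (c m))%:R in
     let eps m : R := dl_eps (c m) in
     n m @[m --> \oo] --> (+oo : set_system R) ->
     (\forall m \near \oo, k m / n m < zz_rate p) ->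
     (fun m => (eps m / n m) `^ (1 - k m / n m)) =o_\oo (fun m => (n m)^-1) ->
     \forall m \near \oo,
       expected_choi_error (c m) (zz_noise p (dl_n (c m))) <=
       (2 `^ (- n m * (zz_rate p - k m / n m)) +
        4 * eps m `^ (1 - k m / n m) * n m `^ (k m / n m) /
          log2 (n m / eps m)) `^ (1 / 4))
  /\ achieves_rate (zz_noise p) (zz_rate p).
Proof.
split; last exact: zz_achieves_rate.
by move=> c n k eps _ rr no; exact: choi_bound_near.
Qed.
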